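(* Let $\bar{C}$ be the algebra of complex polynomial functions on $M_6(\mathbb{C})$ invariant under conjugation by $\mathrm{Sp}_6$. For $z\in M_6(\mathbb{C})$ put $x=\tfrac12(z+z^* )$ and $y=\tfrac12(z-z^* )$, where $z^*$ is the symplectic adjoint of $z$. Let \begin{align*} W_2^{\#}=\{\,& x;\ x^2,\ y^2;\ x^3,\ xy^2;\ x^2y^2,\ (xy)^2,\ y^4;\ x^2yxy,\ xy^4;\\ & (x^2y)^2,\ x^2y^2xy,\ xy^3xy,\ y^6;\ (xy^3)^2\,\}. \end{align*} Then the set of $15$ invariants $\mathrm{tr}\,W_2^{\#}=\{\mathrm{tr}\,w(x,y) : w\in W_2^{\#}\}$ is a homogeneous system of parameters (HSOP) of the algebra $\bar{C}$.
   Context: $M_k=M_k(\mathbb{C})$ is the algebra of complex $k\times k$ matrices and $X^T$ is the transpose of $X$. The symplectic group is $\mathrm{Sp}_{2n}=\{A\in \mathrm{GL}_{2n}(\mathbb{C}) : A^TJA=J\}$ with $J=\begin{bmatrix}0&-I_n\\ I_n&0\end{bmatrix}$. The symplectic adjoint of $X\in M_{2n}$ is $X^*=J^{-1}X^TJ$; the map $X\mapsto X^*$ is an involutory anti-automorphism of the algebra $M_{2n}$. Here $n=3$. $\bar{C}$ is the algebra of complex (holomorphic) polynomial functions on $M_6$ invariant under the action $a\cdot z=aza^{-1}$, $a\in\mathrm{Sp}_6$. Writing $z=x+y$ with $x^*=x$ and $y^*=-y$, the algebra $\bar{C}$ is $\mathbb{Z}^2$-graded by the degrees in the entries of $x$ and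 of $y$; the function $z\mapsto\mathrm{tr}\,w(x,y)$ is a bihomogeneous invariant whose bidegree is the pair (number of occurrences of $x$ in $w$, number of occurrences of $y$ in $w$). The total degree is the sum of the two degrees. A homogeneous system of parameters (HSOP) of $\bar{C}$ is a finite set of algebraically independent homogeneous elements of positive degree such that $\bar{C}$ is a finitely generated module over the subalgebra they generate. *)

(* Defs.v *)
From mathcomp Require Import all_boot all_order all_algebra.
From mathcomp Require Import reals.
From mathcomp Require Import complex.
From mathcomp Require Import mpoly.

Set Implicit Arguments.
Unset Strict Implicit.
Unset Printing Implicit Defensive.

Import GRing.Theory.
Local Open Scope ring_scope.

(* 2n x 2n matrices have type 'M_(n + n); the field K of coefficients is taken *)
(* to be the complex numbers R[i] in the theorem.                              *)
Section SymplecticInvariants.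
Variables (K : fieldType) (n : nat).

Definition sympJ : 'M[K]_(n + n) := block_mx 0 (- 1%:M) 1%:M 0.

Definition in_Sp (a : 'M[K]_(n + n)) : Prop :=
  a \in unitmx /\ a^T *m sympJ *m a = sympJ.

Definition sadj (z : 'M[K]_(n + n)) : 'M[K]_(n + n) :=
  invmx sympJ *m z^T *m sympJ.

Definition xpart (z : 'M[K]_(n + n)) : 'M[K]_(n + n) := 2^-1 *: (z + sadj z).

Definition ypart (z : 'M[K]_(n + n)) : 'M[K]_(n + n) := 2^-1 *: (z - sadj z).

Definition polyfun (f : 'M[K]_(n + n) -> K) : Prop :=
  exists P : {mpoly K[(n + n) * (n + n)]},
    forall z, f z = P.@[fun k => mxvec z 0 k].

Definition Sp_invariant (f : 'M[K]_(n + n) -> K) : Prop :=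
  forall a, in_Sp a -> forall z, f (a *m z *m invmx a) = f z.

Definition Cbar (f : 'M[K]_(n + n) -> K) : Prop :=
  polyfun f /\ Sp_invariant f.

(* The first block of variables of P stands for the entries of x, the second   *)
(* block for the entries of y. The entries of x (and those of y) satisfy       *)
(* linear relations, so P is not unique; since these relations are themselves  *)
(* bihomogeneous, the bidegree of f is nevertheless well defined for f <> 0.   *)
Definition bihomogeneous (d e : nat) (f : 'M[K]_(n + n) -> K) : Prop :=
  exists P : {mpoly K[(n + n) * (n + n) + (n + n) * (n + n)]},
    (forall m, m \in msupp P ->
       (\sum_k m (lshift _ k) = d)%N /\ (\sum_k m (rshift _ k) = e)%N) /\
    (forall z, f z = P.@[fun k => row_mx (mxvec (xpart z)) (mxvec (ypart z)) 0 k]).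

Definition alg_independent (k : nat) (f : 'I_k -> 'M[K]_(n + n) -> K) : Prop :=
  forall P : {mpoly K[k]}, (forall z, P.@[fun i => f i z] = 0) -> P = 0.

Definition gen_subalg (k : nat) (f : 'I_k -> 'M[K]_(n + n) -> K)
    (h : 'M[K]_(n + n) -> K) : Prop :=
  exists P : {mpoly K[k]}, forall z, h z = P.@[fun i => f i z].

Definition Cbar_finite_over (S : ('M[K]_(n + n) -> K) -> Prop) : Prop :=
  exists (m : nat) (g : 'I_m -> 'M[K]_(n + n) -> K),
    (forall j, Cbar (g j)) /\
    (forall h, Cbar h -> exists c : 'I_m -> 'M[K]_(n + n) -> K,
       (forall j, S (c j)) /\ (forall z, h z = \sum_(j < m) c j z * g j z)).

(* A finite set is given as an indexed family; algebraic independence forces   *)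
(* its members to be pairwise distinct.                                        *)
Definition is_HSOP (k : nat) (f : 'I_k -> 'M[K]_(n + n) -> K) : Prop :=
  [/\ forall i, Cbar (f i),
      forall i, exists d e, (0 < d + e)%N /\ bihomogeneous d e (f i),
      alg_independent f
    & Cbar_finite_over (gen_subalg f)].

End SymplecticInvariants.

Definition W2sharp (A : pzRingType) (x y : A) : 15.-tuple A :=
  [tuple x;
         x ^+ 2; y ^+ 2;
         x ^+ 3; x * y ^+ 2;
         x ^+ 2 * y ^+ 2; (x * y) ^+ 2; y ^+ 4;
         x ^+ 2 * y * x * y; x * y ^+ 4;
         (x ^+ 2 * y) ^+ 2;
         x ^+ 2 * y ^+ 2 * x * y; x * y ^+ 3 * x * y; y ^+ 6;
         (x * y ^+ 3) ^+ 2].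

Definition trW2sharp (K : fieldType) (i : 'I_15) (z : 'M[K]_(3 + 3)) : K :=
  \tr (tnth (W2sharp (xpart z) (ypart z)) i).

(* Main.v *)
(* Algebraic independence follows from one integral point where the Jacobian of
   the traces along 15 directions is triangular and invertible.

   For finiteness, suppose that all the traces vanish at z = x + y. The power
   traces make x and y nilpotent, and the mixed traces produce a common kernel
   vector v of x and y. Passing to the orthogonal complement of v modulo v and
   iterating gives a symplectic basis in which x and y are strictly upper
   triangular; a one-parameter torus of Sp then contracts z to 0, so every
   homogeneous invariant of positive degree vanishes at z. By the Nullstellensatz
   (proved for uncountable fields) a power of each such invariant lies in the
   ideal of the traces. Since Sp is stable under conjugate transposition, the
   Fischer inner product on polynomials splits off the invariants equivariantly,
   so the coefficients of such an ideal membership can be taken invariant. With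
   Hilbert's basis theorem this makes the invariants a finite module over the
   algebra generated by the traces. *)

(* The number 15 is dim M_6 - dim Sp_6 = 36 - 21. The nullcone argument rests on eigenvalue pairing:
   the eigenvalues of a self-adjoint x are doubled, so tr x, tr x^2, tr x^3 already give x^3 = 0,
   while those of a skew-adjoint y come in pairs a, -a, so tr y^2, tr y^4, tr y^6 give y^6 = 0.
   Besides x = 0 this leaves two shapes of x: x^2 = 0, where x has rank 2 and the words xy^4 and
   (xy^3)^2 are needed, and Jordan type (3,3), where the mixed words containing x^2 come in. The
   Fischer product stands in for averaging over a compact form of Sp: in bounded degree the
   invariants and the span of all gq - q are orthogonal complements, so a Reynolds operator comes
   from linear algebra alone. Uncountability of the field reduces the Nullstellensatz to counting
   dimensions. *)
Require Import Defs.
From HB Require Import structures.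
From mathcomp Require Import all_boot all_order all_algebra.
From mathcomp Require Import boolp classical_sets.
From mathcomp Require Import reals.
From mathcomp Require Import complex.
From mathcomp Require Import mpoly ssrcomplements.
From mathcomp Require Import ring zify.
From mathcomp Require cardinality lebesgue_measure.
Set Implicit Arguments.
Unset Strict Implicit.
Unset Printing Implicit Defensive.
Import Order.TTheory GRing.Theory Num.Theory.
Local Open Scope ring_scope.

(** * Hilbert's basis theorem and the Nullstellensatz *)

Lemma mnm_ind n (Q : 'X_{1..n} -> Prop) :
  Q 0%MM -> (forall i m, Q m -> Q (U_(i) + m)%MM) -> forall m, Q m.
Proof.
move=> Q0 QS m; have [d] := ubnP (mdeg m); elim: d => // d IH in m *.
have [->//|m0] := eqVneq m 0%MM; rewrite ltnS => lemd.
have [i mi] : exists i, m i != 0%N.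
  apply/existsP; rewrite -negb_forall; apply: contra m0 => /forallP m0.
  by apply/eqP/mnmP => i; rewrite mnm0E; apply/eqP.
rewrite -(submK (m := U_(i)) (m' := m)) ?lep1mP // addmC; apply/QS/IH.
apply: leq_trans lemd; rewrite -{2}(submK (m := U_(i)) (m' := m)) ?lep1mP //.
by rewrite mdegD mdeg1 addn1.
Qed.

Section Ideals.
Variables (K : fieldType) (n : nat).
Implicit Types (p q : {mpoly K[n]}) (J : {mpoly K[n]} -> Prop).

Definition is_ideal J :=
  [/\ J 0, forall p q, J p -> J q -> J (p + q) & forall a p, J p -> J (a * p)].

Lemma ideal_sum J (I : Type) (r : seq I) (P : pred I) (F : I -> {mpoly K[n]}) :
  is_ideal J -> (forall i, P i -> J (F i)) -> J (\sum_(i <- r | P i) F i).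
Proof. by case=> J0 JD _ JF; elim/big_ind: _ => //; exact: JD. Qed.

Lemma idealB J p q : is_ideal J -> J p -> J q -> J (p - q).
Proof. by case=> _ JD JM Jp Jq; apply: JD => //; rewrite -mulN1r; apply: JM. Qed.

Definition span_ideal k (F : 'I_k -> {mpoly K[n]}) p :=
  exists a : 'I_k -> {mpoly K[n]}, p = \sum_i a i * F i.

Lemma span_ideal_ideal k (F : 'I_k -> {mpoly K[n]}) : is_ideal (span_ideal F).
Proof.
split.
- by exists (fun=> 0); rewrite big1 // => i _; rewrite mul0r.
- move=> _ _ [a ->] [b ->]; exists (fun i => a i + b i).
  by rewrite -big_split; apply: eq_bigr => i _; rewrite mulrDl.
- move=> b _ [a ->]; exists (fun i => b * a i).
  by rewrite mulr_sumr; apply: eq_bigr => i _; rewrite mulrA.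
Qed.

Lemma span_ideal_gen k (F : 'I_k -> {mpoly K[n]}) i : span_ideal F (F i).
Proof.
exists (fun j => (j == i)%:R); rewrite (bigD1 i) //= eqxx mul1r big1 ?addr0 //.
by move=> j /negPf ->; rewrite mul0r.
Qed.

Lemma exists_minimal (T U : Type) (f : T -> U) (R : U -> U -> Prop) (P : T -> Prop) :
  well_founded R -> (exists x, P x) ->
  exists2 x, P x & forall y, P y -> ~ R (f y) (f x).
Proof.
move=> wfR [x Px]; apply: contrapT => nomin; move: Px.
have [u] : exists u, u = f x by exists (f x).
elim/(well_founded_ind wfR): u x => u IH x def_u Px.
by apply: nomin; exists x => // y Py; rewrite -def_u => /IH /(_ _ (erefl _)).
Qed.

(** [mu N] is a position from [N] on where [a] is smallest; one jumps from each such minimum to the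
    minimum of what follows it. *)
Lemma nondecreasing_subsequence (a : nat -> nat) : exists2 phi : nat -> nat,
  {homo phi : i j / (i < j)%N} & {homo a \o phi : i j / (i <= j)%N}.
Proof.
have /choice [mu muP] : forall N, exists i, (N <= i)%N /\ forall j, (N <= j)%N -> (a i <= a j)%N.
  move=> N; have [||i Ni imin] := @exists_minimal _ _ a (fun i j => (i < j)%N) (fun i => (N <= i)%N).
  - by elim/ltn_ind => i IH; constructor.
  - by exists N.
  by exists i; split=> // j Nj; rewrite leqNgt; apply/negP; exact: imin.
pose fix phi k := if k is k'.+1 then mu (phi k').+1 else mu 0%N.
have phiS k : (phi k < phi k.+1)%N by case: (muP (phi k).+1).
have phi_inc : {homo phi : i j / (i < j)%N} by apply: homo_ltn => // i j k; exact: ltn_trans.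
exists phi => // i j; rewrite leq_eqVlt => /orP[/eqP -> //|/phi_inc lt_ij] /=.
case: i lt_ij => [|i] lt_ij /=.
  by have [_] := muP 0%N; apply.
by have [le_mu] := muP (phi i).+1; apply; apply: leq_trans le_mu (ltnW lt_ij).
Qed.

(** Subsequences are refined coordinate by coordinate; each refinement keeps the coordinates that
    are already monotone. *)
Lemma dickson (m : nat -> 'X_{1..n}) : exists i j, (i < j)%N /\ (m i <= m j)%MM.
Proof.
suff /(_ n) [phi phi_inc phi_mon] : forall k, exists2 phi : nat -> nat,
    {homo phi : i j / (i < j)%N} &
    forall l : 'I_n, (l < k)%N -> {homo (fun i => m (phi i) l) : i j / (i <= j)%N}.
  exists (phi 0%N), (phi 1%N); split; first exact: phi_inc.
  by apply/mnm_lepP => l; exact: phi_mon.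
elim=> [|k [phi phi_inc phi_mon]]; first by exists id.
have [kn|nk] := ltnP k n; last first.
  by exists phi => // l _; apply: phi_mon; exact: leq_trans nk.
have [psi psi_inc psi_mon] := nondecreasing_subsequence (fun i => m (phi i) (Ordinal kn)).
exists (phi \o psi) => [i j /psi_inc /phi_inc //|l].
rewrite ltnS leq_eqVlt => /orP[/eqP lk|lk] i j le_ij.
  by rewrite (_ : l = Ordinal kn); [exact: psi_mon | exact: val_inj].
apply: phi_mon => //; move: le_ij; rewrite leq_eqVlt => /orP[/eqP -> //|/psi_inc].
exact: ltnW.
Qed.

Lemma mlead_reduce p q : p != 0 -> q != 0 -> (mlead p <= mlead q)%MM ->
  exists a, q - a * p = 0 \/ (mlead (q - a * p) < mlead q)%O.
Proof.
move=> p0 q0 le_pq; exists ((mleadc q / mleadc p) *: 'X_[mlead q - mlead p]).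
set a := _ *: _; have [->|r0] := eqVneq (q - a * p) 0; [by left|right].
have c0 : mleadc p != 0 by rewrite mleadc_eq0.
have ca0 : mleadc q / mleadc p != 0 by rewrite mulf_neq0 ?invr_eq0 ?mleadc_eq0.
have a0 : a != 0 by rewrite -mleadc_eq0 mleadZ // mleadXm mcoeffZ mcoeffX eqxx mulr1.
have lead_ap : mlead (a * p) = mlead q by rewrite mleadM // mleadZ // mleadXm submK.
rewrite lt_neqAle; apply/andP; split; last first.
  by apply: le_trans (mleadB_le _ _) _; rewrite lead_ap joinxx.
apply: contraNneq r0 => e; rewrite -mleadc_eq0 e mcoeffB.
rewrite -[X in (a * p)@_X]lead_ap mleadM // mleadcM mleadZ // mleadXm mcoeffZ mcoeffX eqxx mulr1.
by rewrite divfK // subrr.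
Qed.

(** The intersection of all ideals containing [s]: membership passes between lists of different
    lengths without coefficient families. *)
Definition ideal_gen (s : seq {mpoly K[n]}) p :=
  forall J, is_ideal J -> (forall g, g \in s -> J g) -> J p.

Lemma ideal_gen_ideal s : is_ideal (ideal_gen s).
Proof.
split=> [J JI _|p q sp sq J JI Js|a p sp J JI Js]; have [J0 JD JM] := JI => //.
- by apply: JD; [exact: sp | exact: sq].
- by apply: JM; exact: sp.
Qed.

Lemma mem_ideal_gen s p : p \in s -> ideal_gen s p.
Proof. by move=> sp J _; apply. Qed.

(** [H] is any set, and the generators are found inside it; later they have to be homogeneous
    invariants. If no finite part of [H] sufficed, one could keep adding an element of least leading
    monomial outside the ideal reached so far. Dickson's lemma makes one leading monomial divide a
    later one, and a division step contradicts minimality. *)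
Theorem hilbert_basis (H : {mpoly K[n]} -> Prop) :
  exists (k : nat) (G : 'I_k -> {mpoly K[n]}),
    (forall i, H (G i)) /\ forall p, H p -> span_ideal G p.
Proof.
suff [s sH genH] : exists2 s, forall p, p \in s -> H p & forall p, H p -> ideal_gen s p.
  exists (size s), (fun i => s`_i); split=> [i|p /genH sp]; first by apply/sH/mem_nth.
  apply: (sp _ (span_ideal_ideal _)) => g /(nthP 0) [i ltis <-].
  exact: (span_ideal_gen _ (Ordinal ltis)).
apply: contrapT => nofin.
(* Minimal elements are chosen in the ideal [I] generated by [H], since the remainder of a division
   may leave [H]. *)
pose I p := exists2 s, forall g, g \in s -> H g & ideal_gen s p.
have II : is_ideal I.
  split; first by exists [::] => // J [].
  - move=> p q [s sH sp] [t tH tq]; exists (s ++ t).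
      by move=> g; rewrite mem_cat => /orP[/sH|/tH].
    have [_ JD _] := ideal_gen_ideal (s ++ t).
    by apply: JD => J JI Jst; [apply: sp | apply: tq] => // g gs; apply: Jst;
       rewrite mem_cat gs ?orbT.
  - move=> a p [s sH sp]; exists s => //.
    by have [_ _ JM] := ideal_gen_ideal s; exact: JM.
have HI p : H p -> I p.
  by move=> Hp; exists [:: p] => [g|]; [rewrite inE => /eqP -> | apply: mem_ideal_gen; rewrite inE].
have step (s : seq {mpoly K[n]}) : (forall p, p \in s -> I p) -> exists g,
    [/\ I g, ~ ideal_gen s g & forall q, I q -> ~ ideal_gen s q -> ~ (mlead q < mlead g)%O].
  move=> sI; have [t tH st] : exists2 t, forall g, g \in t -> H g &
      forall p, p \in s -> ideal_gen t p.
    elim: s sI => [|p s IH] sI; first by exists [::].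
    have [|t tH st] := IH; first by move=> q qs; apply: sI; rewrite inE qs orbT.
    have [|u uH up] := sI p; first by rewrite inE eqxx.
    exists (u ++ t) => [g|q]; first by rewrite mem_cat => /orP[/uH|/tH].
    rewrite inE => /orP[/eqP -> |/st tq] J JI Jut; [apply: up | apply: tq] => // g gu;
      by apply: Jut; rewrite mem_cat gu ?orbT.
  have [||g [Ig sg] gmin] := @exists_minimal _ _ (@mlead _ _) (fun m1 m2 => m1 < m2)%O (fun p => I p /\ ~ ideal_gen s p).
  - exact: ltom_wf.
  - apply: contrapT => /forallNP sH; apply: nofin; exists t => // p Hp J JI Jt.
    have : ideal_gen s p by apply: contrapT => ?; apply: (sH p); split=> //; exact: HI.
    by apply=> // g /st; apply.
  by exists g; split=> // q Iq sq; exact: gmin.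
have /choice [e eP] : forall s, exists g, (forall p, p \in s -> I p) ->
    [/\ I g, ~ ideal_gen s g & forall q, I q -> ~ ideal_gen s q -> ~ (mlead q < mlead g)%O].
  move=> s; have [/step [g gP]|sI] := pselect (forall p, p \in s -> I p); first by exists g.
  by exists 0 => /sI.
pose fix s k := if k is k'.+1 then e (s k') :: s k' else [::].
have sI k : forall p, p \in s k -> I p.
  by elim: k => //= k IH p; rewrite inE => /orP[/eqP ->|/IH //]; case: (eP _ IH).
have smem i j : (i < j)%N -> e (s i) \in s j.
  elim: j => // j IH; rewrite ltnS leq_eqVlt inE => /orP[/eqP ->|/IH ->]; first by rewrite eqxx.
  by rewrite orbT.
have [i [j [lt_ij le_ij]]] := dickson (fun k => mlead (e (s k))).
have nz k : e (s k) != 0.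
  apply/eqP => e0; have [_ + _] := eP _ (sI k); apply; rewrite e0.
  by have [] := ideal_gen_ideal (s k).
have [a ra] := mlead_reduce (nz i) (nz j) le_ij.
have [Ij sj minj] := eP _ (sI j).
have sja : ideal_gen (s j) (a * e (s i)).
  have [_ _ JM] := ideal_gen_ideal (s j); apply: JM; apply: mem_ideal_gen; exact: smem.
case: ra => [/eqP|]; first by rewrite subr_eq0 => /eqP e0; apply: sj; rewrite e0.
apply: minj.
  by apply: idealB => //; have [_ _ JM] := II; apply: JM; have [] := eP _ (sI i).
move=> sr; apply: sj; rewrite -[e _](subrK (a * e (s i))).
by have [_ JD _] := ideal_gen_ideal (s j); exact: JD.
Qed.

(** There are only [M] monomials of degree below [D], so the coefficient matrix of [M.+1] terms has
    a nonzero left kernel. *)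
Lemma mpoly_dependent D (u : nat -> {mpoly K[n]}) :
  (forall k, (msize (u k) <= D)%N) ->
  exists (N : nat) (c : 'I_N -> K), (exists j, c j != 0) /\ \sum_j c j *: u j = 0.
Proof.
move=> szu; set M := #|{: 'X_{1..n < D}}|.
pose A : 'M[K]_(M.+1, M) := \matrix_(i, j) (u i)@_(enum_val j : 'X_{1..n < D}).
have : kermx A != 0.
  rewrite -mxrank_eq0 mxrank_ker subn_eq0 -ltnNge.
  by apply: leq_ltn_trans (rank_leq_col A) _.
case/rowV0Pn => v /sub_kermxP vA v0; exists M.+1, (v 0); split.
  apply/existsP; rewrite -negb_forall; apply: contra v0 => /forallP v0.
  by apply/eqP/rowP => j; rewrite mxE; apply/eqP.
apply/mpolyP => m; rewrite mcoeff0 raddf_sum /=.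
have [ltm|gem] := ltnP (mdeg m) D; last first.
  rewrite big1 // => i _; rewrite mcoeffZ memN_msupp_eq0 ?mulr0 //.
  by apply: msize_mdeg_ge; apply: leq_trans gem.
have /rowP/(_ (enum_rank (BMultinom ltm))) := vA.
rewrite mxE [in RHS]mxE => vAm; rewrite -[RHS]vAm.
by apply: eq_bigr => i _; rewrite mcoeffZ [A _ _]mxE enum_rankK.
Qed.

End Ideals.

(** * The Nullstellensatz over an uncountable algebraically closed field *)

Section Nullstellensatz.
Variables (K : closedFieldType) (n : nat).
Implicit Types (p q h : {mpoly K[n]}) (J : {mpoly K[n]} -> Prop).

(** [q] splits into linear factors, and primality puts one of them in [J]; the leading coefficient,
    a unit, cannot lie there. *)
Lemma horner_mpoly_prime J (q : {poly K}) i :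
  is_ideal J -> (forall a b, J (a * b) -> J a \/ J b) -> ~ J 1 ->
  q != 0 -> J (map_poly (@mpolyC n K) q).['X_i] ->
  exists b, J ('X_i - b%:MP).
Proof.
move=> JI Jprime J1 q0; have [r ->] := closed_field_poly_normal q.
elim: r => [|b r IH] in q0 *.
  rewrite big_nil alg_polyC map_polyC hornerC /= => Jc; exfalso; apply: J1.
  have [_ _ JM] := JI; have := JM ((lead_coef q)^-1)%:MP _ Jc.
  by rewrite -rmorphM mulVf ?lead_coef_eq0.
rewrite big_cons scalerAr rmorphM hornerM rmorphB /= map_polyX map_polyC.
by rewrite !hornerE => /Jprime[]; [exists b | exact: IH].
Qed.

Hypothesis K_uncountable : forall S : nat -> seq K, exists a, forall k, a \notin S k.

(** If all fibres of [w] were finite, the field would be a countable union of finite sets. *)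
Lemma inf_uncountable (w : K -> nat) : exists d, exists2 a : nat -> K,
  injective a & forall k, w (a k) = d.
Proof.
apply: contrapT => /forallNP fin.
have bnd d : exists s : seq K, forall a, w a = d -> a \in s.
  apply: contrapT => /forallNP unb; apply: (fin d).
  have ext (s : seq K) : exists a, w a = d /\ a \notin s.
    by apply: contrapT => H; apply: (unb s) => a wa; apply: contrapT => /negP sa; apply: H; exists a.
  have /choice [e eP] := ext.
  pose fix s k := if k is k'.+1 then e (s k') :: s k' else [::].
  exists (fun k => e (s k)); last by move=> k; case: (eP (s k)).
  have sub j k : (j < k)%N -> e (s j) \in s k.
    elim: k => // k IH; rewrite ltnS leq_eqVlt inE => /orP[/eqP->|/IH ->]; first by rewrite eqxx.
    by rewrite orbT.
  move=> j k ejk; case: (ltngtP j k) => // /sub.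
    by rewrite ejk; have [_ /negPf ->] := eP (s k).
  by rewrite -ejk; have [_ /negPf ->] := eP (s j).
have /choice [s sP] := bnd; have [a aP] := K_uncountable s.
by have := sP _ _ (erefl (w a)); rewrite (negPf (aP _)).
Qed.

(** Zorn's lemma. Such a [P] corresponds to a maximal ideal of the localization at [h] and replaces
    Rabinowitsch's extra variable. *)
Lemma max_ideal_avoiding J h : is_ideal J -> (forall N, ~ J (h ^+ N)) ->
  exists P, [/\ is_ideal P, forall p, J p -> P p, forall N, ~ P (h ^+ N) &
    forall Q, is_ideal Q -> (forall p, P p -> Q p) -> (forall N, ~ Q (h ^+ N)) ->
      forall p, Q p -> P p].
Proof.
move=> JI Jh.
pose T := {Q : {mpoly K[n]} -> Prop |
  [/\ is_ideal Q, forall p, J p -> Q p & forall N, ~ Q (h ^+ N)]}.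
pose le (Q1 Q2 : T) := `[< forall p, sval Q1 p -> sval Q2 p >].
have [||||[P [PI PJ Ph]] Pmax] := @ZL_preorder T _ le.
- by exists J.
- by move=> Q; apply/asboolP.
- by move=> Q1 Q2 Q3 /asboolP le21 /asboolP le13; apply/asboolP => p /le21 /le13.
- move=> A Atot; have [[Q0 AQ0]|A0] := pselect (exists Q, A Q); last first.
    by exists (exist _ J (And3 JI (fun p Jp => Jp) Jh)) => Q AQ; case: A0; exists Q.
  pose U p := exists2 Q, A Q & sval Q p.
  have UI : is_ideal U.
    split; first by exists Q0 => //; case: (svalP Q0) => -[].
      move=> p q [Q1 AQ1 Qp] [Q2 AQ2 Qq]; case: (Atot _ _ AQ1 AQ2) => /asboolP le12.
        by exists Q2 => //; case: (svalP Q2) => -[_ + _] _ _; apply=> //; exact: le12.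
      by exists Q1 => //; case: (svalP Q1) => -[_ + _] _ _; apply=> //; exact: le12.
    move=> a p [Q AQ Qp]; exists Q => //.
    by case: (svalP Q) => -[_ _ +] _ _; apply.
  have UJ p : J p -> U p by exists Q0 => //; case: (svalP Q0) => _ + _; apply.
  have Uh N : ~ U (h ^+ N) by case=> Q _; case: (svalP Q) => _ _ /(_ N).
  by exists (exist _ U (And3 UI UJ Uh)) => Q AQ; apply/asboolP => p Qp; exists Q.
exists P; split=> // Q QI PQ Qh p Qp.
have QJ p' : J p' -> Q p' by move=> /PJ /PQ.
have := Pmax (exist _ Q (And3 QI QJ Qh)) => H.
have /asboolP : le (exist _ P (And3 PI PJ Ph)) (exist _ Q (And3 QI QJ Qh)) by apply/asboolP.
by move=> le12; have /asboolP := H (introT (asboolP _) le12); apply.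
Qed.

(* If no translate of X_i lies in the maximal ideal P avoiding the powers of h, *)
(* each h^k is u_a (X_i - a) mod P for some k and u_a; since K is uncountable,  *)
(* infinitely many u_a have the same k and bounded degree, hence are linearly   *)
(* dependent, which puts a polynomial in X_i alone into P.                      *)
Theorem nullstellensatz k (F : 'I_k -> {mpoly K[n]}) h :
  (forall v, (forall i, (F i).@[v] = 0) -> h.@[v] = 0) ->
  exists N, span_ideal F (h ^+ N).
Proof.
move=> Fh; apply: contrapT => /forallNP Jh.
have [P [PI PJ Ph Pmax]] := max_ideal_avoiding (span_ideal_ideal F) Jh.
have [P0 PD PM] := PI.
have P1 : ~ P 1 by apply: (Ph 0).
(* By maximality, adjoining to [P] an element outside it brings in a power of [h]. *)
have adj a : ~ P a -> exists N u, P (h ^+ N - u * a).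
  move=> Pa; pose Q p := exists u, P (p - u * a).
  have QI : is_ideal Q.
    split; first by exists 0; rewrite mul0r subr0.
      by move=> p q [u Pu] [v Pv]; exists (u + v); rewrite mulrDl opprD addrACA; apply: PD.
    by move=> b p [u Pu]; exists (b * u); rewrite -mulrA -mulrBr; apply: PM.
  apply: contrapT => H; apply: Pa; apply: (Pmax Q) => //.
  - by move=> p Pp; exists 0; rewrite mul0r subr0.
  - by move=> N [u Pu]; apply: H; exists N, u.
  - by exists 1; rewrite mul1r subrr.
have Pprime a b : P (a * b) -> P a \/ P b.
  move=> Pab; have [Pa|Pa] := pselect (P a); [by left|right].
  apply: contrapT => Pb; have [M [u Pu]] := adj a Pa; have [N [v Pv]] := adj b Pb.
  apply: (Ph (M + N)%N); rewrite exprD.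
  rewrite (_ : _ * _ = h ^+ N * (h ^+ M - u * a) + u * a * (h ^+ N - v * b) + u * v * (a * b)).
    by apply: (PD); [apply: (PD)|]; apply: (PM).
  ring.
have key i : exists b, P ('X_i - b%:MP).
  apply: contrapT => /forallNP noroot.
  have /choice [w wP] : forall a : K, exists Nu : nat * {mpoly K[n]},
      P (h ^+ Nu.1 - Nu.2 * ('X_i - a%:MP)).
    by move=> a; have [N [u Pu]] := adj _ (noroot a); exists (N, u).
  have [d [a a_inj ad]] := inf_uncountable (fun a => pickle ((w a).1, msize (w a).2)).
  have [[N D]] : exists ND, forall k, ((w (a k)).1, msize (w (a k)).2) = ND.
    exists ((w (a 0%N)).1, msize (w (a 0%N)).2) => l.
    by apply: (pcan_inj (@pickleK _)); rewrite !ad.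
  move=> aND.
  have szD l : (msize (w (a l)).2 <= D)%N by case: (aND l) => _ ->.
  have wN l : (w (a l)).1 = N by case: (aND l).
  have [M [c [[j0 cj0] c0]]] := mpoly_dependent szD.
  (* Let u_j be the cofactor of X_i - a_j and L the product of all X_i - a_l. Modulo [P], L u_j is
     h^N times the product over l <> j, so the relation sum_j c_j u_j = 0 multiplied by L puts h^N
     q(X_i) in [P]. The value of [q] at [a j0] is a nonzero multiple of [c j0]. *)
  pose q := \sum_(j < M) c j *: \prod_(l < M | l != j) ('X - (a l)%:P).
  have q0 : q != 0.
    apply/eqP => /(congr1 (fun r : {poly K} => r.[a j0])); rewrite horner0 horner_sum.
    rewrite (bigD1 j0) //= [X in _ + X]big1 => [|j jj0].
      rewrite addr0 hornerZ horner_prod => /eqP; rewrite mulf_eq0 (negPf cj0) /=.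
      rewrite prodf_seq_eq0 => /hasP[l _ /andP[lj0]].
      rewrite !hornerE subr_eq0 => /eqP /a_inj /val_inj e.
      by rewrite e eqxx in lj0.
    rewrite hornerZ horner_prod (bigD1 j0) /=; last by rewrite eq_sym.
    by rewrite hornerXsubC subrr mul0r mulr0.
  suff Pq : P (h ^+ N * (map_poly (@mpolyC n K) q).['X_i]).
    have [/Ph//|] := Pprime _ _ Pq.
    by move=> /(horner_mpoly_prime PI Pprime P1 q0) [b /noroot].
  pose L := \prod_(l < M) ('X_i - (a l)%:MP_[n]).
  rewrite (_ : _ * _ = \sum_(j < M) (c j)%:MP * ((\prod_(l < M | l != j) ('X_i - (a l)%:MP))
     * (h ^+ N - (w (a j)).2 * ('X_i - (a j)%:MP)))); last first.
    rewrite (eq_bigr (fun j : 'I_M => h ^+ N * ((c j)%:MP * \prod_(l < M | l != j) ('X_i - (a l)%:MP))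
         - (c j *: (w (a j)).2) * L)); last first.
      move=> j _; rewrite mulrBr mulrBr; congr (_ - _); first by ring.
      by rewrite [L](bigD1 j) //= -mul_mpolyC; ring.
    rewrite sumrB -mulr_suml c0 mul0r subr0 -mulr_sumr; congr (_ * _).
    rewrite raddf_sum horner_sum; apply: eq_bigr => j _ /=.
    rewrite map_polyZ /= hornerZ rmorph_prod horner_prod; congr (_ * _).
    by apply: eq_bigr => l _; rewrite rmorphB /= map_polyX map_polyC !hornerE.
  apply: ideal_sum => // j _; apply: (PM); apply: (PM).
  by have := wP (a j); rewrite wN.
have {key} /choice [v vP] := key.
(* Modulo [P] every polynomial is its value at [v]. As [P] contains no nonzero constant, [v] is a
   common zero of the [F i], hence a zero of [h], which puts [h] itself in [P]. *)
have ev p : P (p - p.@[v]%:MP).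
  elim/mpolyind: p => [|c m p _ _ IH]; first by rewrite meval0 subr0.
  rewrite mevalD mpolyCD opprD addrACA; apply: (PD) => //.
  rewrite mevalZ -mul_mpolyC rmorphM -mulrBr; apply: (PM).
  elim/mnm_ind: m => [|i m IHm].
    by rewrite mpolyX0 meval1 rmorph1 subrr.
  rewrite mpolyXD mevalM mevalXU rmorphM /=.
  rewrite (_ : _ - _ = 'X_[m] * ('X_i - (v i)%:MP) + (v i)%:MP * ('X_[m] - 'X_[m].@[v]%:MP)).
    by apply: (PD); apply: (PM).
  ring.
have constP c : P c%:MP -> c = 0.
  move=> Pc; apply: contrapT => /eqP c0; apply: P1.
  by have := PM (c^-1)%:MP _ Pc; rewrite -rmorphM mulVf.
apply: (Ph 1%N); rewrite expr1 -[h]subr0.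
have <- : (h.@[v])%:MP = 0 :> {mpoly K[n]}.
  rewrite Fh ?mpolyC0 // => i; apply: constP.
  have PF : P (F i) by apply: PJ; apply: span_ideal_gen.
  by rewrite -[_%:MP](subKr (F i)); apply: idealB.
exact: ev.
Qed.
End Nullstellensatz.

(** * The Jacobian criterion *)

Section ChainRule.
Variables (K B : comNzRingType) (f : {rmorphism K -> B}) (D : B -> B).
Hypothesis DD : {morph D : x y / x + y}.
Hypothesis DM : forall x y, D (x * y) = D x * y + x * D y.
Hypothesis DC : forall c, D (f c) = 0.

(** Stated for any derivation killing the constants, so that it serves curves ([deriv]) as well as
    compositions and linear substitutions ([mderiv]). *)
Lemma mmap_chain k (h : 'I_k -> B) (P : {mpoly K[k]}) :
  D (mmap f h P) = \sum_i mmap f h P^`M(i) * D (h i).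
Proof.
have D0 : D 0 = 0 by rewrite -(rmorph0 f) DC rmorph0.
elim/mpolyind: P => [|c m P _ _ IH].
  by rewrite mmap0 D0 big1 // => i _; rewrite mderiv0 mmap0 mul0r.
rewrite mmapD DD IH; under [RHS]eq_bigr do rewrite mderivD mmapD mulrDl.
rewrite big_split /=; congr (_ + _).
rewrite mmapZ DM DC mul0r add0r; under eq_bigr do rewrite mderivZ mmapZ -mulrA.
rewrite -mulr_sumr; congr (_ * _).
elim/mnm_ind: m => [|i m IHm].
  rewrite mpolyX0 rmorph1 -(rmorph1 f) DC big1 // => i _.
  by rewrite -mpolyC1 mderivC mmap0 mul0r.
rewrite mpolyXD rmorphM /= DM IHm (mmapX _ _ U_(i)) mmap1U.
under [RHS]eq_bigr do rewrite mderivM mmapD !rmorphM /= (mmapX _ _ U_(i)) mmap1U mulrDl.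
rewrite big_split mulr_sumr; congr (_ + _); last by apply: eq_bigr => j _; rewrite mulrA.
rewrite (bigD1 i) //= [X in _ + X]big1 ?addr0 => [|j ji].
  by rewrite mderivX mnm1E eqxx scale1r -{1}[U_(i)%MM]add0m addmK mpolyX0 rmorph1 mul1r mulrC.
by rewrite mderivX mnm1E eq_sym (negPf ji) scale0r mmap0 !mul0r.
Qed.
End ChainRule.

Lemma mderiv_eq0 (K : numFieldType) n (p : {mpoly K[n]}) :
  (forall i, p^`M(i) = 0) -> p = (p@_0%MM)%:MP.
Proof.
move=> dp; apply/mpolyP => m; rewrite mcoeffC.
have [->|m0] := eqVneq m 0%MM; first by rewrite mulr1.
rewrite mulr0; have [i mi] : exists i, m i != 0%N.
  apply/existsP; rewrite -negb_forall; apply: contra m0 => /forallP m0.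
  by apply/eqP/mnmP => i; rewrite mnm0E; apply/eqP.
have /(congr1 (mcoeff (m - U_(i))%MM)) := dp i.
rewrite mcoeff_mderiv mcoeff0 submK ?lep1mP // => /eqP.
by rewrite mulrn_eq0 /= => /eqP.
Qed.

Lemma msize_mderiv (K : idomainType) n (p : {mpoly K[n]}) i : p != 0 ->
  (msize p^`M(i) < msize p)%N.
Proof.
move=> p0; rewrite msizeE; have: (0 < msize p)%N by rewrite lt0n msize_poly_eq0.
case szp: (msize p) => [//|d] _; rewrite ltnS; apply/bigmax_leqP_seq => m.
rewrite mcoeff_msupp mcoeff_mderiv => pm _.
have : (m + U_(i))%MM \in msupp p.
  by rewrite mcoeff_msupp; apply: contraNneq pm => ->; rewrite mul0rn.
by move/msize_mdeg_lt; rewrite szp mdegD mdeg1 addn1.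
Qed.

Lemma horner_mmap (K : comNzRingType) n (h : 'I_n -> {poly K}) (p : {mpoly K[n]}) x :
  (mmap polyC h p).[x] = p.@[fun j => (h j).[x]].
Proof.
rewrite mevalE -[_.[x]]/(horner_eval x _) rmorph_sum; apply: eq_bigr => m _.
rewrite rmorphM /= horner_evalE hornerC /mmap1 rmorph_prod; congr (_ * _).
by apply: eq_bigr => j _; rewrite rmorphXn.
Qed.

Lemma poly_horner_eq0 (K : numDomainType) (p : {poly K}) : (forall x, p.[x] = 0) -> p = 0.
Proof.
move=> px; apply/eqP; apply: contraT => p0.
pose s := [seq (j%:R : K) | j <- iota 0 (size p)].
have := @max_poly_roots _ _ s p0; rewrite size_map size_iota ltnn; apply.
  by apply/allP => x _; rewrite /root px.
by rewrite map_inj_uniq ?iota_uniq // => a b /eqP; rewrite eqr_nat => /eqP.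
Qed.

(** On each line parallel to an axis the polynomial restricts to zero, so its partial derivatives
    vanish everywhere as well. By induction on the size they are zero, and in characteristic 0 only
    a constant is left. *)
Lemma mpoly_meval_eq0 (K : numFieldType) n (p : {mpoly K[n]}) :
  (forall v, p.@[v] = 0) -> p = 0.
Proof.
have [d] := ubnP (msize p); elim: d => // d IH in p *; rewrite ltnS => szp pv.
have [//|p0] := eqVneq p 0.
have dp i : p^`M(i) = 0.
  apply: IH => [|v]; first by apply: leq_trans szp; exact: msize_mderiv.
  pose h j : {poly K} := (v j)%:P + (i == j)%:R *: 'X.
  have h0 : mmap polyC h p = 0.
    by apply: poly_horner_eq0 => x; rewrite horner_mmap pv.
  have := mmap_chain (@derivD K) (@derivM K) (@derivC K) h p.
  rewrite h0 linear0 (bigD1 i) //= big1 => [|j ji].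
    rewrite derivD derivC derivZ derivX eqxx alg_polyC add0r mulr1 addr0.
    move/(congr1 (fun q : {poly K} => q.[0])); rewrite horner0 horner_mmap => e.
    rewrite [RHS]e; apply: meval_eq => j; rewrite /h !hornerE.
    by rewrite ?mulr0 ?addr0.
  by rewrite derivD derivC derivZ derivX eq_sym (negPf ji) scale0r addr0 mulr0.
have pC := mderiv_eq0 dp.
by have := pv (fun=> 0); rewrite pC mevalC => ->; rewrite mpolyC0.
Qed.

(* Applying the gradient to an algebraic relation of minimal degree gives *)
(* relations of smaller degree, because the Jacobian is invertible.        *)
Theorem jacobian_independent (K : numFieldType) n k (F : k.-tuple {mpoly K[n]})
    (v : 'I_n -> K) (W : 'I_k -> 'I_n -> K) :
  \det (\matrix_(i, l) \sum_j W l j * ((tnth F i)^`M(j)).@[v]) != 0 ->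
  forall P : {mpoly K[k]}, P \mPo F = 0 -> P = 0.
Proof.
move=> detJ P; have [d] := ubnP (msize P); elim: d => // d IH in P *.
rewrite ltnS => szP PF; have [//|P0] := eqVneq P 0.
pose J : 'M[{mpoly K[n]}]_k := \matrix_(i, l) \sum_j W l j *: (tnth F i)^`M(j).
have J0 : \det J != 0.
  apply: contraNneq detJ => J0; apply/eqP; rewrite -[RHS](meval0 v) -[in RHS]J0 -(det_map_mx (meval v)).
  congr (\det _); apply/matrixP => i l; rewrite !mxE rmorph_sum.
  by apply: eq_bigr => j _; rewrite /= mevalZ.
pose G : 'rV[{mpoly K[n]}]_k := \row_i (P^`M(i) \mPo F).
have GJ : G *m J = 0.
  apply/rowP => l; rewrite !mxE.
  under eq_bigr do rewrite !mxE mulr_sumr.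
  rewrite exchange_big big1 //= => j _.
  under eq_bigr do rewrite -scalerAr.
  rewrite -scaler_sumr; apply/eqP; rewrite scaler_eq0; apply/orP; right.
  have := mmap_chain (@mderivD n K j) (@mderivM n K j) (@mderivC n K j) (tnth F) P.
  by rewrite -/(comp_mpoly F P) PF linear0 => <-.
have G0 : G = 0.
  have : (\det J) *: G = 0 by rewrite -mul_mx_scalar -mul_mx_adj mulmxA GJ mul0mx.
  move=> dG; apply/rowP => i; have /rowP/(_ i) := dG; rewrite !mxE => /eqP.
  by rewrite mulf_eq0 (negPf J0) => /eqP.
have dP i : P^`M(i) = 0.
  apply: IH; first by apply: leq_trans szP; exact: msize_mderiv.
  by have /rowP/(_ i) := G0; rewrite !mxE.
move: PF; rewrite (mderiv_eq0 dP) comp_mpolyC => /eqP.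
by rewrite mpolyC_eq0 => /eqP ->; rewrite mpolyC0.
Qed.

(** * The Fischer inner product *)

Section LinearSubstitution.
Variables (K : fieldType) (n : nat).
Implicit Types (p q : {mpoly K[n]}) (A : 'M[K]_n).

(** The value at a row vector v is that of [p] at v A, in agreement with [lin_mx], which acts on
    [mxvec] from the right. *)
Definition msubst A p := p \mPo [tuple \sum_j A j i *: 'X_j | i < n].

Lemma meval_msubst A p v : (msubst A p).@[v] = p.@[fun i => \sum_j v j * A j i].
Proof.
rewrite comp_mpoly_meval; apply: meval_eq => i; rewrite tnth_mktuple rmorph_sum.
by apply: eq_bigr => j _; rewrite /= mevalZ mevalXU mulrC.
Qed.

Lemma msubstM A p q : msubst A (p * q) = msubst A p * msubst A q.
Proof. exact: rmorphM. Qed.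

Lemma msubstD A p q : msubst A (p + q) = msubst A p + msubst A q.
Proof. exact: rmorphD. Qed.

Lemma msubstZ A c p : msubst A (c *: p) = c *: msubst A p.
Proof. exact: linearZ. Qed.

Lemma msubstXU A i : msubst A 'X_i = \sum_j A j i *: 'X_j.
Proof. by rewrite /msubst comp_mpolyXU -tnth_nth tnth_mktuple. Qed.

Lemma mderiv_msubst A p i : (msubst A p)^`M(i) = \sum_j A i j *: msubst A p^`M(j).
Proof.
have := mmap_chain (@mderivD n K i) (@mderivM n K i) (@mderivC n K i)
  (tnth [tuple \sum_j A j i *: 'X_j | i < n]) p.
rewrite -/(comp_mpoly _ p) -/(msubst A p) => ->; apply: eq_bigr => j _.
rewrite -/(comp_mpoly _ _) -/(msubst A _) mulrC tnth_mktuple linear_sum /= (bigD1 i) //= big1.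
  by rewrite addr0 mderivZ mderivX mnm1E eqxx scale1r -{1}[U_(i)%MM]add0m addmK mpolyX0 -scalerAl mul1r.
by move=> k ki; rewrite mderivZ mderivX mnm1E (negPf ki) scale0r scaler0.
Qed.

Lemma msubst_homog A d p : p \is d.-homog -> msubst A p \is d.-homog.
Proof.
move=> /dhomogP hp; rewrite [p]mpolyE /msubst linear_sum.
rewrite big_seq; apply: rpred_sum => m /hp <-; rewrite linearZ; apply: rpredZ => /=.
elim/mnm_ind: m => [|i m IH]; first by rewrite mdeg0 mpolyX0 rmorph1 dhomog1.
rewrite mpolyXD rmorphM /= mdegD; apply: dhomogM => //.
rewrite mdeg1 -/(msubst A _) msubstXU; apply: rpred_sum => j _; apply: rpredZ.
by rewrite dhomogX /= mdeg1.
Qed.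

Lemma msubst_pihomog A d p :
  msubst A (pihomog mdeg d p) = pihomog mdeg d (msubst A p).
Proof.
have -> : msubst A p = \sum_(e < msize p) msubst A (pihomog mdeg e p).
  by rewrite {1}(pihomog_partitionE (leqnn (msize p))) /msubst linear_sum.
rewrite [RHS]raddf_sum /=.
have hom e : msubst A (pihomog mdeg e p) \is e.-homog by apply/msubst_homog/pihomogP.
have [ltd|ged] := ltnP d (msize p); last first.
  rewrite big1 => [|e _]; last by rewrite (pihomog_ne0 _ (hom e)) // ltn_eqF // (leq_trans _ ged).
  have -> : pihomog mdeg d p = 0; last by rewrite /msubst linear0.
  rewrite pihomogE big_seq_cond big1 // => m /andP[mp /eqP md].
  by move: ged; rewrite -md => /(leq_ltn_trans)/(_ (msize_mdeg_lt mp)) ; rewrite ltnn.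
rewrite (bigD1 (Ordinal ltd)) //= big1 ?addr0 => [|e ed]; last exact: (pihomog_ne0 _ (hom e)).
by rewrite (pihomog_dE (hom d)).
Qed.

Lemma msize_msubst A p : (msize (msubst A p) <= msize p)%N.
Proof.
rewrite [X in msubst A X](pihomog_partitionE (leqnn (msize p))) /msubst linear_sum.
apply: leq_trans (msize_sum _ _ _) _; apply/bigmax_leqP => d _.
have /dhomogP hom : msubst A (pihomog mdeg d p) \is d.-homog by apply/msubst_homog/pihomogP.
rewrite msizeE; apply/bigmax_leqP_seq => m ms _; have /= -> := hom m ms; exact: ltn_ord.
Qed.

End LinearSubstitution.

Section Fischer.
Variables (C : numClosedFieldType) (n : nat).
Implicit Types (p q r : {mpoly C[n]}) (A : 'M[C]_n) (m : 'X_{1..n}).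

(** With these weights multiplication by X_i is adjoint to the derivative along X_i
    ([fischer_mulX]), because (m_i + 1)! = (m_i + 1) m_i!. *)
Definition mfact m := (\prod_i (m i)`!)%N.

Definition fischer p q := \sum_(m <- msupp p) (mfact m)%:R * p@_m * (q@_m)^*.

Lemma fischerE D p q : (msize p <= D)%N ->
  fischer p q = \sum_(m : 'X_{1..n < D}) (mfact m)%:R * p@_m * (q@_m)^*.
Proof.
move=> szp; rewrite /fischer (big_mksub 'X_{1..n < D}) /=; first last.
- by move=> m mp; exact: leq_trans (msize_mdeg_lt mp) szp.
- by rewrite msupp_uniq.
rewrite [RHS](bigID (fun m : 'X_{1..n < D} => val m \in msupp p)) /= [X in _ = _ + X]big1 ?addr0 //.
by move=> m /memN_msupp_eq0 ->; rewrite mulr0 mul0r.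
Qed.

Lemma fischerDl p q r : fischer (p + q) r = fischer p r + fischer q r.
Proof.
pose D := maxn (msize p) (msize q).
rewrite !(@fischerE D) ?leq_maxl ?leq_maxr ?msizeD_le // -big_split.
by apply: eq_bigr => m _; rewrite mcoeffD mulrDr mulrDl.
Qed.

Lemma fischerZl c p q : fischer (c *: p) q = c * fischer p q.
Proof.
rewrite (@fischerE (msize p)) ?mmeasureZ_le // (@fischerE (msize p)) // mulr_sumr.
by apply: eq_bigr => m _; rewrite mcoeffZ; ring.
Qed.

Lemma fischer_conj p q : fischer q p = (fischer p q)^*.
Proof.
pose D := maxn (msize p) (msize q).
rewrite !(@fischerE D) ?leq_maxl ?leq_maxr // rmorph_sum; apply: eq_bigr => m _.
by rewrite !rmorphM /= conjCK conjC_nat mulrAC.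
Qed.

Lemma fischerDr p q r : fischer p (q + r) = fischer p q + fischer p r.
Proof. by rewrite fischer_conj fischerDl rmorphD /= -!fischer_conj. Qed.

Lemma fischerZr c p q : fischer p (c *: q) = c^* * fischer p q.
Proof. by rewrite fischer_conj fischerZl rmorphM /= -fischer_conj. Qed.

Lemma fischer0l p : fischer 0 p = 0.
Proof. by rewrite -(scale0r 0) fischerZl mul0r. Qed.

Lemma fischer0r p : fischer p 0 = 0.
Proof. by rewrite fischer_conj fischer0l conjC0. Qed.

Lemma fischerBl p q r : fischer (p - q) r = fischer p r - fischer q r.
Proof. by rewrite -scaleN1r fischerDl fischerZl mulN1r. Qed.

Lemma fischerBr p q r : fischer p (q - r) = fischer p q - fischer p r.
Proof. by rewrite -scaleN1r fischerDr fischerZr rmorphN1 mulN1r. Qed.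

Lemma fischer_suml (I : Type) (s : seq I) (P : pred I) (F : I -> {mpoly C[n]}) q :
  fischer (\sum_(i <- s | P i) F i) q = \sum_(i <- s | P i) fischer (F i) q.
Proof. exact: (big_morph (fischer^~ q) (fun p r => fischerDl p r q) (fischer0l q)). Qed.

Lemma fischer_sumr (I : Type) (s : seq I) (P : pred I) (F : I -> {mpoly C[n]}) q :
  fischer q (\sum_(i <- s | P i) F i) = \sum_(i <- s | P i) fischer q (F i).
Proof. exact: (big_morph (fischer q) (fischerDr q) (fischer0r q)). Qed.

Lemma fischer_eq0 p : fischer p p = 0 -> p = 0.
Proof.
move=> /eqP; rewrite /fischer psumr_eq0 => [/allP p0|m _]; last first.
  by rewrite -mulrA mulr_ge0 ?ler0n ?mul_conjC_ge0.
apply/eqP; rewrite -msupp_eq0; case E: (msupp p) => [//|m s].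
have mp : m \in msupp p by rewrite E inE eqxx.
have := p0 m mp; rewrite /= -mulrA !mulf_eq0 conjC_eq0 orbb pnatr_eq0 => /orP[|].
  by rewrite -leqn0 leqNgt prodn_gt0 // => i; exact: fact_gt0.
by rewrite mcoeff_eq0 mp.
Qed.

Lemma fischerX m q : fischer 'X_[m] q = (mfact m)%:R * (q@_m)^*.
Proof. by rewrite /fischer msuppX big_seq1 mcoeffX eqxx mulr1. Qed.

Lemma fischer_mulX i p q : fischer ('X_i * p) q = fischer p q^`M(i).
Proof.
elim/mpolyind: p => [|c m p _ _ IH]; first by rewrite mulr0 !fischer0l.
rewrite mulrDr !fischerDl IH; congr (_ + _).
rewrite -scalerAr !fischerZl -mpolyXD !fischerX; congr (_ * _).
rewrite mcoeff_mderiv addmC rmorphMn -[_ *+ (m i).+1]mulr_natr mulrA mulrAC -natrM; congr (_%:R * _).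
rewrite /mfact (bigD1 i) //= [in RHS](bigD1 i) //= mnmDE mnm1E eqxx addn1 factS.
rewrite -mulnA mulnC; congr (_ * _ * _)%N.
by apply: eq_bigr => j ji; rewrite mnmDE mnm1E eq_sym (negPf ji) addn0.
Qed.

Definition adjoint_mx A : 'M[C]_n := map_mx Num.conj A^T.

Lemma adjoint_mxK A : adjoint_mx (adjoint_mx A) = A.
Proof. by apply/matrixP => i j; rewrite !mxE conjCK. Qed.

(** Each variable of the left monomial moves to the right as a derivative, and the chain rule for
    [msubst] produces the conjugate transpose. A constant only sees the value at 0, which linear
    substitutions fix. *)
Lemma fischer_msubst A p q : fischer (msubst A p) q = fischer p (msubst (adjoint_mx A) q).
Proof.
elim/mpolyind: p => [|c m p _ _ IH]; first by rewrite /msubst linear0 !fischer0l.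
rewrite msubstD msubstZ !fischerDl !fischerZl IH; congr (_ * _ + _).
elim/mnm_ind: m q {IH} => [|i m IHm] q.
  rewrite mpolyX0 /msubst rmorph1 -/(msubst _ q) -(mpolyX0 _ C) !fischerX; congr (_ * _^*).
  have c0 p' : p'@_0%MM = p'.@[fun=> 0] :> C.
    rewrite mevalE; have [mp|mp] := boolP (0%MM \in msupp p').
      rewrite (bigD1_seq 0%MM) ?msupp_uniq //= [X in _ + X]big1 ?addr0 => [|k k0].
        by rewrite big1 ?mulr1 // => k _; rewrite mnm0E.
      apply/eqP; rewrite mulf_eq0; apply/orP; right.
      have [j kj] : exists j, k j != 0%N.
        apply/existsP; rewrite -negb_forall; apply: contra k0 => /forallP k0.
        by apply/eqP/mnmP => j; rewrite mnm0E; apply/eqP.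
      by apply/prodf_eq0; exists j => //; rewrite expr0n (negPf kj).
    rewrite (memN_msupp_eq0 mp) big_seq big1 // => k kp.
    apply/eqP; rewrite mulf_eq0; apply/orP; right.
    have [j kj] : exists j, k j != 0%N.
      apply/existsP; rewrite -negb_forall; apply: contra mp => /forallP k0.
      rewrite (_ : 0%MM = k) //; by apply/mnmP => j; rewrite mnm0E; apply/esym/eqP.
    by apply/prodf_eq0; exists j => //; rewrite expr0n (negPf kj).
  rewrite !c0 meval_msubst; apply: meval_eq => j; rewrite big1 // => k _; exact: mul0r.
rewrite mpolyXD msubstM msubstXU mulr_suml fischer_suml fischer_mulX.
rewrite mderiv_msubst fischer_sumr; apply: eq_bigr => j _.
by rewrite -scalerAl fischerZl fischer_mulX IHm fischerZr !mxE conjCK.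
Qed.

Definition is_submodule (M : {mpoly C[n]} -> Prop) :=
  [/\ M 0, forall p q, M p -> M q -> M (p + q) & forall c p, M p -> M (c *: p)].

Lemma submoduleB M p q : is_submodule M -> M p -> M q -> M (p - q).
Proof. by case=> _ MD MZ Mp Mq; rewrite -scaleN1r; apply: MD => //; exact: MZ. Qed.

(** Gram-Schmidt along [s]. The last clause stands for [r] lying in the span of [s], put by duality
    so that no coefficients are carried; it also settles the case where the new vector equals its
    own projection. *)
Lemma fischer_project_seq M (s : seq {mpoly C[n]}) p : is_submodule M ->
  (forall x, x \in s -> M x) ->
  exists r, [/\ M r, forall x, x \in s -> fischer (p - r) x = 0 &
    forall q, (forall x, x \in s -> fischer q x = 0) -> fischer q r = 0].
Proof.
move=> MM; have [M0 MD MZ] := MM; elim: s p => [|x s IH] p Ms.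
  by exists 0; split=> // q _; rewrite fischer0r.
have {}IH q := IH q (fun y ys => Ms y (mem_behead (s := x :: s) ys)).
have [r [Mr rs sr]] := IH p; have [t [Mt ts st]] := IH x.
have Mx : M x by apply: Ms; rewrite inE eqxx.
have [xt0|xt0] := eqVneq (x - t) 0.
  exists r; split=> // [y|q qs].
    rewrite inE => /orP[/eqP->|]; last exact: rs.
    by move/eqP: xt0; rewrite subr_eq0 => /eqP ->; apply: st.
  by apply: sr => y ys; apply: qs; rewrite inE ys orbT.
pose c := fischer (p - r) (x - t) / fischer (x - t) (x - t).
have nz : fischer (x - t) (x - t) != 0 by apply: contraNneq xt0 => /fischer_eq0 ->.
exists (r + c *: (x - t)); split.
- by apply: (MD) => //; apply: (MZ); exact: submoduleB.
- have s0 y : y \in s -> fischer (p - (r + c *: (x - t))) y = 0.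
    by move=> ys; rewrite opprD addrA fischerBl fischerZl rs // ts // mulr0 subr0.
  move=> y; rewrite inE => /orP[/eqP->|//]; last exact: s0.
  rewrite -[X in fischer _ X](subrK t) fischerDr [X in _ + X]st // addr0.
  by rewrite opprD addrA fischerBl fischerZl divfK // subrr.
- move=> q qs; have qs' y : y \in s -> fischer q y = 0.
    by move=> ys; apply: qs; rewrite inE ys orbT.
  rewrite fischerDr fischerZr fischerBr sr // st // qs ?inE ?eqxx //.
  by rewrite subrr mulr0 addr0.
Qed.

(* Otherwise Gram-Schmidt would produce an infinite orthogonal sequence in M. *)
Lemma fischer_project M D p : is_submodule M -> (forall x, M x -> (msize x <= D)%N) ->
  exists2 r, M r & forall x, M x -> fischer x (p - r) = 0.
Proof.
move=> MM szM; apply: contrapT => nopr.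
have [M0 MD MZ] := MM.
have /choice [e eP] : forall s : seq {mpoly C[n]}, exists x, (forall y, y \in s -> M y) ->
    [/\ M x, x != 0 & forall y, y \in s -> fischer x y = 0].
  move=> s; have [Ms|] := pselect (forall y, y \in s -> M y); last by exists 0.
  have [r [Mr rs sr]] := fischer_project_seq p MM Ms.
  have [x [Mx xr]] : exists x, M x /\ fischer x (p - r) != 0.
    apply: contrapT => H; apply: nopr; exists r => // x Mx.
    by apply/eqP; apply: contraT => ?; case: H; exists x.
  have [t [Mt ts st]] := fischer_project_seq x MM Ms.
  exists (x - t) => _; split; [exact: submoduleB | | exact: ts].
  apply: contraNneq xr => /eqP; rewrite subr_eq0 => /eqP ->.
  by rewrite fischer_conj st ?conjC0.
pose fix s k := if k is k'.+1 then e (s k') :: s k' else [::].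
have sM k : forall y, y \in s k -> M y.
  by elim: k => //= k IH y; rewrite inE => /orP[/eqP ->|/IH //]; case: (eP _ IH).
have smem i j : (i < j)%N -> e (s i) \in s j.
  elim: j => // j IH; rewrite ltnS leq_eqVlt inE => /orP[/eqP ->|/IH ->]; first by rewrite eqxx.
  by rewrite orbT.
have orth i j : i != j -> fischer (e (s i)) (e (s j)) = 0.
  rewrite neq_ltn => /orP[] lt_ij; last by have [_ _ ->] := eP _ (sM i); rewrite // smem.
  by rewrite fischer_conj; have [_ _ ->] := eP _ (sM j); rewrite ?conjC0 // smem.
have szu k : (msize (e (s k)) <= D)%N by apply: szM; have [] := eP _ (sM k).
have [N [c [[j0 cj0] c0]]] := mpoly_dependent szu.
have : fischer (\sum_j c j *: e (s j)) (e (s j0)) = 0 by rewrite c0 fischer0l.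
rewrite fischer_suml (bigD1 j0) //= big1 => [|j ne]; last by rewrite fischerZl orth ?mulr0.
rewrite addr0 fischerZl => /eqP; rewrite mulf_eq0 (negPf cj0) /= => /eqP /fischer_eq0 e0.
by have [_ /eqP] := eP _ (sM j0).
Qed.

(** * A Reynolds operator for a group stable under conjugate transposition *)

Section Reynolds.
Variable G : 'M[C]_n -> Prop.
Hypothesis G_adjoint : forall A, G A -> G (adjoint_mx A).

Definition minvariant p := forall A, G A -> msubst A p = p.

(** The span of all gq - q with q in [S], as an intersection of submodules. For [S] everything it
    acts as the kernel of the Reynolds operator; an [S] of bounded size keeps it finite-dimensional,
    so that projections exist. *)
Definition coboundary (S : {mpoly C[n]} -> Prop) p := forall M, is_submodule M ->
  (forall A q, G A -> S q -> M (msubst A q - q)) -> M p.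

Lemma coboundary_submodule S : is_submodule (coboundary S).
Proof.
split=> [M [] //|p q Sp Sq M MM MS|c p Sp M MM MS].
  by case: (MM) => _ MD _; apply: MD; [exact: Sp | exact: Sq].
by case: (MM) => _ _ MZ; apply: MZ; exact: Sp.
Qed.

(** For invariant p one has p (gr - r) = g(pr) - pr. This makes the Reynolds operator linear over
    the invariants. *)
Lemma coboundary_mul p r : minvariant p -> coboundary (fun=> True) r ->
  coboundary (fun=> True) (p * r).
Proof.
move=> Gp cr M MM MS; have [M0 MD MZ] := MM.
apply: (cr (fun r => M (p * r))).
  split=> [|q s Mq Ms|c q Mq]; first by rewrite mulr0.
    by rewrite mulrDr; exact: MD.
  by rewrite -scalerAr; exact: MZ.
by move=> A q GA _; rewrite mulrBr -{1}(Gp A GA) -msubstM; exact: MS.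
Qed.

(** The pairing of gq - q with r is that of q with hr - r, where h, the adjoint of g, again lies in
    [G]. So r is orthogonal to itself. *)
Lemma coboundary_invariant r : minvariant r -> coboundary (fun=> True) r -> r = 0.
Proof.
move=> Gr cr; apply: fischer_eq0; apply: (cr (fun q => fischer q r = 0)).
  split=> [|p q p0 q0|c p p0]; first exact: fischer0l.
    by rewrite fischerDl p0 q0 addr0.
  by rewrite fischerZl p0 mulr0.
by move=> A q GA _; rewrite fischerBl fischer_msubst Gr ?subrr //; exact: G_adjoint.
Qed.

(** Here b = p - r, with [r] the projection of p to the coboundaries of bounded size. For q = gb - b
    the square norm of q is the pairing of hq - q with b, h the adjoint of g, and it vanishes
    because hq - q is such a coboundary. *)
Lemma reynolds_decomposition p :
  exists b, minvariant b /\ coboundary (fun=> True) (p - b).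
Proof.
pose D := msize p; pose S q := (msize q <= D)%N : Prop.
have sz_cob x : coboundary S x -> (msize x <= D)%N.
  move=> cx; apply: (cx (fun y => (msize y <= D)%N)).
    split=> [|q r szq szr|c q szq]; first by rewrite msize0.
    - by apply: leq_trans (msizeD_le _ _) _; rewrite geq_max szq.
    - exact: leq_trans (mmeasureZ_le _ _ _) szq.
  move=> A q _ szq; apply: leq_trans (msizeD_le _ _) _; rewrite msizeN geq_max szq andbT.
  exact: leq_trans (msize_msubst _ _) szq.
have [r cr orth] := fischer_project p (coboundary_submodule S) sz_cob.
exists (p - r); split; last first.
  by rewrite subKr => M MM MS; apply: cr => // A q GA _; exact: MS.
move=> A GA; apply/eqP; rewrite -subr_eq0; apply/eqP/fischer_eq0.
have szb : (msize (p - r) <= D)%N.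
  by apply: leq_trans (msizeD_le _ _) _; rewrite msizeN geq_max leqnn sz_cob.
set b := p - r in szb orth *; set q := msubst A b - b.
have szq : (msize q <= D)%N.
  apply: leq_trans (msizeD_le _ _) _; rewrite msizeN geq_max szb andbT.
  exact: leq_trans (msize_msubst _ _) szb.
rewrite {2}/q fischerBr -{1}(adjoint_mxK A) -fischer_msubst -fischerBl.
apply: orth => M MM MS; apply: MS => //; exact: G_adjoint.
Qed.

(** The coefficients a_i are replaced by their Reynolds projections b_i. The error sum_i (a_i - b_i)
    F_i is an invariant and a coboundary, hence zero. *)
Theorem invariant_coefficients k (F : 'I_k -> {mpoly C[n]}) h :
  minvariant h -> (forall i, minvariant (F i)) -> span_ideal F h ->
  exists2 b : 'I_k -> {mpoly C[n]}, forall i, minvariant (b i) & h = \sum_i b i * F i.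
Proof.
move=> Gh GF [a def_h].
have /choice [b bP] := fun i => reynolds_decomposition (a i).
exists b => [i|]; first by case: (bP i).
apply/eqP; rewrite -subr_eq0; apply/eqP; apply: coboundary_invariant.
  move=> A GA; rewrite /msubst rmorphB rmorph_sum /= -/(msubst A h) Gh //; congr (_ - _).
  apply: eq_bigr => i _; rewrite rmorphM /= -/(msubst A _) -/(msubst A (F i)) GF //.
  by case: (bP i) => ->.
rewrite def_h -sumrB; elim/big_ind: _ => [|x y cx cy|i _].
- by have [] := coboundary_submodule (fun=> True).
- by have [_ cD _] := coboundary_submodule (fun=> True); exact: cD.
- by rewrite -mulrBl mulrC; apply: coboundary_mul => //; case: (bP i).
Qed.

Lemma minvariant_pihomog d p : minvariant p -> minvariant (pihomog mdeg d p).
Proof. by move=> Gp A GA; rewrite msubst_pihomog Gp. Qed.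

End Reynolds.
End Fischer.

(** * Peeling off isotropic vectors *)

Section Peeling.
Variable F : numClosedFieldType.

(** Shape of an operator preserving both the line of the first basis vector v and its orthogonal
    complement; [M] is the operator induced on the complement modulo v. *)
Definition peeled m (a : F) (M : 'M[F]_m) (b : F) (X : 'M[F]_(1 + (m + 1))) :=
  exists r s t, X = block_mx a%:M (row_mx r s) 0 (block_mx M t 0 b%:M).

Lemma peeledM m a b a' b' (M M' : 'M[F]_m) X X' :
  peeled a M b X -> peeled a' M' b' X' -> peeled (a * a') (M *m M') (b * b') (X *m X').
Proof.
move=> [r [s [t ->]]] [r' [s' [t' ->]]].
exists (a *: r' + r *m M'), (a *: s' + (r *m t' + b' *: s)), (M *m t' + b' *: t).
rewrite !(mulmx_block, mul_row_block, mulmx0, mul0mx, addr0, add0r) -!scalar_mxM.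
by rewrite mul_mx_row !mul_scalar_mx !mul_mx_scalar add_row_mx.
Qed.

Lemma peeled1 m : peeled 1 (1%:M : 'M[F]_m) 1 1%:M.
Proof. by exists 0, 0, 0; rewrite row_mx0 -!scalar_mx_block. Qed.

Lemma peeledX m a b (M : 'M[F]_m) X k :
  peeled a M b X -> peeled (a ^+ k) (M ^+ k) (b ^+ k) (X ^+ k).
Proof.
move=> pX; elim: k => [|k IH]; first exact: peeled1.
by rewrite !exprS; apply: peeledM.
Qed.

Lemma peeled_trace m a b (M : 'M[F]_m) X : peeled a M b X -> \tr X = a + (\tr M + b).
Proof. by case=> [r [s [t ->]]]; rewrite !mxtrace_block !mxtrace_scalar. Qed.

Definition hyperbolic_sum m (Om : 'M[F]_m) : 'M[F]_(1 + (m + 1)) :=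
  col_mx (row_mx 0 (row_mx 0 1%:M))
    (col_mx (row_mx 0 (row_mx Om 0)) (row_mx (-1)%:M (row_mx 0 0))).

Definition symplectic m (Om : 'M[F]_m) := (Om \in unitmx) && (Om^T == - Om).

Definition form n (Om : 'M[F]_n) (p q : 'cV[F]_n) : F := (p^T *m Om *m q) 0 0.

Lemma formE n (Om : 'M[F]_n) p q : p^T *m Om *m q = (form Om p q)%:M.
Proof. by rewrite [LHS]mx11_scalar. Qed.

Lemma formDl n (Om : 'M[F]_n) p q r : form Om (p + q) r = form Om p r + form Om q r.
Proof. by rewrite /form linearD /= !mulmxDl mxE. Qed.

Lemma formDr n (Om : 'M[F]_n) p q r : form Om p (q + r) = form Om p q + form Om p r.
Proof. by rewrite /form mulmxDr mxE. Qed.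

Lemma formZl n (Om : 'M[F]_n) c p q : form Om (c *: p) q = c * form Om p q.
Proof. by rewrite /form linearZ /= -!scalemxAl mxE. Qed.

Lemma formZr n (Om : 'M[F]_n) c p q : form Om p (c *: q) = c * form Om p q.
Proof. by rewrite /form -scalemxAr mxE. Qed.

Lemma form_skew n (Om : 'M[F]_n) p q : Om^T = - Om -> form Om p q = - form Om q p.
Proof.
move=> skew; have : (p^T *m Om *m q)^T = - (q^T *m Om *m p).
  by rewrite !trmx_mul trmxK skew mulNmx mulmxN mulmxA.
by move/matrixP/(_ 0 0); rewrite mxE [RHS]mxE.
Qed.

Lemma form_alt n (Om : 'M[F]_n) p : Om^T = - Om -> form Om p p = 0.
Proof.
move=> skew; apply/eqP; have /eqP := form_skew p p skew.
by rewrite -addr_eq0 -mulr2n mulrn_eq0.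
Qed.

Lemma form_nondeg n (Om : 'M[F]_n) p : Om \in unitmx ->
  (forall q, form Om p q = 0) -> p = 0.
Proof.
move=> uOm pq; apply: trmx_inj; rewrite trmx0 -[p^T](mulmxK uOm).
rewrite (_ : p^T *m Om = 0) ?mul0mx //; apply/rowP => i.
by have := pq (delta_mx i 0); rewrite /form -colE !mxE.
Qed.

(** The basis is v, then vectors orthogonal to v and w, then w, where v and w pair to 1. Pairing a
    linear relation with w and with v isolates its outer coefficients. *)
Lemma peel_form m (Om : 'M[F]_(1 + (m + 1))) (v : 'cV_(1 + (m + 1))) :
  symplectic Om -> v != 0 ->
  exists g (Om' : 'M[F]_m), [/\ g \in unitmx, symplectic Om',
    g^T *m Om *m g = hyperbolic_sum Om' & lsubmx g = v].
Proof.
case/andP => uOm /eqP skew v0.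
have [w vw] : exists w, form Om v w = 1.
  have [w vw] : exists w, form Om v w != 0.
    apply: contrapT => /forallNP H; move/eqP: v0; apply; apply: (form_nondeg uOm) => q.
    by apply/eqP; apply: contraT => /H.
  by exists ((form Om v w)^-1 *: w); rewrite formZr mulVf.
pose P := row_mx (Om *m v) (Om *m w); pose K := kermx P.
have leK : (m <= \rank K)%N.
  by have := rank_leq_col P; rewrite mxrank_ker; move: (\rank P) => r; lia.
(* The rank of [K] is only known to be at least m here; [pid_mx] keeps m rows of its base. *)
pose B : 'M_(m, 1 + (m + 1)) := pid_mx m *m row_base K.
have freeB : row_free B.
  by rewrite /row_free mxrankMfree ?row_base_free // rank_pid_mx.
have BP : B *m P = 0.
  apply/sub_kermxP; apply: submx_trans (submxMl _ _) _; by rewrite eq_row_base.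
have [Bv Bw] : B *m Om *m v = 0 /\ B *m Om *m w = 0.
  by have /eqP := BP; rewrite mul_mx_row !mulmxA row_mx_eq0 => /andP[/eqP -> /eqP ->].
have wv : form Om w v = -1 by rewrite form_skew // vw.
have trE k (X : 'M[F]_(k, _)) p : X *m Om *m p = 0 -> p^T *m Om *m X^T = 0.
  by move=> Xp; apply: trmx_inj; rewrite !trmx_mul !trmxK skew mulNmx mulmxN mulmxA Xp trmx0 oppr0.
have vB := trE _ _ _ _ Bv; have wB := trE _ _ _ _ Bw.
pose R := col_mx v^T (col_mx B w^T).
pose Om' := B *m Om *m B^T.
have gram : R *m Om *m R^T = hyperbolic_sum Om'.
  rewrite !tr_col_mx !trmxK !mul_col_mx !mul_mx_row !formE vB wB Bv Bw !form_alt //.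
  by rewrite vw wv !raddf0.
have uR : R \in unitmx.
  rewrite -row_free_unit; apply: inj_row_free => c cR.
  have cE : c = row_mx (lsubmx c) (row_mx (lsubmx (rsubmx c)) (rsubmx (rsubmx c))).
    by rewrite !hsubmxK.
  set a := lsubmx c in cE; set b := lsubmx _ in cE; set d := rsubmx _ in cE.
  have cR' : a *m v^T + (b *m B + d *m w^T) = 0 by rewrite -!mul_row_col -cE.
  have a0 : a = 0.
    have := congr1 (fun X => X *m Om *m w) cR'.
    rewrite /= !mulmxDl -!(mulmxA b) Bw -!(mulmxA a) -!(mulmxA d) !formE.
    by rewrite vw form_alt // !mul_mx_scalar scale1r scale0r !mul0mx mulmx0 !addr0.
  have d0 : d = 0.
    have := congr1 (fun X => X *m Om *m v) cR'.
    rewrite /= !mulmxDl -!(mulmxA b) Bv -!(mulmxA a) -!(mulmxA d) !formE.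
    rewrite wv form_alt // !mul_mx_scalar scaleN1r scale0r !mul0mx mulmx0 !add0r.
    by move/eqP; rewrite oppr_eq0 => /eqP.
  have b0 : b = 0.
    by apply: (row_free_inj freeB); rewrite mul0mx -cR' a0 d0 !mul0mx add0r addr0.
  by rewrite cE a0 b0 d0 !row_mx0.
exists R^T, Om'; split.
- by rewrite unitmx_tr.
- apply/andP; split; last by rewrite /Om' trmx_mul [(B *m Om)^T]trmx_mul trmxK skew mulNmx mulmxN mulmxA eqxx.
  rewrite -row_free_unit; apply: inj_row_free => b bOm.
  have : row_mx 0 (row_mx b 0) *m (R *m Om *m R^T) = 0.
    rewrite gram /hyperbolic_sum !mul_row_col !mul0mx add0r addr0 !mul_mx_row bOm !mulmx0.
    by rewrite !row_mx0.
  move=> bG; have : row_mx 0 (row_mx b 0) = 0 :> 'rV_(1 + (m + 1)).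
    by apply: (row_free_inj (A := R *m Om *m R^T)); rewrite ?mul0mx // row_free_unit !unitmx_mul unitmx_tr uR uOm.
  by move/eqP; rewrite !row_mx_eq0 => /and3P[_ /eqP].
- by rewrite trmxK.
- by rewrite tr_col_mx row_mxKl trmxK.
Qed.

Lemma eigenvector n (x : 'M[F]_n) : (0 < n)%N ->
  exists (v : 'cV_n) a, v != 0 /\ x *m v = a *: v.
Proof.
move=> n0; have [a] : exists a, root (char_poly x^T) a.
  by apply/closed_rootP; rewrite size_char_poly -lt0n.
rewrite -eigenvalue_root_char => /eigenvalueP[v vx v0].
exists v^T, a; split; first by rewrite trmx_eq0.
by apply: trmx_inj; rewrite trmx_mul trmxK vx linearZ /= trmxK.
Qed.

Lemma hyperbolic_sumE m (Om : 'M[F]_m) : hyperbolic_sum Om =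
  block_mx 0 (row_mx 0 1%:M) (col_mx 0 (-1)%:M) (block_mx Om 0 0 0).
Proof.
by rewrite /hyperbolic_sum [RHS]block_mxEv; congr (col_mx _ _); rewrite block_mxEv -block_mxEv -block_mxEh.
Qed.

(** Adjointness ties the last row of [X] to its first column, so the last row is e a times the last
    unit vector; the middle block of the same equation is adjointness of [M]. The sign [e] is 1 for
    x and -1 for y. *)
Lemma peel_adjoint m (Om : 'M[F]_m) X e a :
  X^T *m hyperbolic_sum Om = e *: (hyperbolic_sum Om *m X) -> e ^+ 2 = 1 ->
  lsubmx X = col_mx a%:M 0 ->
  exists2 M, peeled a M (e * a) X & M^T *m Om = e *: (Om *m M).
Proof.
move=> adj e2 colX.
pose r := lsubmx (usubmx (rsubmx X)); pose s := rsubmx (usubmx (rsubmx X)).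
pose D := dsubmx (rsubmx X).
pose M := ulsubmx D; pose t := ursubmx D; pose p := dlsubmx D; pose q := drsubmx D.
have XE : X = block_mx a%:M (row_mx r s) 0 (block_mx M t p q).
  rewrite -[LHS]hsubmxK colX -[rsubmx X]vsubmxK -[usubmx (rsubmx X)]hsubmxK.
  by rewrite -[dsubmx (rsubmx X)]submxK -block_mxEh.
clearbody r s M t p q; clear D; move: adj; rewrite XE hyperbolic_sumE !tr_block_mx tr_row_mx !mulmx_block scale_block_mx !trmx0 tr_scalar_mx.
case/eq_block_mx => _ eUR _ eDR.
have {eUR} [p0 qE] : p = 0 /\ q = (e * a)%:M.
  move: eUR; rewrite !mul0mx addr0 add0r mul_row_block !mul0mx !mul1mx !add0r mul_mx_row mulmx0 mulmx1.
  rewrite scale_row_mx => /eq_row_mx[ep eq].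
  have e0 : e != 0 by apply: contra_eq_neq e2 => ->; rewrite expr0n eq_sym oner_eq0.
  split; first by apply/eqP; move/esym/eqP: ep; rewrite scaler_eq0 (negPf e0).
  by rewrite -[q]scale1r -e2 expr2 -scalerA -eq scale_scalar_mx.
exists M; first by exists r, s, t; rewrite p0 qE.
move: eDR; rewrite !mul_col_row !add_block_mx scale_block_mx.
by case/eq_block_mx; rewrite !mulmx0 !mul0mx !addr0 !add0r.
Qed.

(** This is 2k, written so that peeling two outer coordinates holds by computation, without casts of
    matrix sizes. *)
Fixpoint hdim k := if k is k'.+1 then (1 + (hdim k' + 1))%N else 0%N.

Lemma hdimE k : hdim k = k.*2.
Proof. by elim: k => //= k ->; rewrite doubleS addn1 add1n. Qed.

Definition mxconj n (g x : 'M[F]_n) := invmx g *m x *m g.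

Lemma mxconjM n (g x y : 'M[F]_n) : g \in unitmx ->
  mxconj g (x * y) = mxconj g x * mxconj g y.
Proof. by move=> ug; rewrite /mxconj -!mulmxE -!mulmxA (mulKVmx ug). Qed.

Lemma mxconjX n (g x : 'M[F]_n) k : g \in unitmx -> mxconj g (x ^+ k) = mxconj g x ^+ k.
Proof.
move=> ug; elim: k => [|k IH]; first by rewrite !expr0 /mxconj mulmx1 mulVmx.
by rewrite !exprS mxconjM // IH.
Qed.

Lemma mxconj_trace n (g x : 'M[F]_n) : g \in unitmx -> \tr (mxconj g x) = \tr x.
Proof. by move=> ug; rewrite /mxconj mxtrace_mulC mulmxA mulmxV // mul1mx. Qed.

Lemma mxconj_eq0 n (g x : 'M[F]_n) : g \in unitmx -> mxconj g x = 0 -> x = 0.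
Proof.
move=> ug /(congr1 (fun a => g *m a *m invmx g)).
by rewrite /mxconj !mulmxA mulmxV // mul1mx mulmxK // mulmx0 mul0mx.
Qed.

Lemma mxconj_adjoint n (Om g x : 'M[F]_n) e : g \in unitmx ->
  x^T *m Om = e *: (Om *m x) ->
  (mxconj g x)^T *m (g^T *m Om *m g) = e *: (g^T *m Om *m g *m mxconj g x).
Proof.
move=> ug adj; rewrite /mxconj !trmx_mul trmx_inv.
rewrite -!mulmxA [invmx g^T *m _]mulmxA mulVmx ?unitmx_tr // mul1mx.
rewrite [g *m (invmx g *m _)]mulmxA mulmxV // mul1mx [x^T *m _]mulmxA adj.
by rewrite -scalemxAl -scalemxAr -!mulmxA.
Qed.

Lemma adjointX n (Om x : 'M[F]_n) e k : x^T *m Om = e *: (Om *m x) ->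
  (x ^+ k)^T *m Om = e ^+ k *: (Om *m x ^+ k).
Proof.
move=> adj; elim: k => [|k IH]; first by rewrite !expr0 scale1r trmx1 mul1mx mulmx1.
rewrite exprSr exprS -mulmxE trmx_mul -mulmxA IH -scalemxAr (mulmxA x^T) adj -scalemxAl scalerA.
by rewrite -mulmxA mulmxE -exprS exprSr [e * _]mulrC.
Qed.

Lemma lsubmx_mulmx m n p q (A : 'M[F]_(m, n)) (B : 'M_(n, p + q)) :
  lsubmx (A *m B) = A *m lsubmx B.
Proof. by rewrite -{1}[B]hsubmxK mul_mx_row row_mxKl. Qed.

Lemma peeled_sandwich m a b (M : 'M[F]_m) X P :
  peeled 0 M 0 X -> peeled a 0 b P -> X * P * X = 0.
Proof.
move=> [r [s [t ->]]] [r' [s' [t' ->]]]; rewrite -!mulmxE !raddf0.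
rewrite !(mulmx_block, mul_row_block, mulmx0, mul0mx, addr0, add0r, mul_row_col).
by rewrite /block_mx !(row_mx0, col_mx0).
Qed.

(** X P is supported in the last column and P X in the first row; being equal, they live in the
    corner. *)
Lemma peeled_corner m a b (M : 'M[F]_m) X P :
  peeled 0 M 0 X -> peeled a 0 b P -> X * P = P * X ->
  exists c, X * P = block_mx 0 (row_mx 0 c) 0 0.
Proof.
move=> [r [s [t ->]]] [r' [s' [t' ->]]]; rewrite -!mulmxE !raddf0.
rewrite !(mulmx_block, mul_row_block, mulmx0, mul0mx, addr0, add0r, mul_row_col, mul_mx_row).
case/eq_block_mx => _ _ _ /eq_block_mx[_ -> _ _]; eexists; congr block_mx.
by rewrite /block_mx !(row_mx0, col_mx0).
Qed.

Lemma peel_eigenvector m (Om : 'M[F]_(1 + (m + 1))) (v : 'cV_(1 + (m + 1))) : symplectic Om -> v != 0 -> exists g (Om' : 'M[F]_m),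
    [/\ g \in unitmx, symplectic Om', g^T *m Om *m g = hyperbolic_sum Om' &
     forall e (x : 'M_(1 + (m + 1))) a, e ^+ 2 = 1 -> x^T *m Om = e *: (Om *m x) -> x *m v = a *: v ->
     exists2 M, peeled a M (e * a) (mxconj g x) & M^T *m Om' = e *: (Om' *m M)].
Proof.
move=> sOm v0; have [g [Om' [ug sOm' gram gv]]] := peel_form sOm v0.
exists g, Om'; split=> // e x a e2 adj xv; apply: peel_adjoint => //.
  by rewrite -gram; exact: mxconj_adjoint.
rewrite /mxconj lsubmx_mulmx gv -mulmxA xv -scalemxAr -gv -lsubmx_mulmx mulVmx //.
by rewrite scalar_mx_block block_mxEh row_mxKl scale_col_mx scaler0 scale_scalar_mx mulr1.
Qed.

(* Peeling off eigenvectors: the eigenvalues of x come in pairs a, e * a. *)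
Lemma adjoint_spectrum k e (Om x : 'M[F]_(hdim k)) : symplectic Om -> e ^+ 2 = 1 ->
  x^T *m Om = e *: (Om *m x) ->
  exists s : seq F, [/\ size s = k,
    forall j, \tr (x ^+ j) = \sum_(a <- s) (a ^+ j + (e * a) ^+ j),
    all (pred1 0) s -> x ^+ hdim k = 0 &
    e = 1 -> all (pred1 0) s -> x ^+ k = 0].
Proof.
move=> + e2; elim: k => [|k IH] /= in Om x *.
  move=> _ _; exists [::]; split=> // [j|_|_ _]; last 2 first.
  - by apply/matrixP => -[].
  - by apply/matrixP => -[].
  by rewrite big_nil /mxtrace big_ord0.
move=> sOm adj; have [//|v [a [v0 xv]]] := eigenvector x.
have [g [Om' [ug sOm' gram gP]]] := peel_eigenvector sOm v0.
have [M pX adjM] := gP _ _ _ e2 adj xv.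
have [s [szs trM nilM halfM]] := IH _ _ sOm' adjM.
pose X := mxconj g x; rewrite -/X in pX.
exists (a :: s); split=> [|j|/= /andP[/eqP a0 /nilM M0]|e1 /= /andP[/eqP a0 /(halfM e1) M0]].
- by rewrite /= szs.
- rewrite -(mxconj_trace _ ug) mxconjX // (peeled_trace (peeledX j pX)) trM big_cons.
  by ring.
- apply: (mxconj_eq0 ug); rewrite mxconjX // exprD exprD expr1 -/X.
  rewrite a0 mulr0 in pX; have := peeledX (hdim k) pX; rewrite M0 mulrA.
  move=> pP; apply: peeled_sandwich pX pP.
- apply: (mxconj_eq0 ug); rewrite mxconjX // -/X.
  rewrite a0 mulr0 in pX; have := peeledX k pX; rewrite M0 => pP.
  have adjX : X^T *m hyperbolic_sum Om' = 1 *: (hyperbolic_sum Om' *m X).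
    by rewrite -gram; apply: mxconj_adjoint => //; rewrite -e1.
  have := adjointX k.+1 adjX; rewrite expr1n.
  have [|c] := peeled_corner pX pP; first by rewrite -exprS exprSr.
  rewrite -exprS => ->.
  rewrite hyperbolic_sumE tr_block_mx tr_row_mx !trmx0 !mulmx_block !mul0mx !mulmx0 !addr0.
  rewrite scale1r !mul_col_row => /eq_block_mx[_ _ _] /eq_block_mx[_ _ _].
  rewrite mulmx1 mul_scalar_mx scaleN1r => cT.
  (* Up to sign the corner is a diagonal entry of the form times X^(k+1), a skew matrix. This is how
     the nilpotency exponent of a self-adjoint x gets halved. *)
  have -> : c = 0.
    apply/matrixP => i j; rewrite !ord1 mxE; apply/eqP.
    have /matrixP/(_ 0 0) := cT; rewrite !mxE => /eqP.
    by rewrite -addr_eq0 -mulr2n mulrn_eq0.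
  by rewrite row_mx0 /block_mx !row_mx0 col_mx0.
Qed.

(** Newton's identities: six times the monic cubic with roots x, y, z, evaluated at x, with its
    coefficients written in power sums. *)
Lemma three_power_sums (x y z : F) : x + y + z = 0 -> x ^+ 2 + y ^+ 2 + z ^+ 2 = 0 ->
  x ^+ 3 + y ^+ 3 + z ^+ 3 = 0 -> x = 0.
Proof.
move=> p1 p2 p3; have : x ^+ 3 *+ 6 = 0.
  rewrite (_ : _ *+ 6 = x ^+ 2 *+ 6 * (x + y + z)
    - x *+ 3 * ((x + y + z) ^+ 2 - (x ^+ 2 + y ^+ 2 + z ^+ 2)) + (x + y + z) ^+ 3
    - (x + y + z) * (x ^+ 2 + y ^+ 2 + z ^+ 2) *+ 3 + (x ^+ 3 + y ^+ 3 + z ^+ 3) *+ 2); last by ring.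
  by rewrite p1 p2 p3; ring.
by move/eqP; rewrite mulrn_eq0 expf_eq0 /= => /eqP.
Qed.

Lemma power_sums_eq0 (s : seq F) : (size s <= 3)%N ->
  (forall j, (0 < j <= 3)%N -> \sum_(a <- s) a ^+ j = 0) -> all (pred1 0) s.
Proof.
move=> szs ps; move: (ps 1%N isT) (ps 2%N isT) (ps 3%N isT).
case: s szs {ps} => [|x [|y [|z [|]]]] //= _; rewrite !big_cons !big_nil !addr0 ?addrA ?expr1.
- by move=> ->; rewrite eqxx.
- move=> p1 p2 p3; have x0 : x = 0 by apply: (@three_power_sums x y 0); rewrite ?expr0n ?addr0.
  by move: p1; rewrite x0 add0r => ->; rewrite eqxx.
- move=> p1 p2 p3; have x0 : x = 0 by exact: (@three_power_sums x y z).
  move: p1 p2 p3; rewrite x0 ?expr0n /= ?add0r => p1 p2 p3.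
  have y0 : y = 0 by apply: (@three_power_sums y z 0); rewrite ?expr0n ?addr0.
  by move: p1; rewrite y0 add0r => ->; rewrite eqxx.
Qed.

(** For e = 1 the eigenvalues are doubled: tr x^j is twice a power sum of k <= 3 numbers. *)
Lemma selfadjoint_nilpotent k (Om x : 'M[F]_(hdim k)) : (k <= 3)%N -> symplectic Om ->
  x^T *m Om = Om *m x -> (forall j, (0 < j <= 3)%N -> \tr (x ^+ j) = 0) -> x ^+ k = 0.
Proof.
move=> k3 sOm adj tr0; have adj1 : x^T *m Om = 1 *: (Om *m x) by rewrite scale1r.
have [s [szs trx _ nil]] := adjoint_spectrum sOm (expr1n _ 2) adj1; apply: nil => //.
apply: power_sums_eq0; first by rewrite szs.
move=> j /tr0; rewrite trx => /eqP; under eq_bigr do rewrite mul1r -mulr2n.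
by rewrite sumrMnl mulrn_eq0 => /eqP.
Qed.

(** For e = -1 the eigenvalues are pairs a, -a, and the power-sum argument is applied to the squares
    a^2. *)
Lemma skewadjoint_nilpotent k (Om y : 'M[F]_(hdim k)) : (k <= 3)%N -> symplectic Om ->
  y^T *m Om = - (Om *m y) -> (forall j, (0 < j <= 3)%N -> \tr (y ^+ (2 * j)) = 0) ->
  y ^+ hdim k = 0.
Proof.
move=> k3 sOm adj tr0; have adj1 : y^T *m Om = (-1) *: (Om *m y) by rewrite scaleN1r.
have e2 : (-1) ^+ 2 = 1 :> F by rewrite sqrrN expr1n.
have [s [szs trs nil _]] := adjoint_spectrum sOm e2 adj1; apply: nil.
have : all (pred1 0) [seq a ^+ 2 | a <- s].
  apply: power_sums_eq0; first by rewrite size_map szs.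
  move=> j /tr0; rewrite trs big_map => e0.
  have : (\sum_(a <- s) (a ^+ 2) ^+ j) *+ 2 = 0.
    rewrite -[RHS]e0 -sumrMnl; apply: eq_bigr => a _.
    by rewrite mulN1r !exprM sqrrN mulr2n.
  by move/eqP; rewrite mulrn_eq0 => /eqP.
by rewrite all_map => /sub_all; apply => a /=; rewrite expf_eq0.
Qed.
End Peeling.

(** * Common kernel vectors: x^2 = 0 *)

Section CommonKernel.
Variable F : numClosedFieldType.

(* The 4 x 4 submatrix has determinant the square of its Pfaffian, which is *)
(* the difference of the two sides.                                        *)
Lemma skew_rank_le3 n (S : 'M[F]_n) : S^T = - S -> (\rank S <= 3)%N ->
  forall i j k l, S i j * S k l = S i k * S j l - S i l * S j k.
Proof.
move=> skew rk i j k l; have sk a b : S b a = - S a b.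
  by have /matrixP/(_ a b) := skew; rewrite !mxE.
have sd a : S a a = 0.
  by apply/eqP; have /eqP := sk a a; rewrite -addr_eq0 -mulr2n mulrn_eq0.
pose pf := S i j * S k l - S i k * S j l + S i l * S j k.
suff : pf = 0 by move=> pf0; apply/eqP; rewrite -subr_eq0 -[X in _ == X]pf0; apply/eqP; rewrite /pf; ring.
apply/eqP; apply: contraTT rk => pf0; rewrite -ltnNge.
pose f (a : 'I_4) := tnth [tuple i; j; k; l] a.
pose E : 'M[F]_(4, n) := \matrix_(a, b) (b == f a)%:R.
(* The inverse of the 4 x 4 skew submatrix: its Pfaffian adjugate divided by [pf]. It witnesses rank
   at least 4. *)
pose adj : 'M[F]_4 := \matrix_(a, b) (pf^-1 * nth 0 (nth [::] [::
  [:: 0; - S k l; S j l; - S j k]; [:: S k l; 0; - S i l; S i k];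
  [:: - S j l; S i l; 0; - S i j]; [:: S j k; - S i k; S i j; 0]] a) b).
apply: (@mulmx1_min_rank _ _ _ _ S (adj *m E) E^T).
have ES : E *m S *m E^T = \matrix_(a, b) S (f a) (f b).
  apply/matrixP => a b; rewrite !mxE (bigD1 (f b)) //= [X in _ + X]big1 => [|c /negPf cb].
    rewrite addr0 !mxE (bigD1 (f a)) //= [X in _ + X]big1 => [|c /negPf ca].
      by rewrite !mxE !eqxx mul1r mulr1 !addr0.
    by rewrite !mxE ca mul0r.
  by rewrite [E^T _ _]mxE [E _ _]mxE cb mulr0.
rewrite -2!mulmxA (mulmxA E) ES.
apply/matrixP => a b; rewrite !mxE !big_ord_recl big_ord0 !mxE.
have [ji [ki [li [kj [lj lk]]]]] := (sk i j, (sk i k, (sk i l, (sk j k, (sk j l, sk k l))))).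
case: a => [[|[|[|[|//]]]] ?]; case: b => [[|[|[|[|//]]]] ?];
  rewrite /f /= !(tnth_nth i) /= ?ji ?ki ?li ?kj ?lj ?lk ?sd /eq_op /= ?mulr1n ?mulr0n; move: pf0; rewrite /pf => pf0; field; by [].
Qed.

(** Om x is skew, and x^2 = 0 bounds its rank by n/2 <= 3. The Pfaffian relations then write it as a
    wedge of two of its rows i and j with S i j <> 0. So [u] and [v] are columns of x, one rescaled,
    and their pairing is a multiple of an entry of Om x^2. *)
Lemma alternating_rank2 n (Om x : 'M[F]_n) : (n <= 6)%N -> symplectic Om ->
  x^T *m Om = Om *m x -> x ^+ 2 = 0 -> x != 0 ->
  exists u v, x = (v *m u^T - u *m v^T) *m Om /\ form Om u v = 0.
Proof.
move=> n6 /andP[uOm /eqP skew] adj x2 x0; have [S SE] : exists S, S = Om *m x by exists (Om *m x).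
have skS : S^T = - S by rewrite SE trmx_mul skew mulmxN adj.
have rkS : (\rank S <= 3)%N.
  have : (\rank x + \rank x <= n)%N.
    by apply: mulmx0_rank_max; rewrite mulmxE -expr2.
  have : (\rank S <= \rank x)%N by rewrite SE mxrankM_maxr.
  by move: (\rank S) (\rank x) => a b; lia.
have [i [j Sij]] : exists i j, S i j != 0.
  apply: contrapT => H; move/eqP: x0; apply.
  rewrite -[x](mulKmx uOm) -SE (_ : S = 0) ?mulmx0 //; apply/matrixP => i j; rewrite [RHS]mxE.
  by apply/eqP; apply: contraT => Sij; case: H; exists i, j.
pose u := col i x; pose v := (S i j)^-1 *: col j x.
have uOmE : u^T *m Om = row i S by rewrite /u tr_col -row_mul adj SE.
have vOmE : v^T *m Om = (S i j)^-1 *: row j S.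
  by rewrite /v linearZ /= -scalemxAl tr_col -row_mul adj SE.
exists u, v; split; last first.
  rewrite /form uOmE /v -scalemxAr mxE colE mulmxA -row_mul.
  have -> : S *m x = 0 by rewrite SE -mulmxA (x2 : x *m x = 0) mulmx0.
  by rewrite row0 mul0mx [X in _ * X]mxE mulr0.
rewrite mulmxBl -!mulmxA uOmE vOmE; apply: (can_inj (mulKmx uOm)).
rewrite mulmxBr !mulmxA -SE /v /u -scalemxAr !colE !mulmxA -SE -!colE; apply/matrixP => k l.
rewrite !mxE !big_ord1 !mxE.
have := skew_rank_le3 skS rkS i j k l.
have sk a b : S b a = - S a b by have /matrixP/(_ a b) := skS; rewrite !mxE.
rewrite (sk i k) (sk j k) => e; apply: (mulfI Sij); rewrite e; field.
by [].
Qed.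

(** The hypotheses say that det(A + l B) vanishes for all l, where A and B are the symmetric
    matrices with entries a, b, c and a', b', c'. As quadratic forms both are multiples of squares
    of linear forms, and the mixed condition makes these proportional if neither is zero. For a <> 0
    the common kernel contains (-b, a). *)
Lemma singular_pencil (a b c a' b' c' : F) : a * c = b ^+ 2 -> a' * c' = b' ^+ 2 ->
  a * c' + a' * c = 2 * b * b' -> exists s t, [/\ (s != 0) || (t != 0),
    s * a + t * b = 0, s * b + t * c = 0, s * a' + t * b' = 0 & s * b' + t * c' = 0].
Proof.
wlog a0 : a b c a' b' c' / a != 0 => [H|] e1 e2 e3.
  have [a0|] := eqVneq a 0; last by move=> a0; exact: (H a b c a' b' c').
  have [a0'|] := eqVneq a' 0; last first.
    move=> a0'; have [||||s [t [st ? ? ? ?]]] := H a' b' c' a b c => //.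
      by rewrite addrC e3; ring.
    by exists s, t.
  have b0 : b = 0 by apply/eqP; rewrite -[_ == _](expf_eq0 b 2) -e1 a0 mul0r.
  have b0' : b' = 0 by apply/eqP; rewrite -[_ == _](expf_eq0 b' 2) -e2 a0' mul0r.
  by exists 1, 0; rewrite oner_eq0 a0 b0 a0' b0' !mul0r !mulr0 !addr0.
exists (- b), a; rewrite a0 orbT; split=> //; first by ring.
- by rewrite e1; ring.
- suff : (- b * a' + a * b') ^+ 2 = 0 by move/eqP; rewrite expf_eq0 => /eqP.
  have -> : (- b * a' + a * b') ^+ 2 = a' ^+ 2 * (b ^+ 2) - a * a' * (2 * b * b') + a ^+ 2 * (b' ^+ 2) by ring.
  by rewrite -e1 -e2 -e3; ring.
- have e4 : a * b' = b * a'.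
    suff : (- b * a' + a * b') ^+ 2 = 0 by move/eqP; rewrite expf_eq0 => /eqP e; apply/eqP; rewrite -subr_eq0 -[X in _ == X]e; apply/eqP; ring.
    have -> : (- b * a' + a * b') ^+ 2 = a' ^+ 2 * (b ^+ 2) - a * a' * (2 * b * b') + a ^+ 2 * (b' ^+ 2) by ring.
    by rewrite -e1 -e2 -e3; ring.
  apply: (mulfI a0); rewrite mulr0.
  have -> : a * (- b * b' + a * c') = a * (a * c' + a' * c) - a * (2 * b * b') - a' * (a * c - b ^+ 2) + b * (a * b' - b * a') by ring.
  by rewrite e3 e1 e4; ring.
Qed.

(** As y^6 = 0 and y^5 p <> 0, the vectors p, yp, ..., y^5 p are independent, hence a basis in
    dimension at most 6. *)
Lemma krylov_nondeg n (Om y : 'M[F]_n) (p w : 'cV_n) : (n <= 6)%N -> symplectic Om ->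
  y ^+ 6 = 0 -> y ^+ 5 *m p != 0 ->
  (forall k, (k < 6)%N -> form Om w (y ^+ k *m p) = 0) -> w = 0.
Proof.
move=> n6 /andP[uOm /eqP skew] y6 y5p wp; pose K : 'M[F]_(6, n) := \matrix_(k, i) (y ^+ k *m p) i 0.
have y6' k : (6 <= k)%N -> y ^+ k = 0 by move=> le6; rewrite -(subnK le6) exprD y6 mulr0.
have freeK : row_free K.
  apply: inj_row_free => c cK.
  have sumc : \sum_(k < 6) c 0 k *: (y ^+ k *m p) = 0.
    apply/colP => i; rewrite summxE; have /rowP/(_ i) := cK; rewrite !mxE => e; rewrite -[RHS]e.
    by apply: eq_bigr => k _; rewrite !mxE.
  suff c0 m (k : 'I_6) : (k < m)%N -> c 0 k = 0.
    by apply/rowP => k; rewrite mxE (c0 6 k).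
  elim: m k => // m IH k; rewrite ltnS leq_eqVlt => /orP[/eqP km|]; last exact: IH.
  have := congr1 (mulmx (y ^+ (5 - k))) sumc; rewrite mulmx0 mulmx_sumr (bigD1 k) //= big1 => [|j jk].
    have k5 : (k <= 5)%N by rewrite -ltnS.
    rewrite addr0 -scalemxAr mulmxA mulmxE -exprD subnK // => /eqP.
    by rewrite scaler_eq0 (negPf y5p) orbF => /eqP.
  have [jm|jm] := ltnP j m; first by rewrite IH // scale0r mulmx0.
  rewrite -scalemxAr mulmxA mulmxE -exprD y6' ?mul0mx ?scaler0 //.
  have : (m < j)%N by rewrite ltn_neqAle jm andbT -km eq_sym.
  by have := ltn_ord k; lia.
have fullK : row_full K.
  by rewrite /row_full; move: freeK (rank_leq_col K); rewrite /row_free => /eqP ->; lia.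
have [B BK] := row_fullP fullK.
have Kw : K *m (Om *m w) = 0.
  apply/colP => k; rewrite [RHS]mxE -[RHS]oppr0 -(wp k (ltn_ord k)) form_skew // opprK.
  rewrite /form -mulmxA mxE [RHS]mxE; apply: eq_bigr => i _.
  by rewrite [K _ _]mxE [_^T _ _]mxE.
by rewrite -[w](mulKmx uOm) -[Om *m w]mul1mx -BK -mulmxA Kw !mulmx0.
Qed.

(** Moving y^k across the form costs (-1)^k and exchanging the arguments one more sign: symmetric
    for odd k, alternating for even k. *)
Lemma form_powers n (Om y : 'M[F]_n) p q k : Om^T = - Om -> y^T *m Om = - (Om *m y) ->
  form Om q (y ^+ k *m p) = (-1) ^+ k.+1 * form Om p (y ^+ k *m q).
Proof.
move=> skew adj; rewrite form_skew //.
have adjk : (y ^+ k)^T *m Om = (-1) ^+ k *: (Om *m y ^+ k) by apply: adjointX; rewrite scaleN1r.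
have -> : form Om (y ^+ k *m p) q = (-1) ^+ k * form Om p (y ^+ k *m q).
  rewrite /form trmx_mul -(mulmxA p^T) adjk -scalemxAr -scalemxAl mxE.
  by rewrite !mulmxA.
by rewrite exprS mulN1r mulNr.
Qed.

Lemma last_power_kernel n (y : 'M[F]_n) (p : 'cV_n) N : y ^+ N *m p = 0 -> p != 0 ->
  exists k, y ^+ k *m p != 0 /\ y *m (y ^+ k *m p) = 0.
Proof.
elim: N => [|N IH] yp p0; first by rewrite mul1mx in yp; rewrite yp eqxx in p0.
have [e|ypN] := eqVneq (y ^+ N *m p) 0; first exact: IH.
by exists N; rewrite mulmxA mulmxE -exprS.
Qed.

Lemma mxtrace_rank1 n (v : 'cV[F]_n) (r : 'rV_n) : \tr (v *m r) = (r *m v) 0 0.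
Proof. by rewrite mxtrace_mulC trace_mx11. Qed.

(* Here x = (v u^T - u v^T) Om, so the traces are expressions in the forms          *)
(* f_k = Om(., y^k .) on the plane <u, v>. Their vanishing yields p in the plane    *)
(* with f_k(p, .) = 0 on it for k <= 4; the last nonzero y^k p is the common vector. *)
Lemma common_kernel_square0 n (Om x y : 'M[F]_n) : (n <= 6)%N -> symplectic Om ->
  x^T *m Om = Om *m x -> y^T *m Om = - (Om *m y) -> x ^+ 2 = 0 -> x != 0 -> y ^+ 6 = 0 ->
  \tr (x * y ^+ 2) = 0 -> \tr ((x * y) ^+ 2) = 0 -> \tr (x * y ^+ 4) = 0 ->
  \tr (x * y ^+ 3 * x * y) = 0 -> \tr ((x * y ^+ 3) ^+ 2) = 0 ->
  exists v : 'cV_n, [/\ v != 0, x *m v = 0 & y *m v = 0].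
Proof.
move=> n6 sOm adjx adjy x2 x0 y6.
have [u [v [xE uv0]]] := alternating_rank2 n6 sOm adjx x2 x0.
have [_ /eqP skew] := andP sOm.
pose f k p q := form Om p (y ^+ k *m q).
have fsym k p q : f k q p = (-1) ^+ k.+1 * f k p q by exact: form_powers.
have xyE k : x * y ^+ k = v *m (u^T *m Om *m y ^+ k) - u *m (v^T *m Om *m y ^+ k).
  by rewrite xE -mulmxE !mulmxBl !mulmxA.
have tr1 k : \tr (x * y ^+ k) = f k u v - f k v u.
  by rewrite xyE raddfB /= !mxtrace_rank1 /f /form !mulmxA.
have tr2 k l : \tr (x * y ^+ k * (x * y ^+ l)) =
    f k u v * f l u v - f k u u * f l v v - f k v v * f l u u + f k v u * f l v u.
  rewrite !xyE -mulmxE mulmxBl !mulmxBr !raddfB /=.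
  have tr11 (a b : 'cV[F]_n) (r r' : 'rV_n) : \tr (a *m r *m (b *m r')) = (r *m b) 0 0 * (r' *m a) 0 0.
    by rewrite -mulmxA mxtrace_rank1 mulmxA {1}[r *m b]mx11_scalar mul_scalar_mx -scalemxAl [LHS]mxE.
  by rewrite !tr11 /f /form !mulmxA; ring.
(* For even k, tr(x y^k) is 2 f_k(u, v), so f_2 and f_4 vanish on the plane. The words (xy)^2,
   (xy^3)^2 and xy^3xy give, up to factors, the determinants and the mixed determinant of the
   symmetric forms f_1 and f_3. *)
rewrite tr1 => t2; rewrite expr2 -{1 2}[y]expr1 tr2 => t11; rewrite tr1 => t4.
rewrite -mulrA -{2}[y]expr1 tr2 => t31; rewrite expr2 tr2 => t33.
have neg0 z : z = - z -> z = 0 :> F.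
  by move=> e; apply/eqP; have := subrr z; rewrite {2}e opprK -mulr2n => /eqP; rewrite mulrn_eq0.
have f2 : f 2%N u v = 0.
  by apply: neg0; apply/eqP; rewrite -subr_eq0 opprK -[X in _ == X]t2; apply/eqP; rewrite (fsym 2%N u v); ring.
have f4 : f 4%N u v = 0.
  by apply: neg0; apply/eqP; rewrite -subr_eq0 opprK -[X in _ == X]t4; apply/eqP; rewrite (fsym 4%N u v); ring.
have f0 : f 0%N u v = 0 by rewrite /f expr0 mul1mx.
have feven q k : odd k = false -> f k q q = 0.
  by move=> ek; apply: neg0; rewrite {1}fsym -signr_odd /= ek mulN1r.
have fodd k p q : odd k -> f k q p = f k p q.
  by move=> ek; rewrite fsym -signr_odd /= ek mul1r.
have {t11} e1 : f 1%N u u * f 1%N v v = f 1%N u v ^+ 2.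
  apply/eqP; rewrite eq_sym -subr_eq0; apply/eqP/neg0/eqP; rewrite -subr_eq0 opprK -[X in _ == X]t11.
  by apply/eqP; rewrite (fodd 1%N u v) //; ring.
have {t33} e3 : f 3%N u u * f 3%N v v = f 3%N u v ^+ 2.
  apply/eqP; rewrite eq_sym -subr_eq0; apply/eqP/neg0/eqP; rewrite -subr_eq0 opprK -[X in _ == X]t33.
  by apply/eqP; rewrite (fodd 3%N u v) //; ring.
have {t31} e13 : f 1%N u u * f 3%N v v + f 3%N u u * f 1%N v v = 2 * f 1%N u v * f 3%N u v.
  apply/eqP; rewrite eq_sym -subr_eq0 -[X in _ == X]t31.
  by apply/eqP; rewrite (fodd 3%N u v) // (fodd 1%N u v) //; ring.
have [s [t [st k1 k2 k3 k4]]] := singular_pencil e1 e3 e13.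
have indep a b : a *: u + b *: v = 0 -> (a == 0) && (b == 0).
  move=> ab0; apply: contraNT x0; rewrite negb_and xE => /orP[a0|b0].
    have -> : u = - (b / a) *: v.
      by apply: (scalerI a0); rewrite scalerA mulrN mulrC divfK // scaleNr; apply/eqP; rewrite -addr_eq0 ab0.
    by rewrite linearZ /= -scalemxAr -scalemxAl subrr mul0mx.
  have -> : v = - (a / b) *: u.
    by apply: (scalerI b0); rewrite scalerA mulrN mulrC divfK // scaleNr; apply/eqP; rewrite -addr_eq0 addrC ab0.
  by rewrite linearZ /= -scalemxAr -scalemxAl subrr mul0mx.
pose p := s *: u + t *: v.
have p0 : p != 0 by apply: contraTneq st => /indep /andP[/eqP -> /eqP ->]; rewrite eqxx.
have fp k q : f k p q = s * f k u q + t * f k v q by rewrite /f formDl !formZl.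
have fuv k : (k <= 4)%N -> f k p u = 0 /\ f k p v = 0.
  case: k => [|[|[|[|[|//]]]]] _; rewrite !fp.
  - by rewrite (fsym 0%N u v) f0 !feven // !mulr0 addr0.
  - by rewrite (fodd 1%N u v).
  - by rewrite (fsym 2%N u v) f2 !feven // !mulr0 addr0.
  - by rewrite (fodd 3%N u v).
  - by rewrite (fsym 4%N u v) f4 !feven // !mulr0 addr0.
have krylov w : y ^+ 5 *m p != 0 -> (forall k, (k <= 4)%N -> f k p w = 0) ->
    f 5%N p w = 0 -> w = 0.
  move=> y5p wp w5; apply: (krylov_nondeg n6 sOm y6 y5p) => k; rewrite ltnS leq_eqVlt => /orP[/eqP ->|k4'].
    by rewrite -/(f 5%N w p) fsym w5 mulr0.
  by rewrite -/(f k w p) fsym wp ?mulr0.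
(* No trace controls f_5 directly. If f_5(p, w) <> 0, then y^5 p <> 0 and [krylov] applies: f_5(p,
   p) = 0 would force p = 0, and otherwise u and v are both multiples of p, against their
   independence. *)
have f5 : f 5%N p u = 0 /\ f 5%N p v = 0.
  have y5p w : f 5%N p w != 0 -> y ^+ 5 *m p != 0.
    by apply: contraNneq => e; rewrite fsym /f e /form mulmx0 mxE mulr0.
  have fpp k : f k p p = s * f k p u + t * f k p v.
    by rewrite {1}/f {2}/p mulmxDr -!scalemxAr formDr !formZr.
  have [e|ne] := eqVneq (f 5%N p p) 0.
    suff f5w w : f 5%N p w = 0 by [].
    apply/eqP; apply: contraNT p0 => /y5p y5p0; apply/eqP; apply: krylov => // k k4'.
    by rewrite fpp; have [-> ->] := fuv k k4'; rewrite !mulr0 addr0.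
  have prop w : (forall k, (k <= 4)%N -> f k p w = 0) -> exists a, w = a *: p.
    move=> wp; exists (f 5%N p w / f 5%N p p); apply/eqP; rewrite -subr_eq0; apply/eqP.
    have fB k : f k p (w - f 5%N p w / f 5%N p p *: p) = f k p w - f 5%N p w / f 5%N p p * f k p p.
      by rewrite {1}/f mulmxBr -!scalemxAr -scaleN1r formDr !formZr mulN1r.
    apply: krylov; first exact: (y5p p).
      by move=> k k4'; rewrite fB wp // (fpp k); have [-> ->] := fuv k k4'; rewrite !mulr0 addr0 mulr0 subr0.
    by rewrite fB divfK // subrr.
  have [a ua] := prop u (fun k k4' => proj1 (fuv k k4')).
  have [b vb] := prop v (fun k k4' => proj2 (fuv k k4')).
  have /indep/andP[] : (1 - a * s) *: u + (- (a * t)) *: v = 0.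
    by rewrite scalerBl scale1r -scalerA scaleNr -scalerA -addrA -opprD -scalerDr -/p -ua subrr.
  have /indep/andP[] : (- (b * s)) *: u + (1 - b * t) *: v = 0.
    by rewrite scalerBl scale1r -scalerA scaleNr -scalerA addrCA -opprD -scalerDr -/p -vb subrr.
  rewrite oppr_eq0 subr_eq0 => /eqP bs /eqP bt; rewrite subr_eq0 oppr_eq0 => /eqP as_ /eqP at_.
  have : (a * s) * (b * t) = (a * t) * (b * s) by ring.
  by rewrite -as_ -bt at_ mul0r mulr1 => /eqP; rewrite oner_eq0.
have fall k : f k p u = 0 /\ f k p v = 0.
  have [k4'|] := leqP k 4; first exact: fuv.
  rewrite leq_eqVlt => /orP[/eqP <- //|k6].
  by rewrite /f -(subnK k6) exprD y6 mulr0 !mul0mx /form !mulmx0 mxE.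
have y6p : y ^+ 6 *m p = 0 by rewrite y6 mul0mx.
have [k [ykp yykp]] := last_power_kernel y6p p0.
exists (y ^+ k *m p); split=> //.
rewrite xE mulmxBl mulmxBl -!mulmxA !(mulmxA _ Om) !formE.
have [pu pv] := fall k.
by rewrite -/(f k u p) -/(f k v p) !(fsym _ p) pu pv !mulr0 !mul_mx_scalar !scale0r subrr.
Qed.
End CommonKernel.

(** * Common kernel vectors: x^2 <> 0 *)

Section CubeZero.
Variable F : numClosedFieldType.

Definition ent (M : 'M[F]_6) i j := M (inord i) (inord j).

Lemma entP (M N : 'M[F]_6) :
  (forall i j, (i < 6)%N -> (j < 6)%N -> ent M i j = ent N i j) -> M = N.
Proof.
by move=> e; apply/matrixP => i j; have := e i j (ltn_ord i) (ltn_ord j); rewrite /ent !inord_val.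
Qed.

Lemma ent_mul (M N : 'M[F]_6) i j : ent (M * N) i j =
  ent M i 0 * ent N 0 j + (ent M i 1 * ent N 1 j + (ent M i 2 * ent N 2 j +
  (ent M i 3 * ent N 3 j + (ent M i 4 * ent N 4 j + ent M i 5 * ent N 5 j)))).
Proof.
rewrite /ent -mulmxE mxE (eq_bigr (fun k : 'I_6 => ent M i k * ent N k j)); last first.
  by move=> k _; rewrite /ent inord_val.
rewrite -(big_mkord xpredT (fun k => ent M i k * ent N k j)) unlock /=.
by rewrite addr0.
Qed.

Lemma ent_tr (M : 'M[F]_6) : \tr M =
  ent M 0 0 + (ent M 1 1 + (ent M 2 2 + (ent M 3 3 + (ent M 4 4 + ent M 5 5)))).
Proof.
rewrite /mxtrace (eq_bigr (fun k : 'I_6 => ent M k k)); last by move=> k _; rewrite /ent inord_val.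
by rewrite -(big_mkord xpredT (fun k => ent M k k)) unlock /= addr0.
Qed.

(** This is x in the basis e, f, xe, xf, x^2 e, x^2 f: two nilpotent Jordan blocks of size 3. *)
Definition shift2 : 'M[F]_6 := \matrix_(i, j) (i == (j + 2)%N :> nat)%:R.

Lemma ent_shift2 i j : (i < 6)%N -> (j < 6)%N -> ent shift2 i j = (i == (j + 2)%N)%:R.
Proof. by move=> i6 j6; rewrite /ent mxE !inordK. Qed.

Lemma ent_shift i j M : (i < 4)%N -> ent (shift2 * M) i.+2 j = ent M i j.
Proof.
move=> i4; rewrite ent_mul !ent_shift2 //.
by case: i i4 => [|[|[|[|//]]]] _ /=; rewrite ?mul0r ?mul1r ?add0r ?addr0.
Qed.

Lemma ent_shift0 j M : ent (shift2 * M) 0 j = 0.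
Proof. by rewrite ent_mul !ent_shift2 //= !mul0r !addr0. Qed.

Lemma ent_shift1 j M : ent (shift2 * M) 1 j = 0.
Proof. by rewrite ent_mul !ent_shift2 //= !mul0r !addr0. Qed.

Definition entE := (ent_shift0, ent_shift1, ent_shift, ent_mul).

(** Skew-adjointness, entry by entry, for the Gram matrix [antidiag] of that basis. *)
Definition skew2 (Y : 'M[F]_6) := forall i j, (i < 6)%N -> (j < 6)%N ->
  ent Y i j = (-1) ^+ (i + j).+1 * ent Y (5 - j) (5 - i).

Lemma skew2E Y : skew2 Y ->
  (ent Y 1 5 = - ent Y 0 4) * (ent Y 2 4 = - ent Y 1 3) * (ent Y 2 5 = ent Y 0 3) *
  (ent Y 3 4 = ent Y 1 2) * (ent Y 3 5 = - ent Y 0 2) * (ent Y 3 3 = - ent Y 2 2) *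
  (ent Y 4 4 = - ent Y 1 1) * (ent Y 4 5 = ent Y 0 1) * (ent Y 5 4 = ent Y 1 0) *
  (ent Y 5 5 = - ent Y 0 0) * (ent Y 4 2 = - ent Y 3 1) * (ent Y 4 3 = ent Y 2 1) *
  (ent Y 5 2 = ent Y 3 0) * (ent Y 5 3 = - ent Y 2 0) * (ent Y 5 1 = - ent Y 4 0).
Proof. by move=> rel; do !split; rewrite rel //= -signr_odd /= ?mulN1r ?mul1r. Qed.

Lemma mulrn2_eq0 (z : F) : z *+ 2 = 0 -> z = 0.
Proof. by move=> /eqP; rewrite mulrn_eq0 => /eqP. Qed.

(** The trace reads only the upper right 2 x 2 block B of [Y], which is traceless by [skew2], and
    then tr B^2 = -2 det B. *)
Lemma corner_det Y : skew2 Y -> \tr ((shift2 ^+ 2 * Y) ^+ 2) = 0 ->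
  ent Y 0 4 * ent Y 1 5 - ent Y 0 5 * ent Y 1 4 = 0.
Proof.
move=> /skew2E rel; rewrite !expr2 -!mulrA !ent_tr !entE //= ?add0r !rel => e.
apply/eqP; rewrite -oppr_eq0; apply/eqP/mulrn2_eq0; rewrite -[RHS]e; ring.
Qed.

(** Once the corner block is zero, tr(x^2 y^2) is -2 times the determinant of the block in rows 2, 3
    and columns 4, 5, and tr((xy)^2) is then twice the square of its trace: the block is
    nilpotent. *)
Lemma middle_det Y : skew2 Y -> ent Y 0 4 = 0 -> ent Y 0 5 = 0 -> ent Y 1 4 = 0 ->
  \tr (shift2 ^+ 2 * Y ^+ 2) = 0 -> \tr ((shift2 * Y) ^+ 2) = 0 ->
  ent Y 2 4 * ent Y 3 5 - ent Y 2 5 * ent Y 3 4 = 0 /\ ent Y 2 4 + ent Y 3 5 = 0.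
Proof.
move=> /skew2E rel a1 a2 a3; rewrite !expr2 -!mulrA !ent_tr !entE //= ?add0r !rel.
rewrite a1 a2 a3 => e1 e2.
have e3 : ent Y 1 3 * ent Y 0 2 - ent Y 0 3 * ent Y 1 2 = 0.
  by apply: mulrn2_eq0; rewrite -[RHS]oppr0 -[in RHS]e1; ring.
split; first by rewrite mulrNN.
apply/eqP; rewrite -[_ == _](expf_eq0 _ 2); apply/eqP/mulrn2_eq0.
rewrite -[RHS]e2 -[LHS]subr0 -[X in _ - X](mulr0 4) -[in X in _ - X]e3; ring.
Qed.

(** The corner block has rank one here. Together with the zero entries (0,4) and (1,4), the
    conclusion makes x^2 e an eigenvector of y. *)
Lemma first_case Y : skew2 Y -> ent Y 0 4 = 0 -> ent Y 1 4 = 0 -> ent Y 0 5 != 0 ->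
  \tr (shift2 ^+ 2 * Y ^+ 2) = 0 -> \tr ((shift2 * Y) ^+ 2) = 0 ->
  \tr (shift2 ^+ 2 * Y * shift2 * Y) = 0 -> \tr (shift2 ^+ 2 * Y ^+ 2 * shift2 * Y) = 0 ->
  [/\ ent Y 2 4 = 0, ent Y 3 4 = 0 & ent Y 5 4 = 0].
Proof.
move=> /skew2E rel a1 a3 a2; rewrite !expr2 -!mulrA !ent_tr !entE //= ?add0r !rel a1 a3 ?(mulr0, mul0r, add0r, addr0, oppr0).
move=> e1 e2 e3 e4.
have Y12 : ent Y 1 2 = 0.
  by apply: (mulfI a2); rewrite mulr0; apply: mulrn2_eq0; rewrite -[RHS]e3; ring.
move: e1 e2 e4; rewrite Y12 ?(mulr0, mul0r, add0r, addr0) => e1 e2 e4.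
have f1 : ent Y 0 5 * ent Y 1 0 = ent Y 0 2 * ent Y 1 3.
  by apply/eqP; rewrite -subr_eq0; apply/eqP/mulrn2_eq0; rewrite -[RHS]e1; ring.
have f2 : ent Y 3 2 * ent Y 0 5 = - (ent Y 0 2 ^+ 2 + ent Y 1 3 ^+ 2).
  by apply/eqP; rewrite -subr_eq0; apply/eqP/mulrn2_eq0; rewrite -[RHS]e2; ring.
(* After substituting [f2] and [f1], the last trace is minus the cube of this entry. *)
have Y13 : ent Y 1 3 = 0.
  apply/eqP; rewrite -[_ == _](expf_eq0 _ 3) -oppr_eq0 -[X in _ == X]e4 f2.
  by rewrite [ent Y 0 5 * (_ * _)]mulrA f1; apply/eqP; ring.
rewrite Y13 oppr0; split=> //; apply: (mulfI a2).
by rewrite f1 Y13 !mulr0.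
Qed.

(** From tr(xy^2) the entry (3,2) is minus the entry (1,0); then tr(xy^3xy) is minus the square of
    the product of the entries (2,5) and (1,0). By [skew2] the entry (5,4) equals (1,0). *)
Lemma second_case Y : skew2 Y -> ent Y 0 4 = 0 -> ent Y 1 4 = 0 -> ent Y 0 5 = 0 ->
  ent Y 2 4 = 0 -> ent Y 3 4 = 0 -> ent Y 3 5 = 0 -> ent Y 2 5 != 0 ->
  \tr (shift2 * Y ^+ 2) = 0 -> \tr (shift2 * Y ^+ 3 * shift2 * Y) = 0 -> ent Y 5 4 = 0.
Proof.
move=> /skew2E rel a1 a3 a2; rewrite !rel => /eqP; rewrite oppr_eq0 => /eqP b1 b3 /eqP.
rewrite oppr_eq0 => /eqP b4 b2; have [P PE] : exists P, P = Y * Y by exists (Y * Y).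
have [Q QE] : exists Q, Q = Y * P by exists (Y * P).
have -> : Y ^+ 3 = Q by rewrite QE PE !exprS expr0 mulr1.
rewrite expr2 -PE -!mulrA !ent_tr !entE //= ?add0r.
pose zeros := (rel, a1, a2, a3, b1, b3, b4, oppr0).
pose simp := (mulr0, mul0r, add0r, addr0).
rewrite !zeros ?simp QE !ent_mul !zeros ?simp PE !ent_mul !zeros ?simp => e1 e2.
have f1 : ent Y 3 2 = - ent Y 1 0.
  apply: (mulfI b2); apply/eqP; rewrite -subr_eq0; apply/eqP/mulrn2_eq0; rewrite -[RHS]e1; ring.
apply/eqP; rewrite -[_ == _](expf_eq0 _ 2); apply/eqP/(mulfI b2)/(mulfI b2).
by rewrite !mulr0 -[RHS]oppr0 -[in RHS]e2 f1; ring.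
Qed.

Definition jordan_basis (x : 'M[F]_6) (e f : 'cV_6) : 'M_6 :=
  \matrix_(i, j) (x ^+ j./2 *m (if odd j then f else e)) i 0.

Definition adapted (Om x : 'M[F]_6) (e f : 'cV_6) :=
  [/\ form Om e f = 0, form Om e (x *m f) = 0 & form Om e (x ^+ 2 *m f) = 1].

Definition antidiag : 'M[F]_6 := \matrix_(i, j) ((i + j == 5)%N%:R * (-1) ^+ i).

(** * The Jordan basis adapted to the symplectic form *)

Section JordanBasis.
Variables (Om x y : 'M[F]_6).
Hypotheses (sOm : symplectic Om) (adjx : x^T *m Om = Om *m x).
Hypotheses (adjy : y^T *m Om = - (Om *m y)) (x3 : x ^+ 3 = 0).

Let skew : Om^T = - Om. Proof. by case/andP: sOm => _ /eqP. Qed.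

Let xk0 k : (3 <= k)%N -> x ^+ k = 0.
Proof. by move=> k3; rewrite -(subnK k3) exprD x3 mulr0. Qed.

Lemma form_move k p q : form Om (x ^+ k *m p) q = form Om p (x ^+ k *m q).
Proof.
have adjk : (x ^+ k)^T *m Om = 1 *: (Om *m x ^+ k).
  by rewrite -[1](expr1n _ k); apply: adjointX; rewrite scale1r.
by rewrite /form trmx_mul -(mulmxA p^T) adjk scale1r !mulmxA.
Qed.

Lemma form_xkk k p : form Om p (x ^+ k *m p) = 0.
Proof.
apply: mulrn2_eq0; rewrite mulr2n -{1}form_move form_skew // addNr //.
Qed.

Lemma jordan_col e f j : (j < 6)%N ->
  col (inord j) (jordan_basis x e f) = x ^+ j./2 *m (if odd j then f else e).
Proof. by move=> j6; apply/colP => i; rewrite !mxE inordK. Qed.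

Lemma ent_form (g M : 'M[F]_6) i j :
  ent (g^T *m M *m g) i j = form M (col (inord i) g) (col (inord j) g).
Proof.
rewrite /form /ent tr_col -row_mul mxE [RHS]mxE; apply: eq_bigr => k _.
by rewrite [row _ _ _ _]mxE [col _ _ _ _]mxE.
Qed.

(** By self-adjointness the pairing of x^a p with x^b q depends only on a + b. It vanishes for p =
    q, and between e and f unless a + b = 2. *)
Lemma jordan_gram e f : adapted Om x e f ->
  (jordan_basis x e f)^T *m Om *m jordan_basis x e f = antidiag.
Proof.
case=> ef0 ef1 ef2; apply: entP => i j i6 j6.
rewrite ent_form !jordan_col // /ent mxE !inordK // form_move mulmxA mulmxE -exprD.
have efk k : (3 <= k)%N -> form Om e (x ^+ k *m f) = 0.
  by move=> /xk0 ->; rewrite mul0mx /form mulmx0 mxE.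
have fek k : form Om f (x ^+ k *m e) = - form Om e (x ^+ k *m f).
  by rewrite form_skew // form_move.
have ef0' : form Om e (x ^+ 0 *m f) = 0 by rewrite mul1mx.
have ef1' : form Om e (x ^+ 1 *m f) = 0 by [].
case: i i6 => [|[|[|[|[|[|//]]]]]] _; case: j j6 => [|[|[|[|[|[|//]]]]]] _;
  by rewrite /= ?form_xkk ?fek ?ef0' ?ef1' ?ef2 ?efk // ?mul0r ?mul1r ?oppr0 // -signr_odd.
Qed.

Lemma antidiag_unit : antidiag \in unitmx.
Proof.
suff : antidiag *m (- antidiag) = 1%:M by case/mulmx1_unit.
apply: entP => i j i6 j6; rewrite mulmxN -mulNmx mulmxE ent_mul /ent !mxE -val_eqE /= !inordK //.
by case: i i6 => [|[|[|[|[|[|//]]]]]] _; case: j j6 => [|[|[|[|[|[|//]]]]]] _;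
  rewrite /= ?(mul0r, mulr0, add0r, addr0, mul1r, oppr0) //; ring.
Qed.

Lemma jordan_unit e f : adapted Om x e f -> jordan_basis x e f \in unitmx.
Proof.
move=> /jordan_gram gram; have := antidiag_unit; rewrite -gram !unitmx_mul.
by case/andP.
Qed.

Lemma jordan_shift e f : adapted Om x e f -> mxconj (jordan_basis x e f) x = shift2.
Proof.
move=> ad; have ug := jordan_unit ad; set g := jordan_basis x e f in ug *.
suff e1 : x *m g = g *m shift2 by rewrite /mxconj -mulmxA e1 mulKmx.
apply/matrixP => i j; rewrite -(inord_val i) -(inord_val j).
have -> : (x *m g) (inord i) (inord j) = (x ^+ (j./2).+1 *m (if odd j then f else e)) (inord i) 0.
  rewrite exprS -mulmxE -mulmxA -jordan_col // mxE [RHS]mxE.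
  by apply: eq_bigr => k _; rewrite [col _ _ _ _]mxE.
rewrite -/(ent (g *m shift2) i j) mulmxE ent_mul /ent.
case: j => [[|[|[|[|[|[|//]]]]]] j6] /=; rewrite !mxE !inordK //= ?(mulr0, mulr1, add0r, addr0) //.
  by rewrite x3 big1 // => k _; rewrite mxE mul0r.
by rewrite x3 big1 // => k _; rewrite mxE mul0r.
Qed.

Lemma ent_antidiagl M i j : (i < 6)%N -> ent (antidiag * M) i j = (-1) ^+ i * ent M (5 - i) j.
Proof.
move=> i6; rewrite ent_mul /ent !mxE !inordK //.
by case: i i6 => [|[|[|[|[|[|//]]]]]] _ /=; rewrite ?(mul0r, mul1r, add0r, addr0).
Qed.

Lemma ent_antidiagr M i j : (j < 6)%N -> ent (M * antidiag) i j = (-1) ^+ (5 - j) * ent M i (5 - j).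
Proof.
move=> j6; rewrite ent_mul /ent !mxE !inordK //.
rewrite [RHS]mulrC; by case: j j6 => [|[|[|[|[|[|//]]]]]] _ /=; rewrite ?(mul0r, mul1r, mulr0, add0r, addr0).
Qed.

Lemma jordan_skew2 e f : adapted Om x e f -> skew2 (mxconj (jordan_basis x e f) y).
Proof.
move=> ad i j i6 j6; have ug := jordan_unit ad.
have adj1 : y^T *m Om = -1 *: (Om *m y) by rewrite scaleN1r.
have := mxconj_adjoint ug adj1; rewrite jordan_gram //; set Y := mxconj _ y.
rewrite scaleN1r => /(congr1 (fun M => ent M j (5 - i))); rewrite !mulmxE ent_antidiagr; last by lia.
have -> : ent (- (antidiag * Y)) j (5 - i) = - ent (antidiag * Y) j (5 - i) by rewrite /ent mxE.
rewrite ent_antidiagl // (_ : 5 - (5 - i) = i)%N; last by lia.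
have -> : ent Y^T j i = ent Y i j by rewrite /ent mxE.
move=> e1; have := congr1 (fun z => (-1) ^+ i * z) e1; rewrite mulrA -exprD addnn -signr_odd odd_double mul1r => ->.
by rewrite exprS exprD; ring.
Qed.

(** Basis vectors i and 5 - i are dual up to sign, so the entries of y in this basis are values of
    the form. *)
Lemma jordan_form e f i j : adapted Om x e f -> (i < 6)%N -> (j < 6)%N ->
  form Om (x ^+ i./2 *m (if odd i then f else e)) (y *m (x ^+ j./2 *m (if odd j then f else e))) =
  (-1) ^+ i * ent (mxconj (jordan_basis x e f) y) (5 - i) j.
Proof.
move=> ad i6 j6; have ug := jordan_unit ad; rewrite -ent_antidiagl //.
rewrite -(jordan_gram ad) -mulmxE /mxconj -!mulmxA mulKVmx // !mulmxA -(mulmxA _ Om) ent_form.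
by rewrite !jordan_col // /form !mulmxA.
Qed.
End JordanBasis.
End CubeZero.

(** Multiplicativity is enough because all words are nonempty with positive exponents; this covers
    conjugations and entrywise ring morphisms. *)
Lemma W2sharp_morph (A B : pzRingType) (phi : A -> B) x y i :
  {morph phi : a b / a * b} ->
  tnth (W2sharp (phi x) (phi y)) i = phi (tnth (W2sharp x y) i).
Proof.
move=> phiM; have phiX a k : phi (a ^+ k.+1) = phi a ^+ k.+1.
  by elim: k => // k IH; rewrite exprS phiM IH -exprS.
rewrite !(tnth_nth 0); case: i => i /=.
by do 15![case: i => [_|i] /=; first by rewrite ?(phiX, phiM)]; case: i.
Qed.

Section SixDim.
Variable F : numClosedFieldType.

Definition tr_vanish n (x y : 'M[F]_n) := forall i, \tr (tnth (W2sharp x y) i) = 0.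

Lemma tr_vanishE n (x y : 'M[F]_n) : tr_vanish x y <->
  [/\ [/\ \tr x = 0, \tr (x ^+ 2) = 0, \tr (y ^+ 2) = 0, \tr (x ^+ 3) = 0 & \tr (x * y ^+ 2) = 0],
      [/\ \tr (x ^+ 2 * y ^+ 2) = 0, \tr ((x * y) ^+ 2) = 0, \tr (y ^+ 4) = 0,
          \tr (x ^+ 2 * y * x * y) = 0 & \tr (x * y ^+ 4) = 0] &
      [/\ \tr ((x ^+ 2 * y) ^+ 2) = 0, \tr (x ^+ 2 * y ^+ 2 * x * y) = 0,
          \tr (x * y ^+ 3 * x * y) = 0, \tr (y ^+ 6) = 0 & \tr ((x * y ^+ 3) ^+ 2) = 0]].
Proof.
split=> [H|[[? ? ? ? ?] [? ? ? ? ?] [? ? ? ? ?]] i].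
  by do !split; [have := H (@Ordinal 15 0 isT) | have := H (@Ordinal 15 1 isT) |
    have := H (@Ordinal 15 2 isT) | have := H (@Ordinal 15 3 isT) |
    have := H (@Ordinal 15 4 isT) | have := H (@Ordinal 15 5 isT) |
    have := H (@Ordinal 15 6 isT) | have := H (@Ordinal 15 7 isT) |
    have := H (@Ordinal 15 8 isT) | have := H (@Ordinal 15 9 isT) |
    have := H (@Ordinal 15 10 isT) | have := H (@Ordinal 15 11 isT) |
    have := H (@Ordinal 15 12 isT) | have := H (@Ordinal 15 13 isT) |
    have := H (@Ordinal 15 14 isT)]; rewrite (tnth_nth 0).
by rewrite (tnth_nth 0); case: i => i /=; do 15![case: i => [//|i] /=].
Qed.

Lemma tr_vanish_mxconj n (g x y : 'M[F]_n) : g \in unitmx -> tr_vanish x y ->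
  tr_vanish (mxconj g x) (mxconj g y).
Proof.
move=> ug H i; rewrite (W2sharp_morph _ _ _ (fun a b => mxconjM a b ug)).
by rewrite mxconj_trace.
Qed.

Lemma singular2 (a b c d : F) : a * d - b * c = 0 ->
  exists s t, [/\ (s != 0) || (t != 0), s * a + t * b = 0 & s * c + t * d = 0].
Proof.
move=> det; have [a0|a0] := eqVneq a 0; last first.
  exists (- b), a; rewrite a0 orbT; split=> //; first by ring.
  by rewrite -[RHS]det; ring.
have [b0|b0] := eqVneq b 0; last first.
  exists b, (- a); rewrite b0; split=> //; first by ring.
  by rewrite -[RHS]oppr0 -[in RHS]det; ring.
have [c0|c0] := eqVneq c 0; last first.
  exists (- d), c; rewrite c0 orbT a0 b0; split=> //; by ring.
have [d0|d0] := eqVneq d 0; last first.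
  exists d, (- c); rewrite d0 a0 b0; split=> //; by ring.
by exists 1, 0; rewrite oner_eq0 a0 b0 c0 d0; split=> //; ring.
Qed.

Lemma stable_kernel n (x y : 'M[F]_n) (P : 'cV_n -> Prop) p N :
  (forall v, P v -> P (y *m v)) -> (forall v, P v -> x *m v = 0) -> P p -> p != 0 ->
  y ^+ N = 0 -> exists v : 'cV_n, [/\ v != 0, x *m v = 0 & y *m v = 0].
Proof.
move=> Py Px Pp p0 yN; have yNp : y ^+ N *m p = 0 by rewrite yN mul0mx.
have [k [nz yk]] := last_power_kernel yNp p0; exists (y ^+ k *m p); split=> //.
by apply: Px; elim: k {nz yk} => [|k IH]; rewrite ?mul1mx // exprS -mulmxE -mulmxA; apply: Py.
Qed.

Section Fixed.
Variables (Om x y : 'M[F]_6).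
Hypotheses (sOm : symplectic Om) (adjx : x^T *m Om = Om *m x).
Hypotheses (adjy : y^T *m Om = - (Om *m y)) (x3 : x ^+ 3 = 0).

Lemma adapted_exists : x ^+ 2 != 0 -> exists e f, adapted Om x e f.
Proof.
move=> x2; have [_ /eqP skew] := andP sOm.
have [e [b ab]] : exists e b, form Om e (x ^+ 2 *m b) != 0.
  apply: contrapT => H; move/eqP: x2; apply.
  apply/trmx_inj; rewrite trmx0; apply/row_matrixP => i; rewrite row0 -tr_col; apply: trmx_inj; rewrite trmxK trmx0.
  have [uOm _] := andP sOm; apply: (form_nondeg uOm) => q.
  rewrite colE form_skew //; apply/eqP; rewrite oppr_eq0; apply: contraT => ne.
  by case: H; exists q, (delta_mx i 0).
(* Since x^3 = 0, the pairings of e with f, xf, x^2 f are triangular in the coefficients of b, xb,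
   x^2 b; [c2], [c1], [c0] solve this system for the values 0, 0, 1. *)
pose k i := form Om e (x ^+ i *m b).
pose c2 := (k 2%N)^-1; pose c1 := - c2 * k 1%N / k 2%N.
pose c0 := - (c2 * k 0%N + c1 * k 1%N) / k 2%N.
pose f := c2 *: b + (c1 *: (x *m b) + c0 *: (x ^+ 2 *m b)).
have ef i : form Om e (x ^+ i *m f) = c2 * k i + (c1 * k i.+1 + c0 * k i.+2).
  rewrite /f !mulmxDr -!scalemxAr !formDr !formZr; congr (_ + (_ * _ + _ * _)).
    by rewrite mulmxA mulmxE -exprSr.
  by rewrite mulmxA mulmxE -exprD addn2.
have k3 i : k i.+3 = 0 by rewrite /k -(addn3 i) exprD x3 mulr0 mul0mx /form mulmx0 mxE.
have k2 : k 2%N != 0 by [].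
exists e, f; split.
- by have := ef 0%N; rewrite mul1mx => ->; rewrite /c0 divfK //; ring.
- by have := ef 1%N; rewrite expr1 => ->; rewrite k3 /c1 divfK //; ring.
- by rewrite ef !k3 !mulr0 !addr0 mulVf.
Qed.

(** The forms Om(p, x^k q) are alternating, so on the span of e and f they scale by the determinant:
    SL_2 acts on adapted pairs. *)
Lemma adapted_change e f s t s' t' : s * t' - t * s' = 1 -> adapted Om x e f ->
  adapted Om x (s *: e + t *: f) (s' *: e + t' *: f).
Proof.
have [_ /eqP skew] := andP sOm.
move=> det [f0 f1 f2]; have bil k : form Om (s *: e + t *: f) (x ^+ k *m (s' *: e + t' *: f)) = form Om e (x ^+ k *m f).
  rewrite mulmxDr -!scalemxAr formDr !formDl !formZr !formZl !(form_xkk sOm adjx).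
  rewrite (form_skew f) // (form_move adjx) -[RHS]mul1r -det; ring.
split; last by rewrite bil.
  by have := bil 0%N; rewrite !mul1mx => ->.
by have := bil 1%N; rewrite !expr1 => ->.
Qed.

Lemma complete_det s t : (s != 0) || (t != 0) -> exists s' t' : F, s * t' - t * s' = 1.
Proof.
have [s0|s0 _] := eqVneq s 0 => /= [t0|].
  by exists (- t^-1), 0; rewrite s0 mul0r sub0r mulrN opprK divff.
by exists 0, (s^-1); rewrite mulr0 subr0 divff.
Qed.

(* In the basis e, f, xe, xf, x^2 e, x^2 f the matrix x is a shift and y consists   *)
(* of 2 x 2 blocks. The traces make first the block (0,2) and then the block (1,2)  *)
(* singular, and e, f are changed so that the kernel of the block contains e.       *)
Lemma common_kernel_cube0 : x ^+ 2 != 0 -> y ^+ 6 = 0 -> tr_vanish x y ->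
  exists v : 'cV_6, [/\ v != 0, x *m v = 0 & y *m v = 0].
Proof.
move=> x2 y6 tr0; have [e [f ad]] := adapted_exists x2.
have [_ /eqP skew] := andP sOm.
(* [phi 2] and [phi 1] are, up to sign and order, the blocks of [Y] in columns 4, 5 and in rows 0, 1
   and 2, 3 respectively. As bilinear forms in e and f they follow a change of basis. *)
pose phi k (p q : 'cV[F]_6) := form Om (x ^+ k *m p) (y *m (x ^+ 2 *m q)).
have phiDl k a b (p q r : 'cV[F]_6) : phi k (a *: p + b *: q) r = a * phi k p r + b * phi k q r.
  by rewrite /phi mulmxDr -!scalemxAr formDl !formZl.
have phiDr k a b (p q r : 'cV[F]_6) : phi k p (a *: q + b *: r) = a * phi k p q + b * phi k p r.
  by rewrite /phi !mulmxDr -!scalemxAr formDr !formZr.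
pose Y e f := mxconj (jordan_basis x e f) y.
have Y_tr e' f' : adapted Om x e' f' -> tr_vanish (shift2 F) (Y e' f').
  move=> ad'; rewrite -(jordan_shift sOm adjx x3 ad').
  exact: (tr_vanish_mxconj (jordan_unit sOm adjx x3 ad') tr0).
have Y_skew e' f' : adapted Om x e' f' -> skew2 (Y e' f').
  exact: (jordan_skew2 sOm adjx adjy x3).
have Yij e' f' i j (ad' : adapted Om x e' f') := jordan_form y sOm adjx x3 ad' (i := i) (j := j).
have Y04 e' f' : adapted Om x e' f' -> ent (Y e' f') 0 4 = - phi 2%N f' e'.
  by move=> ad'; rewrite /phi (Yij _ _ 5%N 4%N ad') // -signr_odd mulN1r opprK.
have Y05 e' f' : adapted Om x e' f' -> ent (Y e' f') 0 5 = - phi 2%N f' f'.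
  by move=> ad'; rewrite /phi (Yij _ _ 5%N 5%N ad') // -signr_odd mulN1r opprK.
have Y14 e' f' : adapted Om x e' f' -> ent (Y e' f') 1 4 = phi 2%N e' e'.
  by move=> ad'; rewrite /phi (Yij _ _ 4%N 4%N ad') // -signr_odd mul1r.
have Y15 e' f' : adapted Om x e' f' -> ent (Y e' f') 1 5 = phi 2%N e' f'.
  by move=> ad'; rewrite /phi (Yij _ _ 4%N 5%N ad') // -signr_odd mul1r.
have Y24 e' f' : adapted Om x e' f' -> ent (Y e' f') 2 4 = - phi 1%N f' e'.
  by move=> ad'; rewrite /phi (Yij _ _ 3%N 4%N ad') // -signr_odd mulN1r opprK.
have Y25 e' f' : adapted Om x e' f' -> ent (Y e' f') 2 5 = - phi 1%N f' f'.
  by move=> ad'; rewrite /phi (Yij _ _ 3%N 5%N ad') // -signr_odd mulN1r opprK.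
have Y34 e' f' : adapted Om x e' f' -> ent (Y e' f') 3 4 = phi 1%N e' e'.
  by move=> ad'; rewrite /phi (Yij _ _ 2%N 4%N ad') // -signr_odd mul1r.
have Y35 e' f' : adapted Om x e' f' -> ent (Y e' f') 3 5 = phi 1%N e' f'.
  by move=> ad'; rewrite /phi (Yij _ _ 2%N 5%N ad') // -signr_odd mul1r.
have col e' f' j : adapted Om x e' f' -> (j < 6)%N ->
    y *m (x ^+ j./2 *m (if odd j then f' else e')) =
    \sum_(k < 6) ent (Y e' f') k j *: (x ^+ k./2 *m (if odd k then f' else e')).
  move=> ad' j6; have ug := jordan_unit sOm adjx x3 ad'.
  have yg : y *m jordan_basis x e' f' = jordan_basis x e' f' *m Y e' f'.
    by rewrite /Y /mxconj !mulmxA mulmxV // mul1mx.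
  rewrite -jordan_col // colE mulmxA yg -colE.
  apply/colP => i; rewrite mxE [LHS]mxE summxE; apply: eq_bigr => k _.
  by rewrite [RHS]mxE mulrC /ent inord_val [jordan_basis _ _ _ _ _]mxE.
have ker2 p : x *m (x ^+ 2 *m p) = 0 by rewrite mulmxA mulmxE -exprS x3 mul0mx.
have nz2 e' f' : adapted Om x e' f' -> x ^+ 2 *m e' != 0.
  case=> _ _; rewrite -(form_move adjx); apply: contra_eq_neq => ->.
  by rewrite /form trmx0 !mul0mx mxE eq_sym oner_eq0.
(* If column 4 of [Y] has only its diagonal entry, the line of x^2 e is y-stable inside the kernel
   of x. *)
have final e' f' : adapted Om x e' f' -> ent (Y e' f') 0 4 = 0 -> ent (Y e' f') 1 4 = 0 ->
    ent (Y e' f') 2 4 = 0 -> ent (Y e' f') 3 4 = 0 -> ent (Y e' f') 5 4 = 0 ->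
    exists v : 'cV_6, [/\ v != 0, x *m v = 0 & y *m v = 0].
  move=> ad' z0 z1 z2 z3 z5; pose P (v : 'cV[F]_6) := exists c, v = c *: (x ^+ 2 *m e').
  apply: (@stable_kernel 6 x y P (x ^+ 2 *m e') 6) => //; last exact: nz2 ad'.
  - move=> _ [c ->]; rewrite -scalemxAr (col e' f' 4%N ad' isT).
    rewrite !big_ord_recl big_ord0 /= z0 z1 z2 z3 z5 !scale0r !add0r !addr0 scalerA.
    by eexists.
  - by move=> _ [c ->]; rewrite -scalemxAr ker2 scaler0.
  - by exists 1; rewrite scale1r.
have [s [t [st phi_e phi_f]]] : exists s t, [/\ (s != 0) || (t != 0),
    s * phi 2%N e e + t * phi 2%N e f = 0 & s * phi 2%N f e + t * phi 2%N f f = 0].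
  apply: singular2; have [_ _ [+ _ _ _ _]] := (tr_vanishE _ _).1 (Y_tr _ _ ad).
  move/(corner_det (Y_skew _ _ ad)); rewrite Y04 // Y05 // Y14 // Y15 // => e0.
  by rewrite -[RHS]e0; ring.
have [s' [t' det]] := complete_det st.
have {}ad := adapted_change det ad.
set e1 := s *: e + t *: f in ad; set f1 := s' *: e + t' *: f in ad.
have phi_e1 : phi 2%N e1 e1 = 0 by rewrite {1}/e1 phiDl !phiDr phi_e phi_f !mulr0 addr0.
have phi_f1 : phi 2%N f1 e1 = 0 by rewrite {1}/f1 phiDl !phiDr phi_e phi_f !mulr0 addr0.
clearbody e1 f1.
have [[_ _ tr2 _ tr3] [tr22 tr11 _ tr4 _] [_ tr5 tr6 _ _]] := (tr_vanishE _ _).1 (Y_tr _ _ ad).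
have z04 : ent (Y e1 f1) 0 4 = 0 by rewrite Y04 // phi_f1 oppr0.
have z14 : ent (Y e1 f1) 1 4 = 0 by rewrite Y14.
(* Skew-adjointness also kills the entry (1,5), so (0,5) alone decides whether the corner block is
   zero. *)
have [a0|a0] := eqVneq (ent (Y e1 f1) 0 5) 0; last first.
  have [z24 z34 z54] := first_case (Y_skew _ _ ad) z04 z14 a0 tr22 tr11 tr4 tr5.
  exact: final ad _ _ _ _ _.
have phi_ff : phi 2%N f1 f1 = 0 by apply/eqP; rewrite -oppr_eq0 -(Y05 e1 f1 ad) a0.
have phi_ef : phi 2%N e1 f1 = 0.
  by rewrite -(Y15 e1 f1 ad) (skew2E (Y_skew _ _ ad)) z04 oppr0.
have [dB trB] := middle_det (Y_skew _ _ ad) z04 a0 z14 tr22 tr11.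
have [s1 [t1 [st1 psi_e psi_f]]] : exists s t, [/\ (s != 0) || (t != 0),
    s * phi 1%N e1 e1 + t * phi 1%N e1 f1 = 0 & s * phi 1%N f1 e1 + t * phi 1%N f1 f1 = 0].
  apply: singular2; move: dB; rewrite Y24 // Y25 // Y34 // Y35 // => e0.
  by rewrite -[RHS]e0; ring.
have [s1' [t1' det1]] := complete_det st1.
have ad2 := adapted_change det1 ad.
set e2 := s1 *: e1 + t1 *: f1 in ad2; set f2 := s1' *: e1 + t1' *: f1 in ad2.
have phi0 a b c d : phi 2%N (a *: e1 + b *: f1) (c *: e1 + d *: f1) = 0.
  by rewrite phiDl !phiDr phi_e1 phi_f1 phi_ff phi_ef !mulr0 !addr0 !mulr0 addr0.
have psi_e2 : phi 1%N e2 e2 = 0 by rewrite {1}/e2 phiDl !phiDr psi_e psi_f !mulr0 addr0.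
have psi_f2 : phi 1%N f2 e2 = 0 by rewrite {1}/f2 phiDl !phiDr psi_e psi_f !mulr0 addr0.
have {tr22 tr11 tr3 tr6} [[_ _ _ _ tr3] [tr22 tr11 _ _ _] [_ _ tr6 _ _]] := (tr_vanishE _ _).1 (Y_tr _ _ ad2).
have w04 : ent (Y e2 f2) 0 4 = 0 by rewrite Y04 // phi0 oppr0.
have w05 : ent (Y e2 f2) 0 5 = 0 by rewrite Y05 // phi0 oppr0.
have w14 : ent (Y e2 f2) 1 4 = 0 by rewrite Y14 // phi0.
have w15 : ent (Y e2 f2) 1 5 = 0 by rewrite Y15 // phi0.
have w24 : ent (Y e2 f2) 2 4 = 0 by rewrite Y24 // psi_f2 oppr0.
have w34 : ent (Y e2 f2) 3 4 = 0 by rewrite Y34.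
have [_ trB2] := middle_det (Y_skew _ _ ad2) w04 w05 w14 tr22 tr11.
have w35 : ent (Y e2 f2) 3 5 = 0 by rewrite -[RHS]trB2 w24 add0r.
have [w25|w25] := eqVneq (ent (Y e2 f2) 2 5) 0; last first.
  have w54 := second_case (Y_skew _ _ ad2) w04 w14 w05 w24 w34 w35 w25 tr3 tr6.
  exact: final ad2 _ _ _ _ _.
(* Now both blocks vanish, and x^2 e, x^2 f span a y-stable plane in the kernel of x. *)
pose P (v : 'cV[F]_6) := exists c d, v = c *: (x ^+ 2 *m e2) + d *: (x ^+ 2 *m f2).
apply: (@stable_kernel 6 x y P (x ^+ 2 *m e2) 6) => //; last exact: nz2 ad2.
- move=> _ [c [d ->]]; rewrite mulmxDr -!scalemxAr (col e2 f2 4%N ad2 isT) (col e2 f2 5%N ad2 isT).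
  rewrite !big_ord_recl !big_ord0 /= w04 w14 w24 w34 w05 w15 w25 w35 !scale0r !add0r !addr0.
  rewrite !scalerDr !scalerA addrACA -!scalerDl; by do 2!eexists.
- by move=> _ [c [d ->]]; rewrite mulmxDr -!scalemxAr !ker2 !scaler0 addr0.
- by exists 1, 0; rewrite scale1r scale0r addr0.
Qed.
End Fixed.
End SixDim.

(** * The nullcone *)

Section Nullcone.
Variable F : numClosedFieldType.

(** Since x^k = 0 in dimension 2k, the case x^2 <> 0 occurs for k = 3 only. The smaller k are met
    after peeling. *)
Lemma common_kernel k (Om x y : 'M[F]_(hdim k)) : (0 < k <= 3)%N -> symplectic Om ->
  x^T *m Om = Om *m x -> y^T *m Om = - (Om *m y) -> tr_vanish x y ->
  exists v : 'cV_(hdim k), [/\ v != 0, x *m v = 0 & y *m v = 0].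
Proof.
case/andP => k0 k3 sOm adjx adjy tr0.
have [[tr1 tr2 tr3 tr4 tr5] [tr6 tr7 tr8 tr9 tr10] [tr11 tr12 tr13 tr14 tr15]] := (tr_vanishE x y).1 tr0.
have n6 : (hdim k <= 6)%N by rewrite hdimE; lia.
have xk : x ^+ k = 0.
  by apply: selfadjoint_nilpotent sOm adjx _ => // -[|[|[|[|j]]]] //; rewrite expr1.
have yk : y ^+ hdim k = 0.
  by apply: skewadjoint_nilpotent sOm adjy _ => // -[|[|[|[|j]]]].
have y6 : y ^+ 6 = 0 by rewrite -(subnK n6) exprD yk mulr0.
have [x0|x0] := eqVneq x 0.
  have n0 : (0 < hdim k)%N by rewrite hdimE; lia.
  apply: (@stable_kernel _ _ x y (fun=> True) (delta_mx (Ordinal n0) 0) 6) => //.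
    by move=> v _; rewrite x0 mul0mx.
  apply/eqP => /matrixP/(_ (Ordinal n0) 0)/eqP; rewrite !mxE !eqxx /=.
  by rewrite oner_eq0.
have [x2|x2] := eqVneq (x ^+ 2) 0; first exact: common_kernel_square0 n6 sOm adjx adjy _ _ _ _ _ _ _ _.
have k3' : k = 3%N.
  apply/eqP; rewrite eqn_leq k3 ltnNge; apply: contra x2 => k2.
  by rewrite -(subnK k2) exprD xk mulr0.
subst k; exact: (@common_kernel_cube0 F Om x y sOm adjx adjy xk x2 y6 tr0).
Qed.

Fixpoint hyperbolic k : 'M[F]_(hdim k) :=
  if k is k'.+1 then hyperbolic_sum (hyperbolic k') else 0.

Definition strictly_upper n (M : 'M[F]_n) := forall i j : 'I_n, (j <= i)%N -> M i j = 0.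

Lemma strictly_upper_block m (M : 'M[F]_m) (r : 'M_(1, m)) (s : 'M_1) (t : 'M_(m, 1)) :
  strictly_upper M -> strictly_upper (block_mx 0%:M (row_mx r s) 0 (block_mx M t 0 0%:M)).
Proof.
move=> upM i j; rewrite block_mxEv !mxE; case: splitP => i' ->.
  rewrite !mxE; case: splitP => j' ->; first by rewrite !mxE mul0rn.
  by rewrite (ord1 i').
rewrite !mxE; case: splitP => j' ->; first by rewrite !mxE.
rewrite leq_add2l block_mxEv !mxE; case: splitP => i1 ->; rewrite !mxE; case: splitP => j1 ->.
- exact: upM.
- by rewrite leqNgt (leq_trans (ltn_ord i1)) // leq_addr.
- by rewrite !mxE.
- by rewrite !mxE mul0rn.
Qed.

Lemma hyperbolic_support k i j : hyperbolic k i j != 0 -> ((i + j).+1 = hdim k)%N.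
Proof.
elim: k i j => [[]//|k IH] i j /=; rewrite hyperbolic_sumE block_mxEv !mxE.
case: splitP => i' ->; rewrite !mxE; case: splitP => j' ->; rewrite ?mxE ?eqxx //.
- case: splitP => j1 ->; rewrite !mxE ?eqxx // !ord1 => _ ; by rewrite /=; lia.
- case: splitP => i1 ->; rewrite !mxE ?eqxx // !ord1 => _; by rewrite /=; lia.
- case: splitP => i1 ->; rewrite !mxE; case: splitP => j1 ->;
    rewrite ?mxE ?eqxx // => /IH /= e; lia.
Qed.

(** With zero corners, every word in X and Y carries the same word in M and N as middle block, so
    the trace conditions descend to the quotient where the induction goes on. *)
Lemma peeled0_W2sharp m (M N : 'M[F]_m) X Y : peeled 0 M 0 X -> peeled 0 N 0 Y ->
  forall i, peeled 0 (tnth (W2sharp M N) i) 0 (tnth (W2sharp X Y) i).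
Proof.
move=> pX pY.
have pM (A B : 'M[F]_m) A' B' : peeled 0 A 0 A' -> peeled 0 B 0 B' -> peeled 0 (A * B) 0 (A' * B').
  by move=> pA pB; have := peeledM pA pB; rewrite !mul0r.
have pE (A : 'M[F]_m) A' k : peeled 0 A 0 A' -> peeled 0 (A ^+ k.+1) 0 (A' ^+ k.+1).
  by move=> pA; have := peeledX k.+1 pA; rewrite !expr0n.
case=> i lti; rewrite !(tnth_nth 0) /=.
by do 15![case: i lti => [|i] lti /=; first by repeat first [exact: pX | exact: pY |
  match goal with
  | |- peeled _ (_ * _) _ _ => apply: (pM)
  | |- peeled _ (_ ^+ _) _ _ => apply: (pE)
  end]].
Qed.

Lemma strict_triangularization k (Om x y : 'M[F]_(hdim k)) : (k <= 3)%N -> symplectic Om ->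
  x^T *m Om = Om *m x -> y^T *m Om = - (Om *m y) -> tr_vanish x y ->
  exists g, [/\ g \in unitmx, g^T *m Om *m g = hyperbolic k,
    strictly_upper (mxconj g x) & strictly_upper (mxconj g y)].
Proof.
elim: k => [|k IH] in Om x y *.
  move=> *; exists 1%:M; split=> //; last 2 first.
  - by case.
  - by case.
  - exact: unitmx1.
  by apply/matrixP => -[].
move=> k3 sOm adjx adjy tr0.
have [v [v0 xv yv]] := common_kernel (k3 : (0 < k.+1 <= 3)%N) sOm adjx adjy tr0.
have [g [Om' [ug sOm' gram gP]]] := peel_eigenvector sOm v0.
have adjx1 : x^T *m Om = 1 *: (Om *m x) by rewrite scale1r.
have adjy1 : y^T *m Om = -1 *: (Om *m y) by rewrite scaleN1r.
have xv0 : x *m v = 0 *: v by rewrite scale0r.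
have yv0 : y *m v = 0 *: v by rewrite scale0r.
have [M pX adjM] := gP _ _ _ (expr1n _ 2) adjx1 xv0.
have e2 : (-1) ^+ 2 = 1 :> F by rewrite sqrrN expr1n.
have [N pY adjN] := gP _ _ _ e2 adjy1 yv0.
rewrite mulr0 scale1r in pX adjM; rewrite mulr0 scaleN1r in pY adjN.
have trMN : tr_vanish M N.
  move=> i; have := peeled_trace (peeled0_W2sharp pX pY i).
  by rewrite add0r addr0 => <-; exact: tr_vanish_mxconj.
have [h [uh gramh upM upN]] := IH _ _ _ (ltnW k3) sOm' adjM adjN trMN.
pose H := block_mx 1%:M 0 0 (block_mx h 0 0 1%:M) : 'M[F]_(1 + (hdim k + 1)).
pose Hi := block_mx 1%:M 0 0 (block_mx (invmx h) 0 0 1%:M) : 'M[F]_(1 + (hdim k + 1)).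
have HiH : Hi *m H = 1%:M.
  by rewrite /Hi /H !mulmx_block !(mulmx0, mul0mx, addr0, add0r, mul1mx) mulVmx // -!scalar_mx_block.
have [uHi uH] := mulmx1_unit HiH.
have HiE : invmx H = Hi by rewrite -[LHS]mul1mx -HiH mulmxK.
have conjH (Z W : 'M[F]_(hdim k)) X : peeled 0 W 0 X -> strictly_upper (mxconj h W) ->
    strictly_upper (mxconj H X).
  move=> [r [s [t ->]]] up; rewrite /mxconj HiE /Hi /H !mulmx_block.
  rewrite !(mulmx_block, mul_row_block, mulmx0, mul0mx, addr0, add0r, mul1mx, mulmx1).
  exact: strictly_upper_block.
have mxconj2 X : mxconj (g *m H) X = mxconj H (mxconj g X).
  have invM : invmx (g *m H) = invmx H *m invmx g.
    apply: (can_inj (mulKmx (_ : g *m H \in unitmx))); rewrite ?unitmx_mul ?ug //.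
    by rewrite mulmxV ?unitmx_mul ?ug // -mulmxA mulKVmx // mulmxV.
  by rewrite /mxconj invM !mulmxA.
exists (g *m H); split; rewrite ?mxconj2.
- by rewrite unitmx_mul ug.
- rewrite trmx_mul !mulmxA -(mulmxA H^T) -(mulmxA H^T) gram /= -gramh !hyperbolic_sumE /H.
  rewrite tr_block_mx !trmx1 !trmx0 tr_block_mx !trmx1 !trmx0 !mulmx_block.
  rewrite !(mulmx0, mul0mx, addr0, add0r, mul1mx, mulmx1, mul_row_block, mul_block_col).
  by congr block_mx; rewrite mul_mx_row mulmx0 block_mxEv row_mx0.
- exact: conjH pX upM.
- exact: conjH pY upN.
Qed.

(** A torus conjugate written so as to make sense at t = 0. The truncated exponent j - i is
    harmless: for strictly upper triangular [Z] the entries with j <= i are zero. *)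
Definition degenerate (g Z : 'M[F]_6) (t : F) : 'M[F]_6 :=
  g *m (\matrix_(i, j) (Z i j * t ^+ (j - i))) *m invmx g.

Lemma degenerate0 g Z : strictly_upper Z -> degenerate g Z 0 = 0.
Proof.
move=> upZ; rewrite /degenerate (_ : \matrix_(i, j) _ = 0) ?mulmx0 ?mul0mx //.
apply/matrixP => i j; rewrite !mxE; case: (leqP j i) => [/upZ ->|ij]; first by rewrite mul0r.
by rewrite expr0n subn_eq0 leqNgt ij mulr0.
Qed.

Lemma degenerate_sq (Om g z : 'M[F]_6) s : g \in unitmx -> symplectic Om ->
  g^T *m Om *m g = hyperbolic 3 -> strictly_upper (mxconj g z) -> s != 0 ->
  exists a, [/\ a \in unitmx, a^T *m Om *m a = Om &
    a *m z *m invmx a = degenerate g (mxconj g z) (s ^+ 2)].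
Proof.
move=> ug sOm gram upz s0.
(* Here d_i = s^(5 - 2i): d_i d_j = 1 for i + j = 5 preserves the antidiagonal form, and d_i / d_j =
   s^(2(j - i)) explains why the parameter is a square. *)
pose d (i : 'I_6) := s ^+ 5 * s^-1 ^+ (2 * i); pose D : 'M[F]_6 := diag_mx (\row_i d i).
pose D' : 'M[F]_6 := diag_mx (\row_i (d i)^-1).
have d0 i : d i != 0 by rewrite mulf_neq0 ?expf_neq0 ?invr_eq0.
have DD' : D *m D' = 1%:M.
  rewrite mulmx_diag -diag_const_mx; congr diag_mx; apply/rowP => i.
  by rewrite !mxE divff.
have [uD _] := mulmx1_unit DD'.
have invD : invmx D = D' by rewrite -[RHS](mulKmx uD) DD' mulmx1.
have gK : g *m invmx g = 1%:M by rewrite mulmxV.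
pose a := g *m D *m invmx g.
have ua : a \in unitmx by rewrite !unitmx_mul ug uD unitmx_inv.
have invA : invmx a = g *m D' *m invmx g.
  rewrite -[RHS](mulKmx ua) -[LHS]mulmx1; congr (_ *m _).
  by rewrite /a !mulmxA mulmxKV // -(mulmxA g) DD' mulmx1 gK.
exists a; split=> //.
  have DKD : D^T *m hyperbolic 3 *m D = hyperbolic 3.
    have := @hyperbolic_support 3; move: (hyperbolic 3) => K suppK.
    rewrite tr_diag_mx; apply/matrixP => i j; rewrite mul_mx_diag mul_diag_mx !mxE.
    have [->|/suppK /= ij] := eqVneq (K i j) 0; first by rewrite mulr0 mul0r.
    rewrite mulrAC (_ : d i * d j = 1) ?mul1r // /d mulrACA -!exprD -mulnDr.
    have -> : (i + j = 5)%N by case: ij.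
    by rewrite -exprMn divff ?expr1n.
  have : (g *m D)^T *m Om *m (g *m D) = g^T *m Om *m g.
    by rewrite gram -DKD -gram trmx_mul !mulmxA.
  move/(congr1 (fun X => (invmx g)^T *m X *m invmx g)) => e.
  have gT : (invmx g)^T *m g^T = 1%:M by rewrite -trmx_mul gK trmx1.
  move: e; rewrite !mulmxA gT mul1mx -[_ *m g *m invmx g]mulmxA gK mulmx1 => e.
  rewrite -[RHS]e.
  by rewrite /a !trmx_mul !mulmxA.
rewrite invA /a /degenerate.
have -> : g *m D *m invmx g *m z *m (g *m D' *m invmx g) = g *m (D *m mxconj g z *m D') *m invmx g.
  by rewrite /mxconj !mulmxA.
congr (_ *m _ *m _); move: (mxconj g z) upz => Z upz.
apply/matrixP => i j; rewrite mul_mx_diag mul_diag_mx !mxE.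
case: (leqP j i) => [/upz ->|ij]; first by rewrite mulr0 !mul0r.
rewrite -[X in _ = X]mulr1 -(divff (d0 j)) mulrA; congr (_ / _).
rewrite [LHS]mulrC -!mulrA; congr (_ * _).
rewrite /d mulrCA; congr (_ * _).
have -> : (2 * j = 2 * (j - i) + 2 * i)%N by lia.
by rewrite exprD mulrA -exprM -exprMn divff // expr1n mul1r.
Qed.

(* A degenerate matrix is a limit of conjugates of z, so an invariant takes the *)
(* same value at z and at 0.                                                   *)
Theorem invariant_nullcone (Om z : 'M[F]_6) (P : {mpoly F[6 * 6]}) (g : 'M[F]_6) :
  g \in unitmx -> symplectic Om -> g^T *m Om *m g = hyperbolic 3 ->
  strictly_upper (mxconj g z) ->
  (forall a, a \in unitmx -> a^T *m Om *m a = Om ->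
     P.@[fun k => mxvec (a *m z *m invmx a) 0 k] = P.@[fun k => mxvec z 0 k]) ->
  P.@[fun k => mxvec z 0 k] = P.@[fun=> 0].
Proof.
move=> ug sOm gram upz Pinv; have [Z ZE] : exists Z, Z = mxconj g z by exists (mxconj g z).
rewrite -ZE in upz.
pose W : 'M[{poly F}]_6 := map_mx polyC g *m (\matrix_(i, j) (Z i j *: 'X^(j - i)))
  *m map_mx polyC (invmx g).
have WE t : map_mx (horner_eval t) W = degenerate g Z t.
  rewrite /W /degenerate !map_mxM -!map_mx_comp /=; congr (_ *m _ *m _);
    apply/matrixP => i j; rewrite !mxE /= ?horner_evalE ?hornerC //.
  by rewrite hornerZ hornerXn.
pose q := mmap polyC (fun k => mxvec W 0 k) P.
have qE t : q.[t] = P.@[fun k => mxvec (degenerate g Z t) 0 k].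
  by rewrite horner_mmap; apply: meval_eq => k; rewrite -WE -map_mxvec [RHS]mxE.
(* Every t <> 0 is a square, so the values agree there; the factor ['X] absorbs t = 0. *)
have q1 : q - (P.@[fun k => mxvec z 0 k])%:P = 0.
  suff : (q - (P.@[fun k => mxvec z 0 k])%:P) * 'X = 0.
    by move/eqP; rewrite mulf_eq0 polyX_eq0 orbF => /eqP.
  apply: poly_horner_eq0 => t; rewrite hornerMX hornerD hornerN hornerC qE.
  have [->|t0] := eqVneq t 0; first by rewrite mulr0.
  have s0 : sqrtC t != 0 by rewrite sqrtC_eq0.
  have [|a [ua aOm aE]] := degenerate_sq (z := z) ug sOm gram _ s0; first by rewrite -ZE.
  rewrite -ZE in aE.
  by rewrite -(sqrtCK t) -aE Pinv // subrr mul0r.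
have := qE 0; move/eqP: q1; rewrite subr_eq0 => /eqP ->; rewrite hornerC => ->.
by apply: meval_eq => k; rewrite degenerate0 // raddf0 mxE.
Qed.
End Nullcone.

(** * Finiteness over a system cutting out the nullcone *)

(** Two uses: the variable standing for an invariant h_j weighs deg h_j, and weights 0 and 1 read
    off bidegrees. *)
Definition wdeg n (w : 'I_n -> nat) (m : 'X_{1..n}) := (\sum_i m i * w i)%N.

Lemma wdeg0 n (w : 'I_n -> nat) : wdeg w 0%MM = 0%N.
Proof. by rewrite /wdeg big1 // => i _; rewrite mnm0E. Qed.

Lemma wdegD n (w : 'I_n -> nat) : {morph wdeg w : m1 m2 / (m1 + m2)%MM >-> (m1 + m2)%N}.
Proof.
by move=> m1 m2; rewrite /wdeg -big_split /=; apply: eq_bigr => i _; rewrite mnmDE mulnDl.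
Qed.

HB.instance Definition _ n (w : 'I_n -> nat) := isMeasure.Build n (wdeg w) (wdeg0 w) (wdegD w).

Lemma wdegU n (w : 'I_n -> nat) i : wdeg w U_(i)%MM = w i.
Proof.
rewrite /wdeg (bigD1 i) //= mnm1E eqxx mul1n big1 ?addn0 // => j ji.
by rewrite mnm1E eq_sym (negPf ji) mul0n.
Qed.

Section PihomogMul.
Variables (K : idomainType) (n : nat).
Implicit Types p q : {mpoly K[n]}.

Lemma pihomog_mulr d e p q : q \is e.-homog ->
  pihomog mdeg d (p * q) = if (e <= d)%N then pihomog mdeg (d - e) p * q else 0.
Proof.
move=> hq; rewrite {1}(pihomog_partitionE (leqnn (msize p))) mulr_suml raddf_sum /=.
have hom c : pihomog mdeg c p * q \is (c + e).-homog by apply: dhomogM => //; exact: pihomogP.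
case: leqP => [led|ltd]; last first.
  by rewrite big1 // => c _; rewrite (pihomog_ne0 _ (hom c)) //; lia.
have [ltp|gep] := ltnP (d - e) (msize p).
  rewrite (bigD1 (Ordinal ltp)) //= big1 ?addr0 => [|c cd].
    by have := hom (d - e)%N; rewrite subnK // => /pihomog_dE ->.
  rewrite (pihomog_ne0 _ (hom c)) //; apply: contraNneq cd => ce.
  by apply/eqP/val_inj => /=; lia.
rewrite big1 => [|c _]; last by rewrite (pihomog_ne0 _ (hom c)) //; have := ltn_ord c; lia.
have -> : pihomog mdeg (d - e) p = 0; last by rewrite mul0r.
rewrite pihomogE big_seq_cond big1 // => m /andP[mp /eqP md].
by move: gep; rewrite -md => /(leq_ltn_trans)/(_ (msize_mdeg_lt mp)); rewrite ltnn.
Qed.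
End PihomogMul.

Section FiniteGeneration.
Variables (C : numClosedFieldType) (n : nat).
Hypothesis C_uncountable : forall S : nat -> seq C, exists a, forall k, a \notin S k.
Variable G : 'M[C]_n -> Prop.
Hypothesis G_adjoint : forall A, G A -> G (adjoint_mx A).
Variables (k : nat) (F : k.-tuple {mpoly C[n]}) (deg : 'I_k -> nat).
Hypothesis F_inv : forall i, minvariant G (tnth F i).
Hypothesis F_homog : forall i, tnth F i \is (deg i).-homog.
Hypothesis deg_gt0 : forall i, (0 < deg i)%N.
Hypothesis nullcone : forall d p, (0 < d)%N -> minvariant G p -> p \is d.-homog ->
  forall v, (forall i, (tnth F i).@[v] = 0) -> p.@[v] = 0.

Local Notation inv := (minvariant G).

Lemma minvariant0 : inv 0. Proof. by move=> A _; rewrite /msubst rmorph0. Qed.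

Lemma homogeneous_coefficients r (h : 'I_r -> {mpoly C[n]}) (e : 'I_r -> nat) d p :
  (forall j, inv (h j)) -> (forall j, h j \is (e j).-homog) ->
  inv p -> p \is d.-homog -> span_ideal h p ->
  exists b : 'I_r -> {mpoly C[n]}, [/\ forall j, inv (b j),
    forall j, b j \is (d - e j).-homog, forall j, (d < e j)%N -> b j = 0 & p = \sum_j b j * h j].
Proof.
move=> Gh hh Gp hp spanp; have [b Gb def_p] := invariant_coefficients G_adjoint Gp Gh spanp.
(* For e j > d the truncated difference would select the degree 0 component, so the coefficient is
   set to zero. *)
exists (fun j => if (e j <= d)%N then pihomog mdeg (d - e j) (b j) else 0); split=> [j|j|j ltd|].
- by case: ifP => _; [exact: minvariant_pihomog | exact: minvariant0].
- by case: ifP => _; [exact: pihomogP | exact: dhomog0].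
- by rewrite leqNgt ltd.
- rewrite -(pihomog_dE hp) {1}def_p raddf_sum; apply: eq_bigr => j _ /=.
  by rewrite (pihomog_mulr _ _ (hh j)); case: ifP => _; rewrite ?mul0r.
Qed.

Lemma ideal_expr r (h : 'I_r -> {mpoly C[n]}) p N M : (N <= M)%N ->
  span_ideal h (p ^+ N) -> span_ideal h (p ^+ M).
Proof.
move=> leNM hp; rewrite -(subnK leNM) exprD.
by have [_ _ +] := span_ideal_ideal h; apply.
Qed.

(** Graded Nakayama: the [h j] generate the invariants as an algebra, invariants of large degree lie
    in the ideal of [F], and induction on the degree leaves the monomials in the [h j] of bounded
    degree as module generators. *)
Theorem finite_generation : exists (r : nat) (g : 'I_r -> {mpoly C[n]}),
  (forall j, inv (g j)) /\ forall p, inv p ->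
    exists c : 'I_r -> {mpoly C[k]}, p = \sum_j (c j \mPo F) * g j.
Proof.
pose H p := inv p /\ exists2 d, (0 < d)%N & p \is d.-homog.
have [r [h [hH genH]]] := hilbert_basis H.
have /choice [e eP] : forall j, exists d, (0 < d)%N /\ h j \is d.-homog.
  by move=> j; have [_ [d d0 hd]] := hH j; exists d.
have e0 j : (0 < e j)%N by case: (eP j).
have he j : h j \is (e j).-homog by case: (eP j).
have Gh j : inv (h j) by case: (hH j).
pose hs := [tuple h j | j < r].
have hsE j : tnth hs j = h j by rewrite tnth_mktuple.
have Ghs Q : inv (Q \mPo hs).
  move=> A GA; rewrite comp_mpolyEX /msubst rmorph_sum; apply: eq_bigr => m _ /=.
  rewrite linearZ /= comp_mpolyX rmorph_prod; congr (_ *: _); apply: eq_bigr => j _.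
  by rewrite rmorphXn /= hsE -/(msubst A (h j)) Gh.
have step1 d p : inv p -> p \is d.-homog ->
    exists Q, p = Q \mPo hs /\ Q \is d.-homog for (wdeg e).
  have [D ltd] := ubnP d; elim: D => // D IH in d p ltd *.
  move=> Gp hp; have [d0|d0] := posnP d.
    exists (p@_0%MM)%:MP; rewrite comp_mpolyC; split.
      apply/msize1_polyC; rewrite msizeE; apply/bigmax_leqP_seq => m mp _.
      by have /dhomogP/(_ m mp) /= -> := hp; rewrite d0.
    rewrite d0; have := rpredZ (p@_0%MM) (dhomog1 C (wdeg e)); by rewrite -mul_mpolyC mulr1.
  have Hp : H p by split=> //; exists d.
  have [b [Gb hb b0 def_p]] := homogeneous_coefficients Gh he Gp hp (genH p Hp).
  have /choice [Q QP] : forall j, exists Q, b j = Q \mPo hs /\ Q * 'X_j \is d.-homog for (wdeg e).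
    move=> j; have [led|ltde] := leqP (e j) d; last first.
      exists 0; rewrite b0 // rmorph0 mul0r; split=> //; exact: dhomog0.
    have [|Q [bQ hQ]] := IH (d - e j)%N _ _ (Gb j) (hb j).
      by have := e0 j; lia.
    exists Q; split=> //; rewrite -(subnK led); apply: dhomogM => //.
    by rewrite dhomogX /= wdegU.
  exists (\sum_j Q j * 'X_j); split; last by apply: rpred_sum => j _; case: (QP j).
  rewrite rmorph_sum {1}def_p; apply: eq_bigr => j _.
  by rewrite rmorphM /= comp_mpolyXU -tnth_nth hsE; case: (QP j) => <-.
have /choice [N NP] : forall j, exists N, span_ideal (tnth F) (h j ^+ N).
  by move=> j; apply: nullstellensatz => //; exact: nullcone (e0 j) (Gh j) (he j).
pose M := \max_j N j.
have MP j : span_ideal (tnth F) (h j ^+ M) by apply: ideal_expr (NP j); exact: leq_bigmax.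
(* A monomial of weight at least [d0] has some exponent at least [M]. *)
pose d0 := (\sum_j M * e j).+1%N.
have step2 d p : (d0 <= d)%N -> inv p -> p \is d.-homog -> span_ideal (tnth F) p.
  move=> led Gp hp; have [Q [-> /dhomogP hQ]] := step1 d p Gp hp.
  rewrite comp_mpolyEX big_seq; apply: ideal_sum; first exact: span_ideal_ideal.
  move=> m /hQ /= wm; rewrite -mul_mpolyC; have [_ _ JM] := span_ideal_ideal (tnth F).
  apply: (JM); rewrite comp_mpolyX.
  have [j Mj] : exists j, (M <= m j)%N.
    apply/existsP; apply: contraTT led; rewrite negb_exists => /forallP mM.
    rewrite -ltnNge ltnS -wm; apply: leq_sum => j _; apply: leq_mul => //.
    by apply: ltnW; rewrite ltnNge.
  rewrite (bigD1 j) //= mulrC; apply: JM; rewrite hsE.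
  exact: ideal_expr (MP j).
(* [T] bounds the unweighted degree; as all weights are positive, it contains every monomial of
   weight below [d0]. *)
pose T := 'X_{1..r < d0}.
pose g (j : 'I_#|{: T}|) := 'X_[enum_val j : T] \mPo hs.
pose Mod p := exists c : 'I_#|{: T}| -> {mpoly C[k]}, p = \sum_j (c j \mPo F) * g j.
have Mod0 : Mod 0 by exists (fun=> 0); rewrite big1 // => j _; rewrite rmorph0 mul0r.
have ModD p q : Mod p -> Mod q -> Mod (p + q).
  move=> [a ->] [b ->]; exists (fun j => a j + b j); rewrite -big_split.
  by apply: eq_bigr => j _; rewrite rmorphD mulrDl.
have ModM a p : Mod p -> Mod ((a \mPo F) * p).
  move=> [c ->]; exists (fun j => a * c j); rewrite mulr_sumr.
  by apply: eq_bigr => j _; rewrite rmorphM mulrA.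
have Modsum (I : Type) (s : seq I) (P : pred I) (q : I -> {mpoly C[n]}) :
    (forall i, P i -> Mod (q i)) -> Mod (\sum_(i <- s | P i) q i).
  by move=> qM; elim/big_ind: _ => //.
have step3 d p : inv p -> p \is d.-homog -> Mod p.
  have [D ltd] := ubnP d; elim: D => // D IH in d p ltd *.
  move=> Gp hp; have [led|lt0] := leqP d0 d; last first.
    have [Q [-> /dhomogP hQ]] := step1 d p Gp hp.
    rewrite [Q]mpolyE rmorph_sum big_seq; apply: Modsum => m /hQ /= wm.
    rewrite linearZ /=.
    have ltm : (mdeg m < d0)%N.
      apply: leq_ltn_trans lt0; rewrite -wm mdegE; apply: leq_sum => j _.
      by rewrite leq_pmulr.
    exists (fun j => if val (enum_val j : T) == m then (Q@_m)%:MP else 0).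
    rewrite (bigD1 (enum_rank (BMultinom ltm : T))) //= /g enum_rankK eqxx comp_mpolyC mul_mpolyC.
    rewrite big1 ?addr0 // => j jm; rewrite ifN ?rmorph0 ?mul0r //.
    apply: contraNneq jm => jm; apply/eqP/enum_val_inj; rewrite enum_rankK.
    exact: val_inj.
  have [b [Gb hb b0 ->]] := homogeneous_coefficients F_inv F_homog Gp hp (step2 d p led Gp hp).
  apply: Modsum => i _; have [ld|gd] := leqP (deg i) d; last by rewrite b0 // mul0r.
  rewrite mulrC -[tnth F i](_ : 'X_i \mPo F = _); last by rewrite comp_mpolyXU -tnth_nth.
  by apply/ModM/(IH (d - deg i)%N) => //; have := deg_gt0 i; lia.
exists #|{: T}|, g; split=> [j|p Gp]; first exact: Ghs.
rewrite -/(Mod p) (pihomog_partitionE (leqnn (msize p))); apply: Modsum => d _.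
by apply: (step3 d); [exact: minvariant_pihomog | exact: pihomogP].
Qed.
End FiniteGeneration.

(** * Trace polynomials *)

Section PolynomialFunctions.
Variables (K : fieldType) (n : nat) (w1 w2 : 'I_n -> nat).
Variables (T : Type) (v : T -> 'I_n -> K).

(** Total degree in the entries of z and bidegree in those of x and y come from one statement by
    varying [v], [w1] and [w2]. *)
Definition bihom_fun (d : nat * nat) (f : T -> K) := exists P : {mpoly K[n]},
  [/\ P \is d.1.-homog for (wdeg w1), P \is d.2.-homog for (wdeg w2) & forall t, f t = P.@[v t]].

Definition bihom_mx m (d : nat * nat) (M : T -> 'M[K]_m) :=
  forall i j, bihom_fun d (fun t => M t i j).

Lemma bihom_cst c : bihom_fun (0%N, 0%N) (fun=> c).
Proof.
by exists c%:MP; split=> [||t]; rewrite ?mevalC //= -[c]mulr1 mpolyCM mul_mpolyC rpredZ // dhomog1.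
Qed.

Lemma bihom_var k : bihom_fun (w1 k, w2 k) (fun t => v t k).
Proof. by exists 'X_k; split=> [||t]; rewrite ?mevalXU //= dhomogX /= wdegU. Qed.

Lemma bihomM d e f g : bihom_fun d f -> bihom_fun e g ->
  bihom_fun ((d.1 + e.1)%N, (d.2 + e.2)%N) (fun t => f t * g t).
Proof.
move=> [P [P1 P2 Pf]] [Q [Q1 Q2 Qg]]; exists (P * Q).
by split=> [||t]; [exact: dhomogM | exact: dhomogM | rewrite mevalM Pf Qg].
Qed.

Lemma bihomZ d c f : bihom_fun d f -> bihom_fun d (fun t => c * f t).
Proof. by case: d => d e /(bihomM (bihom_cst c)). Qed.

Lemma bihom_sum (I : Type) (s : seq I) (f : I -> T -> K) d :
  (forall i, bihom_fun d (f i)) -> bihom_fun d (fun t => \sum_(i <- s) f i t).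
Proof.
move=> hf; elim: s => [|i s [P [P1 P2 Pf]]].
  by exists 0; split=> [||t]; rewrite ?dhomog0 // big_nil meval0.
have [Q [Q1 Q2 Qf]] := hf i; exists (Q + P).
by split=> [||t]; rewrite ?rpredD // big_cons mevalD Qf Pf.
Qed.

Lemma bihomD d f g : bihom_fun d f -> bihom_fun d g -> bihom_fun d (fun t => f t + g t).
Proof.
move=> [P [P1 P2 Pf]] [Q [Q1 Q2 Qg]]; exists (P + Q).
by split=> [||t]; rewrite ?rpredD // mevalD Pf Qg.
Qed.

Lemma bihom_eq d f g : f =1 g -> bihom_fun d f -> bihom_fun d g.
Proof. by move=> fg [P [P1 P2 Pf]]; exists P; split=> // t; rewrite -fg. Qed.

Lemma bihom_mulmx m d e (M N : T -> 'M[K]_m) : bihom_mx d M -> bihom_mx e N ->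
  bihom_mx ((d.1 + e.1)%N, (d.2 + e.2)%N) (fun t => M t * N t).
Proof.
move=> hM hN i j; apply: (@bihom_eq _ (fun t => \sum_k M t i k * N t k j)).
  by move=> t; rewrite -mulmxE mxE.
by apply: bihom_sum => k; exact: bihomM.
Qed.

Lemma bihom_expmx m d (M : T -> 'M[K]_m) k : bihom_mx d M ->
  bihom_mx ((k.+1 * d.1)%N, (k.+1 * d.2)%N) (fun t => M t ^+ k.+1).
Proof.
move=> hM; elim: k => [|k IH]; first by rewrite !mul1n; case: d hM.
move=> i j; apply: (@bihom_eq _ (fun t => (M t * M t ^+ k.+1) i j)).
  by move=> t; rewrite -exprS.
by rewrite !(mulSn k.+1); exact: (bihom_mulmx hM IH).
Qed.

Lemma bihom_trace m d (M : T -> 'M[K]_m) : bihom_mx d M -> bihom_fun d (fun t => \tr (M t)).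
Proof. by move=> hM; apply: bihom_sum => i; exact: hM. Qed.

Definition W2sharp_bidegree (i : 'I_15) : nat * nat := nth (0%N, 0%N)
  [:: (1, 0); (2, 0); (0, 2); (3, 0); (1, 2); (2, 2); (2, 2); (0, 4); (3, 2); (1, 4);
      (4, 2); (3, 3); (2, 4); (0, 6); (2, 6)]%N i.

Lemma bihom_W2sharp m (X Y : T -> 'M[K]_m) dx dy i : bihom_mx dx X -> bihom_mx dy Y ->
  let: (a, b) := W2sharp_bidegree i in
  bihom_mx ((a * dx.1 + b * dy.1)%N, (a * dx.2 + b * dy.2)%N)
    (fun t => tnth (W2sharp (X t) (Y t)) i).
Proof.
case: dx dy => [a b] [a' b'] hX hY; rewrite /W2sharp_bidegree.
have hX2 := bihom_expmx 1 hX; have hX3 := bihom_expmx 2 hX.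
have hY2 := bihom_expmx 1 hY; have hY3 := bihom_expmx 2 hY; have hY4 := bihom_expmx 3 hY.
have hY6 := bihom_expmx 5 hY.
have hXY := bihom_mulmx hX hY; have hX2Y := bihom_mulmx hX2 hY.
have hXY3 := bihom_mulmx hX hY3; have hX2Y2 := bihom_mulmx hX2 hY2.
have wordE (M M' : T -> 'M[K]_m) d d' : bihom_mx d M -> (forall t, M' t = M t) -> d.1 = d'.1 -> d.2 = d'.2 ->
    bihom_mx d' M'.
  by move=> + /funext ->; case: d d' => [? ?] [? ?] /= + <- <-.
case: i => i lti /=.
do 15?[case: i lti => [|i] lti /=]; last by [].
- by apply: (wordE _ _ _ _ hX) => [t||] /=; [rewrite (tnth_nth 0) | lia | lia].
- by apply: (wordE _ _ _ _ hX2) => [t||] /=; [rewrite (tnth_nth 0) | lia | lia].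
- by apply: (wordE _ _ _ _ hY2) => [t||] /=; [rewrite (tnth_nth 0) | lia | lia].
- by apply: (wordE _ _ _ _ hX3) => [t||] /=; [rewrite (tnth_nth 0) | lia | lia].
- by apply: (wordE _ _ _ _ (bihom_mulmx hX hY2)) => [t||] /=; [rewrite (tnth_nth 0) | lia | lia].
- by apply: (wordE _ _ _ _ hX2Y2) => [t||] /=; [rewrite (tnth_nth 0) | lia | lia].
- by apply: (wordE _ _ _ _ (bihom_expmx 1 hXY)) => [t||] /=; [rewrite (tnth_nth 0) | lia | lia].
- by apply: (wordE _ _ _ _ hY4) => [t||] /=; [rewrite (tnth_nth 0) | lia | lia].
- apply: (wordE _ _ _ _ (bihom_mulmx (bihom_mulmx hX2Y hX) hY)) => [t||] /=;
    by [rewrite (tnth_nth 0) | lia].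
- by apply: (wordE _ _ _ _ (bihom_mulmx hX hY4)) => [t||] /=; [rewrite (tnth_nth 0) | lia | lia].
- by apply: (wordE _ _ _ _ (bihom_expmx 1 hX2Y)) => [t||] /=; [rewrite (tnth_nth 0) | lia | lia].
- apply: (wordE _ _ _ _ (bihom_mulmx (bihom_mulmx hX2Y2 hX) hY)) => [t||] /=;
    by [rewrite (tnth_nth 0) | lia].
- apply: (wordE _ _ _ _ (bihom_mulmx (bihom_mulmx hXY3 hX) hY)) => [t||] /=;
    by [rewrite (tnth_nth 0) | lia].
- by apply: (wordE _ _ _ _ hY6) => [t||] /=; [rewrite (tnth_nth 0) | lia | lia].
- by apply: (wordE _ _ _ _ (bihom_expmx 1 hXY3)) => [t||] /=; [rewrite (tnth_nth 0) | lia | lia].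
Qed.
End PolynomialFunctions.

(** * Invariants of the symplectic group *)

Section SymplecticAdjoint.
Variables (K : fieldType) (n : nat).
Local Notation J := (sympJ K n).
Implicit Types z a : 'M[K]_(n + n).

Lemma sympJ_sq : J *m J = - 1%:M.
Proof.
rewrite /sympJ mulmx_block !(mul0mx, mulmx0, mul1mx, mulmx1, addr0, add0r).
by rewrite [in RHS]scalar_mx_block opp_block_mx oppr0.
Qed.

Lemma sympJ_tr : J^T = - J.
Proof. by rewrite /sympJ tr_block_mx opp_block_mx !linear0 !linearN /= trmx1 !opprK. Qed.

Lemma sympJ_unit : J \in unitmx.
Proof. by case: (@mulmx1_unit _ _ (- J) J _) => //; rewrite mulNmx sympJ_sq opprK. Qed.

Lemma sympJ_inv : invmx J = - J.
Proof.
by rewrite -[RHS]mulmx1 -(mulmxV sympJ_unit) mulmxA mulNmx sympJ_sq opprK mul1mx.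
Qed.

Lemma sadjE z : sadj z = - (J *m z^T *m J).
Proof. by rewrite /sadj sympJ_inv !mulNmx. Qed.

Lemma sadjK : involutive (@sadj K n).
Proof.
move=> z; rewrite !sadjE [(- _)^T]linearN /= !trmx_mul trmxK sympJ_tr !(mulNmx, mulmxN) !opprK.
by rewrite -!mulmxA sympJ_sq !mulmxN mulmx1 !mulmxA sympJ_sq mulNmx mul1mx opprK.
Qed.

Lemma sadjD : {morph (@sadj K n) : z z' / z + z'}.
Proof. by move=> z z'; rewrite /sadj linearD /= mulmxDr mulmxDl. Qed.

Lemma sadjZ c z : sadj (c *: z) = c *: sadj z.
Proof. by rewrite /sadj linearZ /= -scalemxAr -scalemxAl. Qed.

Lemma sadjM z z' : sadj (z *m z') = sadj z' *m sadj z.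
Proof. by rewrite /sadj trmx_mul !mulmxA mulmxK ?sympJ_unit. Qed.

Lemma sadjB : {morph (@sadj K n) : z z' / z - z'}.
Proof. by move=> z z'; rewrite sadjD -!scaleN1r sadjZ. Qed.

Lemma trmx_sympJ z : z^T *m J = J *m sadj z.
Proof. by rewrite /sadj !mulmxA mulmxV ?sympJ_unit // mul1mx. Qed.

Lemma sadj_in_Sp a : in_Sp a -> sadj a = invmx a.
Proof.
move=> [ua aJ]; have e : sadj a *m a = 1%:M.
  by rewrite /sadj -!mulmxA (mulmxA a^T) aJ mulVmx ?sympJ_unit.
by rewrite -[LHS](mulmxK ua) e mul1mx.
Qed.

Lemma in_Sp_inv a : in_Sp a -> in_Sp (invmx a).
Proof.
move=> [ua aJ]; split; first by rewrite unitmx_inv.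
by rewrite -{1}aJ trmx_inv !mulmxA mulVmx ?unitmx_tr // mul1mx mulmxK.
Qed.

Lemma sadj_conj a z : in_Sp a -> sadj (a *m z *m invmx a) = a *m sadj z *m invmx a.
Proof.
by move=> Sa; rewrite !sadjM (sadj_in_Sp Sa) (sadj_in_Sp (in_Sp_inv Sa)) invmxK mulmxA.
Qed.

Lemma xpart_conj a z : in_Sp a -> xpart (a *m z *m invmx a) = a *m xpart z *m invmx a.
Proof. by move=> Sa; rewrite /xpart sadj_conj // -mulmxDl -mulmxDr -scalemxAr -scalemxAl. Qed.

Lemma ypart_conj a z : in_Sp a -> ypart (a *m z *m invmx a) = a *m ypart z *m invmx a.
Proof. by move=> Sa; rewrite /ypart sadj_conj // -mulmxBl -mulmxBr -scalemxAr -scalemxAl. Qed.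

Lemma sadj_xpart z : sadj (xpart z) = xpart z.
Proof. by rewrite /xpart sadjZ sadjD sadjK addrC. Qed.

Lemma sadj_ypart z : sadj (ypart z) = - ypart z.
Proof. by rewrite /ypart sadjZ sadjB sadjK -scalerN opprB. Qed.

Lemma xpart_ypart z : (2 : K) != 0 -> xpart z + ypart z = z.
Proof.
by move=> nz2; rewrite -scalerDr addrACA subrr addr0 -mulr2n -scaler_nat scalerA mulVf ?scale1r.
Qed.

End SymplecticAdjoint.

Lemma W2sharp_trace_conj (K : fieldType) n (a x y : 'M[K]_n) i : a \in unitmx ->
  \tr (tnth (W2sharp (a *m x *m invmx a) (a *m y *m invmx a)) i) = \tr (tnth (W2sharp x y) i).
Proof.
move=> ua.
have cM : {morph (fun x => a *m x *m invmx a) : x y / x * y}.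
  by move=> b c; rewrite -!mulmxE !mulmxA mulmxKV.
by rewrite (W2sharp_morph _ _ _ cM) mxtrace_mulC !mulmxA mulVmx // mul1mx.
Qed.

Section SymplecticInvariants6.
Variable C : numClosedFieldType.
Implicit Types z a : 'M[C]_(3 + 3).
Local Notation J := (sympJ C 3).
Local Notation eval P z := P.@[fun k => mxvec z 0 k].

Lemma trW2sharp_invariant i : Sp_invariant (@trW2sharp C i).
Proof.
move=> a Sa z; rewrite /trW2sharp (xpart_conj z Sa) (ypart_conj z Sa).
by apply: W2sharp_trace_conj; case: Sa.
Qed.

Lemma bihom_parts (n : nat) (w1 w2 : 'I_n -> nat) T (v : T -> 'I_n -> C) d (s : C)
    (Z : T -> 'M[C]_(3 + 3)) : bihom_mx w1 w2 v d Z ->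
  bihom_mx w1 w2 v d (fun t => 2^-1 *: (Z t + s *: sadj (Z t))).
Proof.
move=> hZ i j.
apply: (@bihom_eq _ _ _ _ _ _ _ (fun t => 2^-1 * (Z t i j +
   s * (\sum_k \sum_l (- J i k * J l j) * Z t l k)))).
  move=> t; rewrite sadjE [RHS]mxE; congr (_ * _); rewrite [RHS]mxE; congr (_ + _).
  rewrite [RHS]mxE; congr (_ * _); rewrite [RHS]mxE [X in - X]mxE -sumrN exchange_big.
  apply: eq_bigr => l _; rewrite [(J *m _) _ _]mxE mulr_suml -sumrN; apply: eq_bigr => k _.
  by rewrite [_^T _ _]mxE !mulNr mulrAC.
apply/bihomZ/bihomD; first exact: hZ.
by apply/bihomZ/bihom_sum => k; apply: bihom_sum => l; apply: bihomZ; exact: hZ.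
Qed.

Definition W2sharp_degree i := ((W2sharp_bidegree i).1 + (W2sharp_bidegree i).2)%N.

Lemma W2sharp_degree_gt0 i : (0 < W2sharp_degree i)%N.
Proof. by case: i => i /=; do 15?[case: i => [|i] //=]. Qed.

Lemma wdeg1 n (m : 'X_{1..n}) : wdeg (fun=> 1%N) m = mdeg m.
Proof. by rewrite mdegE /wdeg; apply: eq_bigr => i _; rewrite muln1. Qed.

Lemma trW2sharp_poly : exists F : 15.-tuple {mpoly C[(3 + 3) * (3 + 3)]},
  forall i, tnth F i \is (W2sharp_degree i).-homog /\ forall z, trW2sharp i z = eval (tnth F i) z.
Proof.
suff /choice[F FP] : forall i, exists P : {mpoly C[(3 + 3) * (3 + 3)]},
    P \is (W2sharp_degree i).-homog /\ forall z, trW2sharp i z = eval P z.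
  by exists (mktuple F) => i; rewrite tnth_mktuple.
move=> i; pose w1 (k : 'I_((3 + 3) * (3 + 3))) := 1%N; pose w2 (k : 'I_((3 + 3) * (3 + 3))) := 0%N.
pose v z k := mxvec z 0 k.
have hz : bihom_mx w1 w2 v (1%N, 0%N) id.
  move=> j k; apply: (@bihom_eq _ _ _ _ _ _ _ (fun z => v z (mxvec_index j k))).
    by move=> z; rewrite /v mxvecE.
  exact: bihom_var.
have hX : bihom_mx w1 w2 v (1%N, 0%N) (@xpart C 3).
  by move=> j k; apply: bihom_eq (bihom_parts 1 hz j k) => z; rewrite scale1r.
have hY : bihom_mx w1 w2 v (1%N, 0%N) (@ypart C 3).
  by move=> j k; apply: bihom_eq (bihom_parts (-1) hz j k) => z; rewrite scaleN1r.
have := bihom_W2sharp i hX hY; rewrite /W2sharp_degree.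
case: (W2sharp_bidegree i) => a b /bihom_trace [P [P1 _ PE]]; exists P; split=> //.
apply/dhomogP => m mP; have /dhomogP/(_ m mP) := P1.
by rewrite /= wdeg1 !muln1.
Qed.

Lemma trW2sharp_Cbar i : Cbar (@trW2sharp C i).
Proof.
split; last exact: trW2sharp_invariant.
by have [F FP] := trW2sharp_poly; exists (tnth F i); case: (FP i).
Qed.

Lemma trW2sharp_bihomogeneous i :
  exists d e, (0 < d + e)%N /\ bihomogeneous d e (@trW2sharp C i).
Proof.
pose N := ((3 + 3) * (3 + 3))%N.
pose w1 (k : 'I_(N + N)) := (k < N : nat)%N; pose w2 (k : 'I_(N + N)) := (N <= k : nat)%N.
have wl (q : 'I_N) : w1 (lshift N q) = 1%N /\ w2 (lshift N q) = 0%N.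
  by rewrite /w1 /w2 /= ltn_ord leqNgt ltn_ord.
have wr (q : 'I_N) : w1 (rshift N q) = 0%N /\ w2 (rshift N q) = 1%N.
  by [].
pose v z (k : 'I_(N + N)) := row_mx (mxvec (xpart z)) (mxvec (ypart z)) 0 k.
have hX : bihom_mx w1 w2 v (1%N, 0%N) (@xpart C 3).
  move=> j k; apply: (@bihom_eq _ _ _ _ _ _ _ (fun z => v z (lshift N (mxvec_index j k)))).
    by move=> z; rewrite /v row_mxEl mxvecE.
  have := bihom_var w1 w2 v (lshift N (mxvec_index j k)).
  by have [-> ->] := wl (mxvec_index j k).
have hY : bihom_mx w1 w2 v (0%N, 1%N) (@ypart C 3).
  move=> j k; apply: (@bihom_eq _ _ _ _ _ _ _ (fun z => v z (rshift N (mxvec_index j k)))).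
    by move=> z; rewrite /v row_mxEr mxvecE.
  have := bihom_var w1 w2 v (rshift N (mxvec_index j k)).
  by have [-> ->] := wr (mxvec_index j k).
exists (W2sharp_bidegree i).1, (W2sharp_bidegree i).2; split; first exact: W2sharp_degree_gt0.
have := bihom_W2sharp i hX hY; case: (W2sharp_bidegree i) => a b /bihom_trace [P [P1 P2 PE]].
exists P; split=> // m mP.
have wd1 : wdeg w1 m = (\sum_k m (lshift N k))%N.
  rewrite /wdeg big_split_ord -[RHS]addn0; congr (_ + _)%N; last apply: big1 => k _.
    by apply: eq_bigr => k _; have [-> _] := wl k; rewrite muln1.
  by have [-> _] := wr k; rewrite muln0.
have wd2 : wdeg w2 m = (\sum_k m (rshift N k))%N.
  rewrite /wdeg big_split_ord -[RHS]add0n; congr (_ + _)%N; first apply: big1 => k _.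
    by have [_ ->] := wl k; rewrite muln0.
  by apply: eq_bigr => k _; have [_ ->] := wr k; rewrite muln1.
rewrite -wd1 -wd2; move: P1 P2 => /dhomogP/(_ m mP) /= -> /dhomogP/(_ m mP) /= ->.
by rewrite !(muln1, muln0, addn0, add0n).
Qed.

Definition conj_matrix a : 'M[C]_((3 + 3) * (3 + 3)) := lin_mx (fun z => a *m z *m invmx a).

Lemma conj_matrixE a i j k l :
  conj_matrix a (mxvec_index i j) (mxvec_index k l) = a k i * invmx a j l.
Proof.
rewrite mxE /= vec_mx_delta mxvecE -(mul_delta_mx (0 : 'I_1)) mulmxA -colE -mulmxA -rowE.
by rewrite mxE big_ord1 mxE [row _ _ _ _]mxE.
Qed.

Lemma adjoint_mxM n (a b : 'M[C]_n) : adjoint_mx (a *m b) = adjoint_mx b *m adjoint_mx a.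
Proof. by rewrite /adjoint_mx trmx_mul map_mxM. Qed.

(** The product of a and [sadj a] being 1 means a J a^T = J, and J is real. *)
Lemma in_Sp_adjoint a : in_Sp a -> in_Sp (adjoint_mx a).
Proof.
move=> Sa; have [ua aJ] := Sa; split; first by rewrite /adjoint_mx map_unitmx unitmx_tr.
have aJa : a *m J *m a^T = J.
  apply: (can_inj (mulmxK (sympJ_unit C 3))).
  by rewrite sympJ_sq -(mulmxV ua) -(sadj_in_Sp Sa) sadjE mulmxN opprK !mulmxA.
have cJ : map_mx Num.conj J = J.
  by rewrite /sympJ map_block_mx !map_mx0 map_mxN map_scalar_mx rmorph1.
by rewrite /adjoint_mx map_trmx trmxK -{1}cJ -map_mxM -map_mxM aJa.
Qed.

Definition conj_group (A : 'M[C]_((3 + 3) * (3 + 3))) := exists2 a, in_Sp a & A = conj_matrix a.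

(** On matrix units, conjugation by a has entries that are products of an entry of a and one of its
    inverse, so its conjugate transpose is conjugation by the conjugate transpose of a. *)
Lemma conj_group_adjoint A : conj_group A -> conj_group (adjoint_mx A).
Proof.
move=> [a Sa ->]; exists (adjoint_mx a); first exact: in_Sp_adjoint.
have [ua _] := Sa; have iE : invmx (adjoint_mx a) = adjoint_mx (invmx a).
  have e : adjoint_mx (invmx a) *m adjoint_mx a = 1%:M.
    by rewrite -adjoint_mxM mulmxV // /adjoint_mx trmx1 map_mx1.
  have [_ ua'] := mulmx1_unit e.
  by rewrite -[LHS]mul1mx -e mulmxK.
apply/matrixP => p q; case/mxvec_indexP: p => i j; case/mxvec_indexP: q => k l.
transitivity (conj_matrix a (mxvec_index k l) (mxvec_index i j))^*.
  by rewrite mxE [_^T _ _]mxE.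
by rewrite !conj_matrixE iE rmorphM [adjoint_mx _ _ _]mxE [adjoint_mx _ _ _]mxE ![_^T _ _]mxE.
Qed.

Lemma meval_conj_matrix (P : {mpoly C[(3 + 3) * (3 + 3)]}) a z :
  (msubst (conj_matrix a) P).@[fun k => mxvec z 0 k] = eval P (a *m z *m invmx a).
Proof.
rewrite meval_msubst; apply: meval_eq => k.
rewrite -[RHS]/((mxvec ((mulmxr (invmx a) \o mulmx a) z)) 0 k).
by rewrite -mul_vec_lin mxE.
Qed.

Lemma minvariantP P : minvariant conj_group P <-> Sp_invariant (fun z => eval P z).
Proof.
split=> [GP a Sa z|SP _ [a Sa ->]].
  by rewrite -meval_conj_matrix GP //; exists a.
apply/eqP; rewrite -subr_eq0; apply/eqP/mpoly_meval_eq0 => v.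
have -> : v = (fun k => mxvec (vec_mx (\row_k v k) : 'M_(3 + 3)) 0 k).
  by apply/funext => k; rewrite vec_mxK mxE.
by rewrite mevalB meval_conj_matrix SP // subrr.
Qed.

Lemma trW2sharp_nullcone z P : (forall i, trW2sharp i z = 0) ->
  Sp_invariant (fun z => eval P z) -> eval P z = P.@[fun=> 0].
Proof.
move=> tr0 SP; have nz2 : (2 : C) != 0 by rewrite pnatr_eq0.
have sJ : symplectic (J : 'M_(hdim 3)).
  by apply/andP; split; [exact: (sympJ_unit C 3) | apply/eqP; exact: (sympJ_tr C 3)].
have ex : (xpart z)^T *m J = J *m xpart z by rewrite trmx_sympJ sadj_xpart.
have ey : (ypart z)^T *m J = - (J *m ypart z) by rewrite trmx_sympJ sadj_ypart mulmxN.
have [g [ug gJ upx upy]] := @strict_triangularization C 3 J (xpart z) (ypart z) isT sJ ex ey tr0.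
apply: (invariant_nullcone ug sJ gJ); last by move=> a ua aJ; apply: SP.
move=> i j lji; rewrite -[z](xpart_ypart _ nz2) /mxconj mulmxDr mulmxDl mxE.
by rewrite upx // upy // addr0.
Qed.

Hypothesis C_uncountable : forall S : nat -> seq C, exists c, forall k, c \notin S k.

Lemma trW2sharp_finite : Cbar_finite_over (gen_subalg (@trW2sharp C)).
Proof.
have [F FP] := trW2sharp_poly.
have Fhom i : tnth F i \is (W2sharp_degree i).-homog by case: (FP i).
have FE i z : trW2sharp i z = eval (tnth F i) z by case: (FP i).
have Finv i : minvariant conj_group (tnth F i).
  by apply/minvariantP => a Sa z; rewrite -!FE; exact: trW2sharp_invariant.
have null d p : (0 < d)%N -> minvariant conj_group p -> p \is d.-homog ->
    forall v, (forall i, (tnth F i).@[v] = 0) -> p.@[v] = 0.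
  move=> d0 /minvariantP Sp hp v.
  have -> : v = (fun k => mxvec (vec_mx (\row_k v k) : 'M_(3 + 3)) 0 k).
    by apply/funext => k; rewrite vec_mxK mxE.
  move: (vec_mx _) => z Fz; rewrite (trW2sharp_nullcone _ Sp) => [|i]; last by rewrite FE.
  rewrite mevalE big_seq big1 // => m mp; have /dhomogP/(_ m mp) /= md := hp.
  have [j mj] : exists j, m j != 0%N.
    apply/existsP; rewrite -negb_forall; apply: contraTN d0 => /forallP m0.
    by rewrite -md mdegE big1 // => j _; apply/eqP.
  by rewrite (bigD1 j) //= expr0n (negPf mj) mul0r mulr0.
have [r [g [Gg fin]]] :=
  finite_generation C_uncountable conj_group_adjoint Finv Fhom W2sharp_degree_gt0 null.
exists r, (fun j z => eval (g j) z); split=> [j|h [[P hP] Sh]].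
  by split; [exists (g j) | apply/minvariantP].
have [|c cP] := fin P; first by apply/minvariantP => a Sa z; rewrite -!hP; exact: Sh.
exists (fun j z => (c j).@[fun i => trW2sharp i z]); split=> [j|z]; first by exists (c j).
rewrite hP cP rmorph_sum; apply: eq_bigr => j _; rewrite rmorphM /= comp_mpoly_meval.
by congr (_ * _); apply: meval_eq => i; rewrite FE.
Qed.
End SymplecticInvariants6.

(** * A point with invertible Jacobian *)

(* First-order jets (a, b) stand for a + b t modulo t^2. *)
Definition jet := (int * int)%type.
Definition jet_add (a b : jet) : jet := (a.1 + b.1, a.2 + b.2).
Definition jet_mul (a b : jet) : jet := (a.1 * b.1, a.1 * b.2 + a.2 * b.1).
Definition jet_sum (f : nat -> jet) := foldr (fun k s => jet_add (f k) s) (0, 0) (iota 0 6).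

Definition jetmx := seq (seq jet).
Definition jet_get (A : jetmx) i j : jet := nth (0, 0) (nth [::] A i) j.
Definition jet_mx (f : nat -> nat -> jet) : jetmx := mkseq (fun i => mkseq (f i) 6) 6.
Definition jet_mulmx (A B : jetmx) :=
  jet_mx (fun i j => jet_sum (fun k => jet_mul (jet_get A i k) (jet_get B k j))).
Definition jet_trace (A : jetmx) := jet_sum (fun k => jet_get A k k).

Definition jet_W2sharp (x y : jetmx) : seq jetmx :=
  let m := jet_mulmx in
  let x2 := m x x in let y2 := m y y in let y3 := m y y2 in let y4 := m y y3 in
  let xy := m x y in let x2y := m x2 y in let x2y2 := m x2 y2 in let xy3 := m x y3 in
  [:: x; x2; y2; m x x2; m x y2; x2y2; m xy xy; y4; m (m x2y x) y; m x y4;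
      m x2y x2y; m (m x2y2 x) y; m (m xy3 x) y; m y (m y y4); m xy3 xy3].

Definition sparse (l : seq (nat * nat * int)) (i j : nat) : int :=
  foldr (fun e s => (if e.1 == (i, j) then e.2 else 0) + s) 0 l.

(** Entries of the symplectic adjoint: J exchanges i and i + 3 modulo 6, with a minus sign for i <
    3. *)
Definition int_adj (z : nat -> nat -> int) i j : int :=
  (-1) ^+ (i < 3)%N * (-1) ^+ (j < 3)%N * z ((j + 3) %% 6)%N ((i + 3) %% 6)%N.

(** Twice the self-adjoint or skew-adjoint part; evaluation at twice an integer matrix avoids the
    halves. *)
Definition int_part (s : int) (z : nat -> nat -> int) i j := z i j + s * int_adj z i j.

Definition jet_part (s : int) (z w : nat -> nat -> int) : jetmx :=
  jet_mx (fun i j => (int_part s z i j, int_part s w i j)).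

(* Found by a random search; the directions were chosen by column reduction of
   the Jacobian at the base point. *)
Definition base_point : seq (nat * nat * int) :=
  [:: (1, 4, 1); (1, 5, 1); (2, 4, 1); (3, 0, 1); (3, 1, -1); (4, 1, -1); (5, 1, 1); (5, 3, -1)].

Definition directions : seq (seq (nat * nat * int)) := [::
  [:: (0, 0, 1)];
  [:: (0, 4, 1)];
  [:: (0, 3, 1)];
  [:: (0, 4, 1); (2, 4, 1)];
  [:: (0, 5, 1)];
  [:: (1, 0, 1)];
  [:: (2, 1, 1)];
  [:: (5, 2, 1)];
  [:: (0, 2, 1)];
  [:: (3, 2, 1)];
  [:: (0, 2, -1); (2, 5, 1)];
  [:: (0, 4, 1); (1, 0, 1); (2, 0, 1); (3, 2, -1)];
  [:: (3, 0, 1)];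
  [:: (0, 2, -1); (0, 3, 1); (0, 4, 1); (1, 0, 1); (1, 4, 1); (2, 0, 1); (2, 1, 1); (2, 5, 2); (3, 2, -1)];
  [:: (0, 3, -1); (2, 1, 1); (3, 0, 1); (3, 2, 1); (4, 2, 1); (5, 2, -1)]].

Definition jet_jacobian := let z := sparse base_point in
  [seq [seq (jet_trace A).2 | A <- jet_W2sharp (jet_part 1 z (sparse w)) (jet_part (-1) z (sparse w))]
  | w <- directions].

Lemma jet_jacobian_trig l i : (l < 15)%N -> (i < 15)%N ->
  if (i < l)%N then nth 0 (nth [::] jet_jacobian l) i = 0
  else (i == l) ==> (nth 0 (nth [::] jet_jacobian l) i != 0).
Proof.
have : all (fun l => all (fun i => if (i < l)%N then nth 0 (nth [::] jet_jacobian l) i == 0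
    else (i == l) ==> (nth 0 (nth [::] jet_jacobian l) i != 0)) (iota 0 15)) (iota 0 15).
  by vm_compute.
move=> /allP/(_ l); rewrite mem_iota => H lt_l lt_i; have /allP/(_ i) := H lt_l.
by rewrite mem_iota => /(_ lt_i); case: ifP => // _ /eqP.
Qed.

Section JetCorrectness.
Variable K : fieldType.
Implicit Types (p q : {poly K}) (M N : 'M[{poly K}]_6) (A B : jetmx).

Definition has_jet p (a : jet) := p`_0 = a.1%:~R /\ p`_1 = a.2%:~R.

Lemma has_jet0 : has_jet 0 (0, 0). Proof. by split; rewrite coef0. Qed.

Lemma has_jetD p q a b : has_jet p a -> has_jet q b -> has_jet (p + q) (jet_add a b).
Proof. by move=> [p0 p1] [q0 q1]; split; rewrite coefD /= rmorphD /= (p0, p1) (q0, q1). Qed.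

Lemma has_jetM p q a b : has_jet p a -> has_jet q b -> has_jet (p * q) (jet_mul a b).
Proof.
move=> [p0 p1] [q0 q1]; split; rewrite coefM ?big_ord_recl big_ord0 /= ?rmorphD !rmorphM /=.
  by rewrite p0 q0 addr0.
by rewrite /bump /= p0 p1 q0 q1 addr0.
Qed.

Lemma has_jet_sum (f : 'I_6 -> {poly K}) (g : nat -> jet) :
  (forall k : 'I_6, has_jet (f k) (g k)) -> has_jet (\sum_k f k) (jet_sum g).
Proof.
move=> fg; rewrite /jet_sum -val_enum_ord foldr_map -big_enum /=.
elim: (enum _) => [|k s IH] /=; first by rewrite big_nil; exact: has_jet0.
by rewrite big_cons; exact: has_jetD.
Qed.

Definition has_jetmx M A := forall i j : 'I_6, has_jet (M i j) (jet_get A i j).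

Lemma jet_get_mx f i j : (i < 6)%N -> (j < 6)%N -> jet_get (jet_mx f) i j = f i j.
Proof. by move=> i6 j6; rewrite /jet_get !nth_mkseq. Qed.

Lemma has_jet_mulmx M N A B : has_jetmx M A -> has_jetmx N B -> has_jetmx (M * N) (jet_mulmx A B).
Proof.
move=> MA NB i j; rewrite -mulmxE mxE jet_get_mx //.
by apply: (has_jet_sum (g := fun k => jet_mul (jet_get A i k) (jet_get B k j))) => k; exact: has_jetM.
Qed.

Lemma has_jet_trace M A : has_jetmx M A -> has_jet (\tr M) (jet_trace A).
Proof. by move=> MA; apply: (has_jet_sum (g := fun k => jet_get A k k)) => k; exact: MA. Qed.

Lemma has_jet_W2sharp M N A B (i : 'I_15) : has_jetmx M A -> has_jetmx N B ->
  has_jetmx (tnth (W2sharp M N) i) (nth [::] (jet_W2sharp A B) i).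
Proof.
move=> hM hN; rewrite (tnth_nth 0); have mul := has_jet_mulmx.
have hM2 := mul _ _ _ _ hM hM; have hN2 := mul _ _ _ _ hN hN.
have hN3 := mul _ _ _ _ hN hN2; have hN4 := mul _ _ _ _ hN hN3.
have hMN := mul _ _ _ _ hM hN; have hM2N := mul _ _ _ _ hM2 hN.
have hM2N2 := mul _ _ _ _ hM2 hN2; have hMN3 := mul _ _ _ _ hM hN3.
case: i => i lti /=; do 15?[case: i lti => [|i] lti /=]; last by [].
- exact: hM.
- exact: hM2.
- exact: hN2.
- exact: (mul _ _ _ _ hM hM2).
- exact: (mul _ _ _ _ hM hN2).
- exact: hM2N2.
- exact: (mul _ _ _ _ hMN hMN).
- exact: hN4.
- exact: (mul _ _ _ _ (mul _ _ _ _ hM2N hM) hN).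
- exact: (mul _ _ _ _ hM hN4).
- exact: (mul _ _ _ _ hM2N hM2N).
- exact: (mul _ _ _ _ (mul _ _ _ _ hM2N2 hM) hN).
- exact: (mul _ _ _ _ (mul _ _ _ _ hMN3 hM) hN).
- exact: (mul _ _ _ _ hN (mul _ _ _ _ hN hN4)).
- exact: (mul _ _ _ _ hMN3 hMN3).
Qed.
End JetCorrectness.

Section SympJEntries.
Variable K : fieldType.

Definition partner (i : 'I_(3 + 3)) : 'I_(3 + 3) := inord ((i + 3) %% 6).

Lemma partnerE (i : 'I_(3 + 3)) : partner i = ((i + 3) %% 6)%N :> nat.
Proof. by rewrite /partner inordK // ltn_mod. Qed.

Lemma sympJE (i k : 'I_(3 + 3)) :
  sympJ K 3 i k = if k == partner i then (-1) ^+ (i < 3)%N else 0.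
Proof.
rewrite -val_eqE /= partnerE /sympJ !mxE.
case: splitP => i' ei; rewrite !mxE; case: splitP => k' ek; rewrite ?mxE ei ek.
- by rewrite ifF //; have := ltn_ord i'; have := ltn_ord k'; lia.
- have -> : (i' == k') = (3 + k' == (i' + 3) %% 6)%N.
    by rewrite -val_eqE /=; have := ltn_ord i'; have := ltn_ord k'; lia.
  by case: ifP => _; rewrite ?expr1 ?mulr0n ?oppr0.
- have -> : (i' == k') = (k' == (3 + i' + 3) %% 6 :> nat)%N.
    by rewrite -val_eqE /=; have := ltn_ord i'; have := ltn_ord k'; lia.
  by case: ifP => _; rewrite ?expr0.
- by rewrite ifF //; have := ltn_ord i'; have := ltn_ord k'; lia.
Qed.

Lemma sadj_entry (z : 'M[K]_(3 + 3)) i j :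
  sadj z i j = (-1) ^+ (i < 3)%N * (-1) ^+ (j < 3)%N * z (partner j) (partner i).
Proof.
rewrite sadjE mxE [X in - X]mxE (bigD1 (partner j)) //= big1 ?addr0 => [|l lj]; last first.
  rewrite (sympJE l) ifF ?mulr0 //; apply: contraNF lj; rewrite -!val_eqE /= !partnerE.
  by have := ltn_ord l; have := ltn_ord j; lia.
rewrite mxE (bigD1 (partner i)) //= big1 ?addr0 => [|k ki]; last by rewrite sympJE (negPf ki) mul0r.
rewrite !sympJE eqxx [_^T _ _]mxE ifT; last first.
  by rewrite -val_eqE /= !partnerE; have := ltn_ord j; lia.
have -> : (partner j < 3)%N = ~~ (j < 3)%N by rewrite partnerE; have := ltn_ord j; lia.
by case: (j < 3)%N; rewrite /= ?expr1 ?expr0; ring.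
Qed.
End SympJEntries.

Lemma W2sharp_trace_map (A B : comNzRingType) (f : {rmorphism A -> B}) n (x y : 'M[A]_n) i :
  \tr (tnth (W2sharp (map_mx f x) (map_mx f y)) i) = f (\tr (tnth (W2sharp x y) i)).
Proof. by rewrite (W2sharp_morph _ _ _ (@map_mxM _ _ f n n n)) trace_map_mx. Qed.

Section AlgebraicIndependence.
Variable C : numClosedFieldType.

Definition line n (A B : 'M[C]_n) : 'M[{poly C}]_n := map_mx polyC A + 'X *: map_mx polyC B.

Lemma lineE n (A B : 'M[C]_n) i j : line A B i j = (A i j)%:P + 'X * (B i j)%:P.
Proof. by rewrite !mxE. Qed.

Lemma line_horner n (A B : 'M[C]_n) a : map_mx (horner_eval a) (line A B) = A + a *: B.
Proof. by apply/matrixP => i j; rewrite !mxE horner_evalE !hornerE. Qed.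

Definition sym_part (s : int) (z : 'M[C]_(3 + 3)) := 2^-1 *: (z + s%:~R *: sadj z).

Lemma xpartE z : xpart z = sym_part 1 z. Proof. by rewrite /sym_part scale1r. Qed.
Lemma ypartE z : ypart z = sym_part (-1) z. Proof. by rewrite /sym_part scaleN1r. Qed.

Lemma sym_part_line s z w a : sym_part s (z + a *: w) = sym_part s z + a *: sym_part s w.
Proof.
rewrite /sym_part sadjD sadjZ [a *: (2^-1 *: _)]scalerA [a * 2^-1]mulrC -scalerA -scalerDr.
congr (_ *: _).
by rewrite !scalerDr addrACA !scalerA [_ * a]mulrC.
Qed.

Definition int_mx (z : nat -> nat -> int) : 'M[C]_(3 + 3) := \matrix_(i, j) (z i j)%:~R.

Lemma sym_part_int_mx (s : int) z i j :
  sym_part s (2 *: int_mx z) i j = (int_part s z i j)%:~R.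
Proof.
have nz2 : (2 : C) != 0 by rewrite pnatr_eq0.
rewrite /sym_part sadjZ scalerA [_ * 2]mulrC -scalerA -scalerDr scalerA mulVf // scale1r.
rewrite mxE [X in _ + X]mxE sadj_entry [int_mx _ _ _]mxE [int_mx _ _ _]mxE !partnerE.
by rewrite /int_part /int_adj rmorphD !rmorphM !rmorphXn !rmorphN1.
Qed.

Lemma has_jet_line s z w : has_jetmx (line (sym_part s (2 *: int_mx z)) (sym_part s (2 *: int_mx w)))
  (jet_part s z w).
Proof.
move=> i j; rewrite jet_get_mx ?ltn_ord //; rewrite /has_jet lineE !sym_part_int_mx.
by split; rewrite coefD coefC coefMC coefX /= ?mul0r ?mul1r ?addr0 ?add0r.
Qed.

Theorem trW2sharp_independent : alg_independent (@trW2sharp C).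
Proof.
move=> P hP; have [F FP] := trW2sharp_poly C.
have FE i z : trW2sharp i z = (tnth F i).@[fun k => mxvec z 0 k] by case: (FP i).
pose z := 2 *: int_mx (sparse base_point).
pose w l := 2 *: int_mx (sparse (nth [::] directions l)).
pose u k := mxvec z 0 k; pose W (l : 'I_15) k := mxvec (w l) 0 k.
apply: (@jacobian_independent _ _ _ F u W); last first.
  apply: mpoly_meval_eq0 => v; rewrite comp_mpoly_meval -[RHS](hP (vec_mx (\row_k v k))).
  apply: meval_eq => i; rewrite FE; apply: meval_eq => k.
  by rewrite vec_mxK mxE.
have dirE i l : \sum_j W l j * ((tnth F i)^`M(j)).@[u] = (nth 0 (nth [::] jet_jacobian l) i)%:~R.
  pose X := line (xpart z) (xpart (w l)); pose Y := line (ypart z) (ypart (w l)).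
  (* The derivative at [z] along [w l] is the coefficient of t in the trace along z + t w, which the
     jets compute over the integers. *)
  pose h k : {poly C} := (u k)%:P + W l k *: 'X.
  have curve : mmap polyC h (tnth F i) = \tr (tnth (W2sharp X Y) i).
    apply/eqP; rewrite -subr_eq0; apply/eqP/poly_horner_eq0 => a.
    apply/eqP; rewrite hornerD hornerN subr_eq0 horner_mmap; apply/eqP.
    rewrite -[RHS]/(horner_eval a _) -W2sharp_trace_map !line_horner.
    rewrite !xpartE !ypartE -!sym_part_line -xpartE -ypartE -[RHS]/(trW2sharp i (z + a *: w l)) FE.
    apply: meval_eq => k; rewrite /h /u /W !hornerE; case/mxvec_indexP: k => p q.
    by rewrite !mxvecE [RHS]mxE [X in _ = _ + X]mxE mulrC.
  have [_ jet1] : has_jet (\tr (tnth (W2sharp X Y) i))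
      (jet_trace (nth [::] (jet_W2sharp (jet_part 1 (sparse base_point) (sparse (nth [::] directions l)))
        (jet_part (-1) (sparse base_point) (sparse (nth [::] directions l)))) i)).
    by apply/has_jet_trace/has_jet_W2sharp; rewrite /X /Y ?xpartE ?ypartE; exact: has_jet_line.
  rewrite /jet_jacobian (nth_map [::]) ?ltn_ord // (nth_map [::]) ?ltn_ord //.
  rewrite -jet1 -curve -[RHS]mulr1n -[_ *+ 1]coef_deriv -horner_coef0.
  rewrite (mmap_chain (@derivD C) (@derivM C) (@derivC C)) -[RHS]/(horner_eval 0 _) rmorph_sum.
  apply: eq_bigr => j _; rewrite rmorphM /= !horner_evalE horner_mmap mulrC; congr (_ * _).
    by apply: meval_eq => k; rewrite /h !hornerE ?mulr0 ?addr0.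
  by rewrite /h derivD derivC derivZ derivX add0r !hornerE.
rewrite det_trig; last first.
  apply/is_trig_mxP => i l lt_il; rewrite mxE dirE.
  by have := jet_jacobian_trig (ltn_ord l) (ltn_ord i); rewrite lt_il => ->.
apply/prodf_neq0 => i _; rewrite mxE dirE intr_eq0.
by have := jet_jacobian_trig (ltn_ord i) (ltn_ord i); rewrite ltnn eqxx.
Qed.
End AlgebraicIndependence.

(** Otherwise the reals, as real parts of the listed numbers, would be countable and of Lebesgue
    measure zero. *)
Lemma complex_uncountable (R : realType) (S : nat -> seq R[i]) :
  exists c, forall k, c \notin S k.
Proof.
apply: contrapT => noc.
pose A : set R := (\bigcup_(k in setT) [set` [seq complex.Re z | z <- S k]])%classic.
have cA : cardinality.countable A.
  apply: cardinality.bigcup_countable => [|k _]; first exact: cardinality.countableP.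
  by apply: cardinality.finite_set_countable; exact: cardinality.finite_seq.
have AT : A = [set: R]%classic.
  apply/seteqP; split=> // r _; apply: contrapT => nAr; apply: noc.
  exists (r%:C)%C => k; apply/negP => rS; apply: nAr; exists k => //=.
  by apply/mapP; exists (r%:C)%C.
have := lebesgue_measure.countable_lebesgue_measure0 cA.
rewrite AT -set_interval.set_itvNyy lebesgue_measure.lebesgue_measure_itv.
by [].
Qed.

Theorem theorem7p1 (R : realType) :
  is_HSOP (@trW2sharp R[i]).
Proof.
split; [exact: trW2sharp_Cbar | exact: trW2sharp_bihomogeneous | |].
  exact: trW2sharp_independent.
exact: (trW2sharp_finite (@complex_uncountable R)).
Qed.
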